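(* Let $H$ and $K$ be locally compact groups, let $\tau:H\to Aut(K)$ be a continuous homomorphism, let $G_\tau=H\ltimes_\tau K$ and let $1\le p\le\infty$. Then $L^p(G_\tau)$ with the left module action $$(f,u)\mapsto f\stackrel{\tau_l}{\ast}_{(p)}u,\qquad f\stackrel{\tau_l}{\ast}_{(p)}u(h,k)=\int_H f_t\ast u_h(k)\,\delta(t)\,dt\qquad(f\in L^1_{\tau_l}(G_\tau),\ u\in L^p(G_\tau)),$$ is a left Banach $L^1_{\tau_l}(G_\tau)$-module.
   Context: $H,K$ have left Haar measures $dh$ (also written $dt$) and $dk$ (also $ds$). A homomorphism $\tau:H\to Aut(K)$, $h\mapsto\tau_h$, is called continuous if $(h,k)\mapsto\tau_h(k)$ is continuous from $H\times K$ to $K$. The semidirect product $G_\tau=H\ltimes_\tau K$ is the set $H\times K$ with the product topology and the operation $(h,k)\ltimes_\tau(h',k')=(hh',k\tau_h(k'))$. The continuous homomorphism $\delta:H\to(0,\infty)$ is given by $dk=\delta(h)\,d(\tau_h(k))$, i.e. $|E|=\delta(h)|\tau_h(E)|$ for Haar measure $|\cdot|$ on $K$; a left Haar measure of $G_\tau$ is $\delta(h)\,dh\,dk$, and $L^p(G_\tau)$ is taken with respect to it. For a function $f$ on $G_\tau$ and $t\in H$ put $f_t(k)=f(t,k)$; $\ast$ denotes standard convolution on $K$, $\phi\ast\psi(k)=\int_K\phi(s)\psi(s^{-1}k)\,ds$. $L^1_{\tau_l}(G_\tau)$ is the Banach algebra $L^1(G_\tau)$ with the left $\tau$-convolution $f\stackrel{\tau_l}{\ast}g(h,k)=\int_H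 f_t\ast g_h(k)\,\delta(t)\,dt$. A left Banach module over a Banach algebra $\mathcal{A}$ is a Banach space $X$ with a bilinear action satisfying $(ab)\cdot x=a\cdot(b\cdot x)$ and $\|a\cdot x\|\le\|a\|\|x\|$. *)

(* Defs.v *)
From HB Require Import structures.
From mathcomp Require Import all_boot all_order all_algebra complex.
From mathcomp Require Import ring_quotient.
From mathcomp Require Import all_classical all_reals all_analysis.
From mathcomp Require Import measurable_realfun ess_sup_inf.

Set Implicit Arguments.
Unset Strict Implicit.
Unset Printing Implicit Defensive.

Import Order.TTheory GRing.Theory Num.Theory.
Import numFieldNormedType.Exports.
Import ComplexField.Normc.

Local Open Scope classical_set_scope.
Local Open Scope ring_scope.
Local Open Scope complex_scope.

HB.mixin Record PointedTopological_Group_isTopologicalGroup G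
    & PointedTopological G & Group G := {
  mulg_continuous : continuous (fun x : G * G => (x.1 * x.2)%g) ;
  invg_continuous : continuous (fun x : G => (x^-1)%g)
}.

(* The distinguished point that measurable types require is arbitrary; it is
   not assumed to be the unit of the group. *)
#[short(type="topologicalGroupType")]
HB.structure Definition TopologicalGroup :=
  {G of PointedTopological_Group_isTopologicalGroup G
      & PointedTopological G & Group G}.

Definition locally_compact_group (G : topologicalGroupType) :=
  hausdorff_space G /\ locally_compact [set: G].

Definition borel (T : ptopologicalType) := g_sigma_algebraType (@open T).
HB.instance Definition _ (T : ptopologicalType) :=
  Measurable.on (borel T).

(* Outer regular on Borel sets, but inner regular on open sets only: on groups
   that are not sigma-compact the two regularities are not interchangeable. *)
Record radon_measure (R : realType) (T : ptopologicalType)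
    (mu : {measure set (borel T) -> \bar R}) : Prop := RadonMeasure {
  radon_compact : forall C : set T, compact C -> (mu C < +oo)%E ;
  radon_outer : forall E : set (borel T), measurable E ->
    mu E = ereal_inf [set mu U | U in [set U : set T | open U /\ E `<=` U]] ;
  radon_inner : forall U : set T, open U ->
    mu U = ereal_sup [set mu C | C in [set C : set T | compact C /\ C `<=` U]]
}.

Record left_haar_measure (R : realType) (G : topologicalGroupType)
    (mu : {measure set (borel G) -> \bar R}) : Prop := LeftHaarMeasure {
  haar_radon : radon_measure mu ;
  haar_neq0 : mu setT != 0%E ;
  haar_left : forall (g : G) (E : set (borel G)), measurable E ->
    mu [set (g * x)%g | x in (E : set G)] = mu E
}.

(* A continuous homomorphism from H to the automorphism group of K.  Each
   automorphism is bicontinuous because its inverse is the one attached to the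
   inverse of h. *)
Record cont_hom_aut (H K : topologicalGroupType) := ContHomAut {
  cha_fun :> H -> K -> K ;
  cha_bij : forall h, bijective (cha_fun h) ;
  cha_morph : forall h, {morph cha_fun h : x y / (x * y)%g} ;
  cha_mul : forall h h' k, cha_fun (h * h')%g k = cha_fun h (cha_fun h' k) ;
  cha_continuous : continuous (fun x : H * K => cha_fun x.1 x.2)
}.

(* An alias, so that the group law is not the one of the direct product. *)
Definition semidirect (H K : topologicalGroupType) (tau : cont_hom_aut H K) :
  Type := (H * K)%type.

Section SemidirectProduct.
Variables (H K : topologicalGroupType) (tau : cont_hom_aut H K).
Local Notation semidirect := (semidirect tau).

Definition sdprod_mul (x y : semidirect) : semidirect :=
  ((x.1 * y.1)%g, (x.2 * tau x.1 y.2)%g).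
Definition sdprod_one : semidirect := (1%g, 1%g).
Definition sdprod_inv (x : semidirect) : semidirect :=
  ((x.1^-1)%g, tau (x.1^-1)%g (x.2^-1)%g).

HB.instance Definition _ := Topological.copy semidirect (H * K)%type.
HB.instance Definition _ := Pointed.copy semidirect (H * K)%type.

Local Lemma cha1 k : tau 1%g k = k.
Proof. by apply: (bij_inj (cha_bij tau 1%g)); rewrite -cha_mul mulg1. Qed.

Local Lemma cha_one h : tau h 1%g = 1%g.
Proof. by apply: (@mulgI _ (tau h 1%g)); rewrite -cha_morph !mulg1. Qed.

Local Lemma sdprod_mulA : associative sdprod_mul.
Proof.
move=> [a x] [b y] [c z]; rewrite /sdprod_mul/=.
by rewrite cha_morph cha_mul !mulgA.
Qed.

Local Lemma sdprod_mul1 : left_id sdprod_one sdprod_mul.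
Proof. by move=> [a x]; rewrite /sdprod_mul/= cha1 !mul1g. Qed.

Local Lemma sdprod_mulr1 : right_id sdprod_one sdprod_mul.
Proof. by move=> [a x]; rewrite /sdprod_mul/= cha_one !mulg1. Qed.

Local Lemma sdprod_mulV : left_inverse sdprod_one sdprod_inv sdprod_mul.
Proof.
by move=> [a x]; rewrite /sdprod_mul/= -cha_morph !mulVg cha_one.
Qed.

Local Lemma sdprod_mulrV : right_inverse sdprod_one sdprod_inv sdprod_mul.
Proof.
by move=> [a x]; rewrite /sdprod_mul/= -cha_mul !mulgV cha1 mulgV.
Qed.

HB.instance Definition _ := isGroup.Build semidirect
  sdprod_mulA sdprod_mul1 sdprod_mulr1 sdprod_mulV sdprod_mulrV.

Local Lemma continuous_pair_fun (X A B : topologicalType)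
    (f : X -> A) (g : X -> B) :
  continuous f -> continuous g -> continuous (fun x => (f x, g x)).
Proof. by move=> cf cg x; apply: cvg_pair; [exact: cf | exact: cg]. Qed.

Local Lemma continuous_fst_comp (X A B : topologicalType) (f : X -> A * B) :
  continuous f -> continuous (fun x => (f x).1).
Proof. by move=> cf x; apply: (cvg_comp _ _ (cf x)); exact: cvg_fst. Qed.

Local Lemma continuous_snd_comp (X A B : topologicalType) (f : X -> A * B) :
  continuous f -> continuous (fun x => (f x).2).
Proof. by move=> cf x; apply: (cvg_comp _ _ (cf x)); exact: cvg_snd. Qed.

Local Lemma continuous_comp_fun (X A B : topologicalType)
    (f : X -> A) (g : A -> B) :
  continuous f -> continuous g -> continuous (fun x => g (f x)).
Proof. by move=> cf cg x; apply: continuous_comp; [exact: cf | exact: cg]. Qed.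

Local Lemma continuous_idfun (X : topologicalType) : continuous (fun x : X => x).
Proof. by move=> x. Qed.

Local Lemma sdprod_mul_continuous :
  continuous (fun x : semidirect * semidirect => (x.1 * x.2)%g).
Proof.
have c1 : continuous (fun x : (H * K) * (H * K) => x.1).
  exact/continuous_fst_comp/continuous_idfun.
have c2 : continuous (fun x : (H * K) * (H * K) => x.2).
  exact/continuous_snd_comp/continuous_idfun.
have c11 := continuous_fst_comp c1; have c12 := continuous_snd_comp c1.
have c21 := continuous_fst_comp c2; have c22 := continuous_snd_comp c2.
apply: (@continuous_pair_fun ((H * K) * (H * K))%type H K).
  exact: (continuous_comp_fun (continuous_pair_fun c11 c21)
                              (@mulg_continuous H)).
exact: (continuous_comp_fun (continuous_pair_fun c12
    (continuous_comp_fun (continuous_pair_fun c11 c22)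
                         (@cha_continuous _ _ tau)))
  (@mulg_continuous K)).
Qed.

Local Lemma sdprod_inv_continuous : continuous (fun x : semidirect => (x^-1)%g).
Proof.
have c1 : continuous (fun x : H * K => (x.1^-1)%g).
  apply: continuous_comp_fun (@invg_continuous H).
  exact/continuous_fst_comp/continuous_idfun.
have c2 : continuous (fun x : H * K => (x.2^-1)%g).
  apply: continuous_comp_fun (@invg_continuous K).
  exact/continuous_snd_comp/continuous_idfun.
apply: (@continuous_pair_fun (H * K)%type H K) => //.
exact: (continuous_comp_fun (continuous_pair_fun c1 c2)
                            (@cha_continuous _ _ tau)).
Qed.

HB.instance Definition _ :=
  PointedTopological_Group_isTopologicalGroup.Build semidirect
    sdprod_mul_continuous sdprod_inv_continuous.

End SemidirectProduct.

Section ComplexFunctions.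
Context d (T : measurableType d) (R : realType).
Implicit Types (f : T -> R[i]) (mu : {measure set T -> \bar R}).

Definition cmeasurable f :=
  measurable_fun setT (fun x => complex.Re (f x)) /\
  measurable_fun setT (fun x => complex.Im (f x)).

Definition cintegrable mu f :=
  mu.-integrable setT (fun x => (complex.Re (f x))%:E) /\
  mu.-integrable setT (fun x => (complex.Im (f x))%:E).

Definition cintegral mu f : R[i] :=
  Rintegral mu setT (fun x => complex.Re (f x)) +i*
  Rintegral mu setT (fun x => complex.Im (f x)).

Definition cLnorm mu (p : \bar R) f : \bar R :=
  'N[mu]_p[EFin \o (fun x => normc (f x))]%E.

End ComplexFunctions.

Section ComplexLnormTheory.
Context d (T : measurableType d) (R : realType).
Variables (mu : {measure set T -> \bar R}) (p : \bar R) (p1 : (1 <= p)%E).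
Implicit Types (f g : T -> R[i]).

Local Lemma cmeasurable_cst (c : R[i]) : cmeasurable (fun _ : T => c).
Proof. by split; exact: measurable_cst. Qed.

Local Lemma ReD (x y : R[i]) : complex.Re (x + y) = complex.Re x + complex.Re y.
Proof. by case: x y => [a b] [c e]. Qed.

Local Lemma ImD (x y : R[i]) : complex.Im (x + y) = complex.Im x + complex.Im y.
Proof. by case: x y => [a b] [c e]. Qed.

Local Lemma ReM (x y : R[i]) : complex.Re (x * y) =
  complex.Re x * complex.Re y - complex.Im x * complex.Im y.
Proof. by case: x y => [a b] [c e]. Qed.

Local Lemma ImM (x y : R[i]) : complex.Im (x * y) =
  complex.Re x * complex.Im y + complex.Im x * complex.Re y.
Proof. by case: x y => [a b] [c e]. Qed.

Local Lemma cmeasurableD f g :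
  cmeasurable f -> cmeasurable g -> cmeasurable (f + g).
Proof.
move=> [f1 f2] [g1 g2]; split.
- by under eq_fun do rewrite ReD; exact: measurable_funD.
- by under eq_fun do rewrite ImD; exact: measurable_funD.
Qed.

Local Lemma cmeasurableZ a f : cmeasurable f -> cmeasurable (a *: f).
Proof.
move=> [f1 f2]; split.
- under eq_fun do rewrite ReM; apply: measurable_funB.
    by apply: measurable_funM => //; exact: measurable_cst.
  by apply: measurable_funM => //; exact: measurable_cst.
- under eq_fun do rewrite ImM; apply: measurable_funD.
    by apply: measurable_funM => //; exact: measurable_cst.
  by apply: measurable_funM => //; exact: measurable_cst.
Qed.

Local Lemma normcE (z : R[i]) :
  normc z = Num.sqrt (complex.Re z ^+ 2 + complex.Im z ^+ 2).
Proof. by case: z. Qed.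

Local Lemma normc_ge0 (z : R[i]) : 0 <= normc z.
Proof. by rewrite normcE sqrtr_ge0. Qed.

Local Lemma measurable_normc f :
  cmeasurable f -> measurable_fun setT (fun x => normc (f x)).
Proof.
move=> [f1 f2]; under eq_fun do rewrite normcE.
apply: (@measurableT_comp _ _ _ _ _ _ (@Num.sqrt R)).
  by apply: continuous_measurable_fun; exact: sqrt_continuous.
by apply: measurable_funD; exact: measurable_funX.
Qed.

Local Lemma le_Lnorm (f g : T -> R) :
  measurable_fun setT f -> measurable_fun setT g ->
  (forall x, 0 <= f x <= g x) ->
  ('N[mu]_p[EFin \o f] <= 'N[mu]_p[EFin \o g])%E.
Proof.
move=> mf mg fg; rewrite unlock /Lnorm.
case: p p1 => [r|_|//].
- rewrite lee_fin => r1; have r0 : 0 <= r by rewrite (le_trans _ r1).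
  have mpow (h : T -> R) : measurable_fun setT h ->
      measurable_fun setT (fun x => (`|(EFin \o h) x| `^ r)%E).
    move=> mh; apply: (measurableT_comp (measurable_poweR _)).
    by apply: measurableT_comp => //; exact/measurable_EFinP.
  have le0 (h : T -> R) : (0 <= \int[mu]_x `|(EFin \o h) x| `^ r)%E.
    by apply: integral_ge0 => x _; exact: poweR_ge0.
  rewrite gt0_ler_poweR ?invr_ge0 ?in_itv/= ?le0 ?leey//.
  apply: ge0_le_integral => //=.
  + exact: (mpow f).
  + exact: (mpow g).
  + move=> x _; rewrite lee_fin; have /andP[f0 fgx] := fg x.
    by rewrite ge0_ler_powR ?nnegrE ?normr_ge0 ?ger0_norm// (le_trans f0).
- case: ifPn => // _; apply: le_ess_sup; apply: nearW => x /=.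
  rewrite lee_fin; have /andP[f0 fgx] := fg x.
  by rewrite !ger0_norm// (le_trans f0).
Qed.

Local Lemma le_cLnormD f g : cmeasurable f -> cmeasurable g ->
  (cLnorm mu p (f + g)%R <= cLnorm mu p f + cLnorm mu p g)%E.
Proof.
move=> mf mg.
have nf := measurable_normc mf; have ng := measurable_normc mg.
apply: le_trans (eminkowski mu nf ng p1).
apply: le_Lnorm.
- exact/measurable_normc/cmeasurableD.
- exact: measurable_funD.
- by move=> x; rewrite normc_ge0/=; exact: le_normcD.
Qed.

Local Lemma cLnorm_ge0 f : (0 <= cLnorm mu p f)%E.
Proof. exact: Lnorm_ge0. Qed.

Local Lemma cLnormZ a f : cmeasurable f -> (cLnorm mu p f < +oo)%E ->
  cLnorm mu p (a *: f) = ((normc a)%:E * cLnorm mu p f)%E.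
Proof.
move=> mf ff.
have nf := measurable_normc mf.
have Lf : (fun x => normc (f x)) \in Lfun mu p.
  by rewrite inE; apply/andP; split; rewrite inE.
have := LnormZ (Lfun_Sub p1 Lf) (normc a).
rewrite ger0_norm ?normc_ge0// /cLnorm => <-; congr Lnorm.
by apply/funext => x /=; rewrite normcM.
Qed.

Local Lemma cLnorm_eq0 f : cmeasurable f ->
  (cLnorm mu p f = 0)%E <-> (\forall x \ae mu, f x = 0).
Proof.
move=> mf; have nf := measurable_normc mf.
have p0 : (0 < p)%E by exact: lt_le_trans p1.
split => [f0|f0].
- have /measurable_EFinP nf' := nf.
  apply: filterS (Lnorm_eq0_eq0 nf' p0 f0) => x /(_ I) /= [].
  exact: eq0_normc.
- rewrite /cLnorm unlock /Lnorm; case: p p1 p0 => [r r1|_|//]; rewrite ?lte_fin.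
  + move=> r0; rewrite (ae_eq_integral (cst 0%E)) ?integral0//.
    * by rewrite poweR0r// invr_neq0// gt_eqF.
    * apply: (measurableT_comp (measurable_poweR _)).
      by apply: measurableT_comp => //; exact/measurable_EFinP.
    * apply: filterS f0 => x fx _ /=.
      by rewrite fx normc0 normr0 powR0// gt_eqF.
  + move=> _; case: ifPn => // mu0; apply: ess_sup_ae_cst => //.
    by apply: filterS f0 => x fx /=; rewrite fx normc0 normr0.
Qed.

End ComplexLnormTheory.

(* The proof of 1 <= p is an argument because the vector space structures below
   depend on it.  Functions are Borel; for p = +oo the norm is the essential
   supremum modulo null (not locally null) sets. *)
Definition cLfun d (T : measurableType d) (R : realType)
    (mu : {measure set T -> \bar R}) (p : \bar R) (p1 : (1 <= p)%E) :
    {pred T -> R[i]} :=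
  mem [set f | cmeasurable f /\ (cLnorm mu p f < +oo)%E].

Section LpSpace.
Context d (T : measurableType d) (R : realType).
Variables (mu : {measure set T -> \bar R}) (p : \bar R) (p1 : (1 <= p)%E).

Local Lemma cLfunP f :
  reflect (cmeasurable f /\ (cLnorm mu p f < +oo)%E) (f \in cLfun mu p1).
Proof. by apply: (iffP idP) => [/set_mem|/mem_set]. Qed.

Local Lemma cLfun_submod_closed : submod_closed (cLfun mu p1).
Proof.
split.
  apply/cLfunP; split; first exact: cmeasurable_cst.
  have /(cLnorm_eq0 mu p1)[_ ->] : cmeasurable (0 : T -> R[i]).
  - exact: cmeasurable_cst.
  - by [].
  - exact: nearW.
move=> a f g /cLfunP[mf lf] /cLfunP[mg lg]; apply/cLfunP; split.
  by apply: cmeasurableD => //; exact: cmeasurableZ.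
apply: le_lt_trans (le_cLnormD mu p1 (cmeasurableZ a mf) mg) _.
rewrite lte_add_pinfty// cLnormZ//.
by rewrite lte_mul_pinfty// ?lee_fin ?normc_ge0.
Qed.

HB.instance Definition _ :=
  GRing.isSubmodClosed.Build R[i] (T -> R[i]) (cLfun mu p1)
    cLfun_submod_closed.

Record cLfunType := CLfunType {
  cLfun_val :> T -> R[i] ;
  _ : cLfun_val \in cLfun mu p1
}.
HB.instance Definition _ := [isSub for cLfun_val].
HB.instance Definition _ := [Choice of cLfunType by <:].
HB.instance Definition _ := [SubChoice_isSubLmodule of cLfunType by <:].

Implicit Types (f g : cLfunType).

Local Lemma cLfun_measurable f : cmeasurable f.
Proof. by case: f => f /= /cLfunP[]. Qed.

Local Lemma cLfun_lty f : (cLnorm mu p f < +oo)%E.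
Proof. by case: f => f /= /cLfunP[]. Qed.

Definition cLnull : {pred cLfunType} :=
  mem [set f : cLfunType | \forall x \ae mu, f x = 0].

Local Lemma cLnullP f : reflect (\forall x \ae mu, f x = 0) (f \in cLnull).
Proof. by apply: (iffP idP) => [/set_mem|/mem_set]. Qed.

Local Lemma cLnull_zmod_closed : zmod_closed cLnull.
Proof.
split; first by apply/cLnullP; exact: nearW.
move=> f g /cLnullP f0 /cLnullP g0; apply/cLnullP.
apply: filterS2 f0 g0 => x fx gx; rewrite [LHS](_ : _ = f x - g x)//.
by rewrite fx gx subrr.
Qed.

HB.instance Definition _ :=
  GRing.isZmodClosed.Build cLfunType cLnull cLnull_zmod_closed.

Definition cLspace : Type := Quotient.quot cLnull.
HB.instance Definition _ := GRing.Zmodule.on cLspace.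
HB.instance Definition _ := EqQuotient.on cLspace.

Local Open Scope quotient_scope.

Local Notation class f := (\pi_cLspace f).

Local Lemma eq_class f g : (class f = class g) <-> (f - g \in cLnull).
Proof.
by split => [/eqmodP|h]; [|apply/eqmodP].
Qed.

Local Lemma classD f g : class (f + g) = class f + class g.
Proof. exact: (@Quotient.pi_add _ cLnull f g). Qed.

Local Lemma class_repr (x : cLspace) : class (repr x) = x.
Proof. exact: reprK. Qed.

Definition cLspace_scale (a : R[i]) (x : cLspace) : cLspace :=
  class (a *: repr x).

Local Lemma class_scale a f : cLspace_scale a (class f) = class (a *: f).
Proof.
apply/eq_class; rewrite -scalerBr; apply/cLnullP.
have /eq_class/cLnullP : class (repr (class f)) = class f by exact: class_repr.
apply: filterS => x h; rewrite [LHS](_ : _ = a * (repr (class f) - f) x)//.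
by rewrite h mulr0.
Qed.

Local Lemma cLspace_scaleA a b x :
  cLspace_scale a (cLspace_scale b x) = cLspace_scale (a * b) x.
Proof. by rewrite -(class_repr x) !class_scale scalerA. Qed.

Local Lemma cLspace_scale1 : left_id 1 cLspace_scale.
Proof. by move=> x; rewrite -(class_repr x) class_scale scale1r. Qed.

Local Lemma cLspace_scaleDr : right_distributive cLspace_scale +%R.
Proof.
move=> a x y; rewrite -(class_repr x) -(class_repr y) -classD !class_scale.
by rewrite -classD scalerDr.
Qed.

Local Lemma cLspace_scaleDl x :
  {morph cLspace_scale^~ x : a b / a + b >-> a + b}.
Proof.
move=> a b; rewrite -(class_repr x) !class_scale.
by rewrite -classD scalerDl.
Qed.

HB.instance Definition _ := GRing.Zmodule_isLmodule.Build R[i] cLspace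
  cLspace_scaleA cLspace_scale1 cLspace_scaleDr cLspace_scaleDl.

Definition cLspace_norm (x : cLspace) : R[i] :=
  (fine (cLnorm mu p (repr x)))%:C.

Local Lemma cLnorm_fin f : cLnorm mu p f \is a fin_num.
Proof. by rewrite ge0_fin_numE ?cLnorm_ge0// cLfun_lty. Qed.

Local Lemma cLnorm_le f g : f - g \in cLnull ->
  (cLnorm mu p f <= cLnorm mu p g)%E.
Proof.
move=> /cLnullP h; rewrite -[f in leLHS](subrK g).
apply: le_trans
  (le_cLnormD mu p1 (cLfun_measurable (f - g)) (cLfun_measurable g)) _.
have /(cLnorm_eq0 mu p1)[_ ->//] := cLfun_measurable (f - g).
by rewrite add0e.
Qed.

Local Lemma norm_class f : cLspace_norm (class f) = (fine (cLnorm mu p f))%:C.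
Proof.
rewrite /cLspace_norm; congr (fine _)%:C; apply/eqP; rewrite eq_le.
have e : class (repr (class f)) = class f by exact: class_repr.
by rewrite !cLnorm_le//; apply/eq_class.
Qed.

Local Lemma cLspace_normD x y :
  cLspace_norm (x + y) <= cLspace_norm x + cLspace_norm y.
Proof.
rewrite -(class_repr x) -(class_repr y) -classD !norm_class -rmorphD/= lecR.
rewrite -lee_fin EFinD !fineK ?cLnorm_fin//.
  exact: (le_cLnormD mu p1 (cLfun_measurable _) (cLfun_measurable _)).
exact: (cLnorm_fin (repr x + repr y)).
Qed.

Local Lemma cLspace_normZ a x : cLspace_norm (a *: x) = `|a| * cLspace_norm x.
Proof.
rewrite -(class_repr x) [_ *: _]class_scale !norm_class.
rewrite (cLnormZ p1 a (cLfun_measurable _) (cLfun_lty _)).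
by rewrite fineM ?cLnorm_fin// rmorphM.
Qed.

Local Lemma cLspace_norm_eq0 x : cLspace_norm x = 0 -> x = 0.
Proof.
rewrite -(class_repr x) norm_class => -[] h.
have : cLnorm mu p (repr x) = 0%E.
  by rewrite -[LHS]fineK ?cLnorm_fin// h.
move=> /(cLnorm_eq0 mu p1 (cLfun_measurable _)) h0.
rewrite -[0 in RHS](class_repr 0); apply/eq_class.
have h1 : (repr (0 : cLspace)) \in cLnull.
  rewrite -[X in X \in _]subr0; apply/eq_class; rewrite class_repr.
  by apply: (@addrI _ (class 0)); rewrite -classD !addr0.
by rewrite rpredB//; apply/cLnullP.
Qed.

HB.instance Definition _ := Lmodule_isNormed.Build R[i] cLspace
  cLspace_normD cLspace_normZ cLspace_norm_eq0.

(* The class of a function, with the junk value 0 outside cLfun. *)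
Definition cLclass (f : T -> R[i]) : cLspace := class (insubd 0 f).

End LpSpace.

Section BanachModules.
Variable K : numFieldType.

Definition banach_space (X : normedModType K) : Prop :=
  forall F : set_system X, ProperFilter F -> cauchy F -> cvg F.

Definition bilinear_map (X Y Z : lmodType K) (m : X -> Y -> Z) : Prop :=
  (forall y, linear (m ^~ y)) /\ (forall x, linear (m x)).

Record banach_algebra (A : normedModType K) (mul : A -> A -> A) : Prop :=
  BanachAlgebra {
  ba_banach : banach_space A ;
  ba_bilinear : bilinear_map mul ;
  ba_assoc : associative mul ;
  ba_norm : forall a b, `|mul a b| <= `|a| * `|b|
}.

Record left_banach_module (A : normedModType K) (mul : A -> A -> A)
    (X : normedModType K) (act : A -> X -> X) : Prop := LeftBanachModule {
  lbm_algebra : banach_algebra mul ;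
  lbm_banach : banach_space X ;
  lbm_bilinear : bilinear_map act ;
  lbm_assoc : forall a b x, act (mul a b) x = act a (act b x) ;
  lbm_norm : forall a x, `|act a x| <= `|a| * `|x|
}.

End BanachModules.

Section LeftTauConvolution.
Variables (R : realType) (H K : topologicalGroupType) (tau : cont_hom_aut H K).
Variables (muH : {measure set (borel H) -> \bar R}).
Variables (muK : {measure set (borel K) -> \bar R}).
Variable delta : H -> R.

Record is_modulus : Prop := IsModulus {
  modulus_gt0 : forall h, 0 < delta h ;
  modulus_mul : forall h h', delta (h * h')%g = delta h * delta h' ;
  modulus_continuous : continuous delta ;
  modulus_scale : forall (h : H) (E : set (borel K)), measurable E ->
    muK E = ((delta h)%:E * muK [set tau h k | k in (E : set K)])%E
}.

Local Notation G := (borel (semidirect tau)).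

(* lam = delta(h) dh dk as a Radon measure, that is, the measure of the positive
   functional given by the iterated integral on continuous functions with
   compact support.  Without sigma-finiteness, iterated integrals of indicators of
   Borel sets need not agree with that measure. *)
Definition is_delta_dh_dk (lam : {measure set G -> \bar R}) : Prop :=
  forall phi : semidirect tau -> R,
    continuous phi -> compact (closure [set x | phi x != 0]) ->
  Rintegral lam setT phi =
  Rintegral muH setT
    (fun h => Rintegral muK setT (fun k => phi (h, k)) * delta h).

Definition conv (phi psi : K -> R[i]) (k : K) : R[i] :=
  cintegral muK (fun s => phi s * psi (s^-1 * k)%g).

Definition tau_conv (f u : G -> R[i]) (x : G) : R[i] :=
  cintegral muH (fun t =>
    conv (fun s => f (t, s)) (fun s => u (x.1, s)) x.2 * (delta t)%:C).

(* cintegral is total, with junk values for non-integrable functions; this says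
   that the two integrals defining tau_conv f u x converge absolutely. *)
Definition tau_conv_converges (f u : G -> R[i]) (x : G) : Prop :=
  (\forall t \ae muH,
    cintegrable muK (fun s : borel K => f (t, s) * u (x.1, (s^-1 * x.2)%g))) /\
  cintegrable muH (fun t =>
    conv (fun s => f (t, s)) (fun s => u (x.1, s)) x.2 * (delta t)%:C).

Variable lam : {measure set G -> \bar R}.

(* For p = 1 this is the product of the algebra L^1_{tau_l}. *)
Definition tau_act (p : \bar R) (p1 : (1 <= p)%E)
    (a : cLspace lam (lexx (1 : \bar R)%E)) (x : cLspace lam p1) : cLspace lam p1 :=
  cLclass lam p1 (tau_conv (repr a) (repr x)).

End LeftTauConvolution.

(* Main.v *)
(** For f, g, u >= 0 the action can be written as one integral over the group,
    (f . u)(x) = \int_G f(y) u(x.1, y.2^-1 x.2) dlam(y),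
    because lam = delta(t) dt ds.  In this form associativity is Tonelli's theorem
    together with the invariance of lam under left translation by (1, s), and
    |f . u|_p <= |f|_1 |u|_p is Hoelder's inequality for the measure |f| dlam,
    followed by the same two facts.  The general case follows: bilinearity reduces
    associativity to nonnegative functions, and domination by |f| . |u| gives
    convergence almost everywhere and the norm estimate.

    The groups need not be sigma-compact and Borel sets of a product need not lie
    in the product sigma-algebra, so the standard Tonelli theorem does not apply.
    An integrable function vanishes outside a box A x B, with A and B
    open sigma-compact subgroups of H and K.  On such a box, Haar measure is
    sigma-finite and every open set is, up to a null set, a countable union of open
    rectangles; measures with this last property are determined by their values on
    open rectangles.  The formula lam = delta(t) dt ds, known for compactly
    supported continuous functions, reaches open rectangles by Urysohn cutoffs. *)

Require Import Defs.
From HB Require Import structures.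
From mathcomp Require Import all_boot all_order all_algebra complex finmap.
From mathcomp Require Import all_classical all_reals all_analysis.
From mathcomp Require Import measurable_realfun ess_sup_inf lra.

Set Implicit Arguments.
Unset Strict Implicit.
Unset Printing Implicit Defensive.

Import Order.TTheory GRing.Theory Num.Theory.
Import numFieldNormedType.Exports.
Import ComplexField.Normc.

Local Open Scope classical_set_scope.
Local Open Scope ring_scope.

(** * Borel measures *)

(** Two facts carry the measure theory. For an open set in a product, the measure of the section is
    lower semicontinuous, because a compact part of one section stays inside the neighbouring
    sections by the tube lemma; this replaces the measurability that the product sigma-algebra would
    give. And an open subset of X x V, with V of finite measure, is filled in almost every section
    by countably many rectangles, found from rational lower bounds on the section measure. Boxes are
    subgroups, so that translation by (1, s) with s in B preserves them, and closed as well as open,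
    so that what sticks out of a box is again open and cannot be null unless empty. For p = +oo the
    function u need not vanish outside any box; only f and the exceptional null set of u are
    enclosed in one. Completeness of L^p is proved for Cauchy filters, with limits formed as upper
    limits so that they are Borel functions defined everywhere. *)

Section Disintegration.
Context d1 d2 (S : measurableType d1) (T : measurableType d2) (R : realType).
Variables (n : {measure set S -> \bar R}) (l : S -> {measure set T -> \bar R}).
Hypothesis ml : forall E, measurable E -> measurable_fun setT (l ^~ E).
Variable nu : {measure set T -> \bar R}.
Hypothesis nuE : forall E, measurable E -> nu E = (\int[n]_y l y E)%E.
Import HBNNSimple.
Local Open Scope ereal_scope.

Lemma disintegration_nnsfun (f : {nnsfun T >-> R}) :
  \int[nu]_x (f x)%:E = \int[n]_y \int[l y]_x (f x)%:E.
Proof.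
rewrite integralT_nnsfun sintegralE.
under [RHS]eq_integral do rewrite integralT_nnsfun sintegralE.
rewrite ge0_integral_fsum//; last 2 first.
- by move=> r; apply: measurable_funeM; exact: ml.
- by move=> r y _; apply: nnsfun_mulemu_ge0.
apply: eq_fsbigr => r _; rewrite nuE//.
(* [ge0_integralZl] needs a nonnegative factor; at negative r the level set of a nonnegative simple
   function is empty and both sides vanish. *)
have [r0|r0] := leP 0%R r; first by rewrite ge0_integralZl//; exact: ml.
have f0 : f @^-1` [set r] = set0 by exact: preimage_nnfun0.
rewrite f0; under eq_integral do rewrite measure0.
under [RHS]eq_integral do rewrite measure0 mule0.
by rewrite !integral0 mule0.
Qed.

(** Monotone convergence passes from simple functions to f in both integrals, which keeps the
    identity valid for measures without any finiteness. It serves for restrictions and for both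
    iterated product measures. *)
Lemma disintegration (f : T -> \bar R) : (forall x, 0 <= f x) ->
  measurable_fun setT f -> \int[nu]_x f x = \int[n]_y \int[l y]_x f x.
Proof.
move=> f0 mf; pose f_ := nnsfun_approx measurableT mf.
have ndf x : {homo (fun k => (f_ k x)%:E) : a b / (a <= b)%N >-> a <= b}.
  by move=> a b ab; rewrite lee_fin; exact/lefP/nd_nnsfun_approx.
have limE (mu : {measure set T -> \bar R}) :
    \int[mu]_x f x = limn (fun k => \int[mu]_x (f_ k x)%:E).
  rewrite -monotone_convergence//.
  - by apply: eq_integral => x _; apply/esym/cvg_lim => //; exact: cvg_nnsfun_approx.
  - by move=> k; exact/measurable_EFinP.
  - by move=> k x _; rewrite lee_fin.
rewrite limE; under [RHS]eq_integral do rewrite limE.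
rewrite monotone_convergence//.
- by apply: congr_lim; apply/funext => k; exact: disintegration_nnsfun.
- move=> k; apply: measurable_fun_integral_kernel => //.
    by move=> x; rewrite lee_fin.
  exact/measurable_EFinP.
- by move=> k y _; apply: integral_ge0 => x _; rewrite lee_fin.
- move=> y _ a b ab; apply: ge0_le_integral => //.
  + by move=> x _; rewrite lee_fin.
  + exact/measurable_EFinP.
  + exact/measurable_EFinP.
  + by move=> x _; exact: ndf.
Qed.

End Disintegration.

Lemma ae_mono d (T : measurableType d) (R : realType)
    (mu : {measure set T -> \bar R}) (P Q : T -> Prop) :
  (forall x, P x -> Q x) -> (\forall x \ae mu, P x) -> \forall x \ae mu, Q x.
Proof. by move=> PQ; exact: filterS. Qed.

Lemma ae_all d (T : measurableType d) (R : realType)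
    (mu : {measure set T -> \bar R}) (P : T -> Prop) :
  (forall x, P x) -> \forall x \ae mu, P x.
Proof. by move=> aP; exact: nearW. Qed.

Section Mixture.
Context d1 d2 (S : measurableType d1) (T : measurableType d2) (R : realType).
Variables (n : {measure set S -> \bar R}) (l : S -> {measure set T -> \bar R}).
Hypothesis ml : forall E, measurable E -> measurable_fun setT (l ^~ E).
Local Open Scope ereal_scope.

(** The measurability proof is an argument so that the measure structure, whose sigma-additivity
    depends on it, can be attached to [mixture ml] itself. *)
Definition mixture (_ : forall E, measurable E -> measurable_fun setT (l ^~ E))
  (E : set T) : \bar R := \int[n]_y l y E.

Local Lemma mixture0 : mixture ml set0 = 0.
Proof. by rewrite /mixture; under eq_integral do rewrite measure0; rewrite integral0. Qed.

Local Lemma mixture_ge0 E : 0 <= mixture ml E.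
Proof. by apply: integral_ge0 => y _; exact: measure_ge0. Qed.

Local Lemma mixture_sigma_additive : semi_sigma_additive (mixture ml).
Proof.
move=> F mF tF mUF; rewrite /mixture.
under eq_integral do rewrite measure_semi_bigcup//.
rewrite integral_nneseries//; last by move=> i; exact: ml.
by apply: is_cvg_nneseries => i _ _; exact: mixture_ge0.
Qed.

HB.instance Definition _ := isMeasure.Build _ _ _ (mixture ml)
  mixture0 mixture_ge0 mixture_sigma_additive.

End Mixture.

Section BorelSets.
Context (R : realType).

Lemma open_borel (T : ptopologicalType) (U : set T) :
  open U -> measurable (U : set (borel T)).
Proof. by move=> oU; exact: (@sub_sigma_algebra _ setT (@open T)). Qed.

Lemma closed_borel (T : ptopologicalType) (U : set T) :
  closed U -> measurable (U : set (borel T)).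
Proof.
by move=> cU; rewrite -(setCK U); apply: measurableC; apply: open_borel; exact: closed_openC.
Qed.

Lemma compact_borel (T : ptopologicalType) (C : set T) :
  hausdorff_space T -> compact C -> measurable (C : set (borel T)).
Proof. by move=> hT cC; apply: closed_borel; exact: compact_closed. Qed.

Lemma continuous_borel (S T : ptopologicalType) (f : S -> T) :
  continuous f -> measurable_fun setT (f : borel S -> borel T).
Proof.
move=> /continuousP cf.
apply: (@measurability _ _ (borel S) (borel T) setT f (@open T)) => //.
by move=> _ [U oU <-]; rewrite setTI; apply: open_borel; exact: cf.
Qed.

Lemma continuous_borel_real (S : ptopologicalType) (f : S -> R) :
  continuous f -> measurable_fun setT (f : borel S -> R).
Proof.
move=> /continuousP cf.
apply: (measurability _ (RGenOpens.measurableE R)) => // _ [_ [a [b ->]] <-].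
by rewrite setTI; apply: open_borel; apply: cf; exact: interval_open.
Qed.

(** Measurability of lower semicontinuous functions; section measures of open sets are of this
    kind. *)
Lemma open_superlevel_measurable (T : ptopologicalType) (f : T -> \bar R) :
  (forall c : R, open [set x | (c%:E < f x)%E]) ->
  measurable_fun setT (f : borel T -> \bar R).
Proof.
move=> of_; apply: (measurability _ (ErealGenOInfty.measurableE R)) => //.
by move=> _ [_ [x ->] <-]; rewrite setTI preimage_itvoy; exact: open_borel.
Qed.

End BorelSets.

Section ContinuousImage.
Context (R : realType) (S T : ptopologicalType).
Variables (g : S -> T) (cg : continuous g) (m : {measure set (borel S) -> \bar R}).
Local Open Scope ereal_scope.

(** As for [mixture], the proof of continuity is an argument so that the measure instance can depend
    on it. *)
Definition image_measure (_ : continuous g) (E : set (borel T)) : \bar R :=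
  m (g @^-1` E).

Lemma preimage_borel (E : set (borel T)) : measurable E ->
  measurable (g @^-1` E : set (borel S)).
Proof.
by move=> mE; rewrite -[X in measurable X]setTI; exact: (continuous_borel cg).
Qed.

Local Lemma image_measure0 : image_measure cg set0 = 0.
Proof. exact: measure0. Qed.

Local Lemma image_measure_ge0 E : 0 <= image_measure cg E.
Proof. exact: measure_ge0. Qed.

Local Lemma image_measure_sigma_additive : semi_sigma_additive (image_measure cg).
Proof.
move=> F mF tF mUF; rewrite /image_measure preimage_bigcup.
apply: measure_semi_sigma_additive.
- by move=> i; exact: preimage_borel.
- by move=> i j _ _ [x [Fi Fj]]; apply: (tF i j I I); exists (g x).
- by apply: bigcupT_measurable => i; exact: preimage_borel.
Qed.

HB.instance Definition _ := isMeasure.Build _ _ _ (image_measure cg)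
  image_measure0 image_measure_ge0 image_measure_sigma_additive.

Lemma integral_image_measure (w : T -> \bar R) :
  (forall z, 0 <= w z) -> measurable_fun setT (w : borel T -> \bar R) ->
  \int[image_measure cg]_z w z = \int[m]_x w (g x).
Proof.
move=> w0 mw.
by rewrite -(ge0_integral_pushforward (continuous_borel cg) m measurableT).
Qed.

End ContinuousImage.

(** The fields are what product arguments use: open sets of finite measure exhausting the space
    permit truncation and subtraction, and sigma-compactness of open sets up to null sets gives
    inner regularity and countable subcovers. Restrictions of Radon measures to boxes have these
    properties even when the Radon measure is not sigma-finite. *)
Record sregular (R : realType) (T : ptopologicalType)
    (m : {measure set (borel T) -> \bar R}) : Prop := SRegular {
  sr_hausdorff : hausdorff_space T ;
  sr_cover : exists U : nat -> set T, [/\ forall i, open (U i),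
    nondecreasing_seq U, \bigcup_i U i = setT & forall i, (m (U i) < +oo)%E] ;
  sr_inner : forall O : set T, open O -> exists C : nat -> set T,
    [/\ forall i, compact (C i), forall i, C i `<=` O &
        m (O `\` \bigcup_i C i) = 0%E]
}.

Section SRegular.
Context (R : realType) (T : ptopologicalType).
Variables (m : {measure set (borel T) -> \bar R}) (sm : sregular m).
Local Open Scope ereal_scope.

(** Finite unions of the compact sets in [sr_inner] increase to O up to a null set, so their
    measures converge to m O. A countable exhaustion thus yields inner regularity, also on open sets
    of infinite measure. *)
Lemma sregular_compact_lt (O : set T) (c : \bar R) : open O -> c < m O ->
  exists C : set T, [/\ compact C, C `<=` O & c < m C].
Proof.
move=> oO cO; have [C [cC CO mC]] := sr_inner sm oO.
have mCi i : measurable (C i : set (borel T)).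
  exact: compact_borel (sr_hausdorff sm) (cC i).
pose D k := \big[setU/set0]_(i < k) C i.
have cD k : compact (D k) by apply: bigsetU_compact.
have DO k : D k `<=` O by rewrite /D -bigcup_mkord; apply: bigcup_sub => i _.
have mD k : measurable (D k : set (borel T)).
  exact: compact_borel (sr_hausdorff sm) (cD k).
have DE : \bigcup_k D k = \bigcup_i C i.
  apply/seteqP; split=> [x [k _]|x [i _ Cx]].
    by rewrite /D -bigcup_mkord => -[i _ Cx]; exists i.
  by exists i.+1 => //; rewrite /D -bigcup_mkord; exists i => /=.
have mO : m O = m (\bigcup_k D k).
  have sub : \bigcup_i C i `<=` O by exact: bigcup_sub.
  rewrite -(setDKU sub) measureU//.
  - by rewrite -[RHS]add0e; congr (_ + _); [exact: mC|rewrite DE].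
  - apply: measurableD; first exact: open_borel.
    exact: bigcupT_measurable.
  - exact: bigcupT_measurable.
  - by rewrite setDE -setIA setICl setI0.
have : m (D k) @[k --> \oo] --> m (\bigcup_k D k).
  apply: nondecreasing_cvg_mu => //; first exact: bigcupT_measurable.
  by move=> i j ij; apply/subsetPset; exact: subset_bigsetU.
rewrite -mO => cv; apply: contrapT => nC.
have : m O <= c.
  rewrite -(cvg_lim _ cv)//; apply: lime_le; first exact: cvgP cv.
  apply: nearW => k; rewrite leNgt; apply/negP => cDk.
  by apply: nC; exists (D k).
by rewrite leNgt cO.
Qed.

End SRegular.

HB.instance Definition _ (X Y : ptopologicalType) := Pointed.on (X * Y)%type.

(** * Tube lemma, countable subcovers and measurability of sections *)

Section Tube.
Context (X Y : ptopologicalType).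

(** Compactness is used as a near-covering property over the filter of small neighbourhoods W of y:
    shrinking W preserves [P W x], so one W serves all x in C at once. *)
Lemma tube (E : set (X * Y)) (C : set X) (y : Y) : open E -> compact C ->
  (forall x, C x -> E (x, y)) ->
  exists A : set X, exists B : set Y,
    [/\ open A, open B, C `<=` A, B y & A `*` B `<=` E].
Proof.
move=> oE /compact_near_coveringP cC CE.
pose P (W : set Y) (x : X) := exists2 V, nbhs x V & V `*` W `<=` E.
have : \forall W \near powerset_filter_from (nbhs y), C `<=` P W.
  apply: cC => x Cx.
  have : nbhs (x, y) E by apply: open_nbhs_nbhs; split => //; exact: CE.
  case=> -[V W] /= [nV nW] VW.
  exists (interior V, [set W' | nbhs y W' /\ W' `<=` W]) => /=.
    split; first by apply: open_nbhs_nbhs; split; [exact: open_interior|].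
    exact: powerset_filter_fromP.
  move=> [x' W'] /= [Vx' [nW' W'W]]; exists V => //.
  by move=> z [Vz /W'W Wz]; apply: VW.
move=> /near_powerset_filter_fromP[|W nW CW].
  move=> W1 W2 W12 CP x /CP[V nV VW]; exists V => // z [Vz /W12 Wz].
  exact: VW.
exists (interior [set x | P W x]), (interior W); split => //.
- exact: open_interior.
- exact: open_interior.
- move=> x /CW[V nV VW]; apply: filterS (nbhs_interior nV) => x' nx'.
  by exists V.
- by move=> [x' y'] [/= /interior_subset[V nV VW] /interior_subset Wy];
    apply: VW; split => //=; exact: nbhs_singleton.
Qed.

Lemma open_compact_section (E : set (X * Y)) (C : set X) : open E -> compact C ->
  open [set y | forall x, C x -> E (x, y)].
Proof.
move=> oE cC; rewrite openE => y /= Cy.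
have [A [B [oA oB CA By AB]]] := tube oE cC Cy.
apply: filterS (open_nbhs_nbhs (conj oB By)) => y' By' x Cx.
by apply: AB; split => //=; exact: CA.
Qed.

Lemma open_setX (A : set X) (B : set Y) : open A -> open B -> open (A `*` B).
Proof.
rewrite !openE => oA oB [x y] [/= Ax By].
by exists (A, B) => //=; split; [exact: oA|exact: oB].
Qed.

Lemma continuous_pairl (x : X) : continuous (fun y : Y => (x, y)).
Proof. by move=> y; apply: cvg_pair; [exact: cvg_cst|exact: cvg_id]. Qed.

Lemma continuous_pairr (y : Y) : continuous (fun x : X => (x, y)).
Proof. by move=> x; apply: cvg_pair; [exact: cvg_id|exact: cvg_cst]. Qed.

Lemma continuous_swap : continuous (fun z : Y * X => (z.2, z.1)).
Proof. by move=> z; apply: cvg_pair; [exact: cvg_snd|exact: cvg_fst]. Qed.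

End Tube.

Section Lindelof.
Context (T : ptopologicalType).

(** The Lindelof property of sigma-compact sets. [J] is pointed so that a sequence of indices exists
    even when the subcover is empty. *)
Lemma compact_bigcup_countable_cover (J : pointedType) (F : J -> set T)
    (C : nat -> set T) : (forall i, open (F i)) -> (forall k, compact (C k)) ->
  \bigcup_k C k `<=` \bigcup_i F i ->
  exists e : nat -> J, \bigcup_k C k `<=` \bigcup_j F (e j).
Proof.
move=> oF cC CF.
have fin k : exists D : {fset J}, C k `<=` cover [set` D] F.
  have := cC k; rewrite compact_cover => /(_ J setT F) [||D _ CD].
  - by move=> i _; exact: oF.
  - by move=> x Cx; have [i _ Fx] := CF x (ex_intro2 _ _ k I Cx); exists i.
  - by exists D.
have [D CD] := choice fin.
have cD : countable (\bigcup_k [set` D k]).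
  by apply: bigcup_countable => // k _; exact: countable_fset.
have [e eD] : exists e : nat -> J, \bigcup_k [set` D k] `<=` range e.
  have [D0|/set0P[i0 _]] := eqVneq (\bigcup_k [set` D k]) set0.
    by exists (fun=> point); rewrite D0.
  by have /pcard_surjP[e es] := cD; exists e; apply: subset_trans es _.
exists e => x [k _ /CD [i Di Fx]].
have [|j _ ej] := eD i; first by exists k.
by exists j => //; rewrite ej.
Qed.

End Lindelof.

Section Sections.
Context (R : realType) (X Y : ptopologicalType).
Variables (m : {measure set (borel X) -> \bar R}) (sm : sregular m).
Local Open Scope ereal_scope.

Lemma section_borel (E : set (borel (X * Y)%type)) (y : Y) : measurable E ->
  measurable ([set x | E (x, y)] : set (borel X)).
Proof.
exact: (preimage_borel (@continuous_pairr X Y y)).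
Qed.

(** Lower semicontinuity of the section measure: a compact subset of the section at y with measure
    above c is, by the tube lemma, still contained in the sections at nearby points. *)
Lemma open_section_superlevel (E : set (X * Y)) (c : \bar R) : open E ->
  open [set y | c < m [set x | E (x, y)]].
Proof.
move=> oE; rewrite openE => y /= cy.
have oEy : open [set x | E (x, y)].
  by have /continuousP := @continuous_pairr X Y y; exact.
have [C [cC CE cmC]] := sregular_compact_lt sm oEy cy.
have := open_compact_section oE cC; rewrite openE => /(_ y CE).
apply: filterS => y' Cy'; apply: lt_le_trans cmC _; apply: le_measure => //.
- by rewrite inE; exact: compact_borel (sr_hausdorff sm) cC.
- rewrite inE; apply: open_borel.
  by have /continuousP := @continuous_pairr X Y y'; exact.
Qed.

Lemma measurable_section (E : set (borel (X * Y)%type)) : measurable E ->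
  measurable_fun setT ((fun y => m [set x | E (x, y)]) : borel Y -> \bar R).
Proof.
move=> mE; have [U [oU ndU UT mU]] := sr_cover sm.
have mUk k : measurable (U k : set (borel X)) by exact: open_borel.
(* Truncation by [U k] makes the measures finite, so that the Dynkin step for complements is a
   subtraction; a monotone limit removes the truncation at the end. *)
have key k (E' : set (borel (X * Y)%type)) : measurable E' -> measurable_fun setT
    ((fun y => m (U k `&` [set x | E' (x, y)])) : borel Y -> \bar R).
  move: E'; apply: (@dynkin_induction _ (borel (X * Y)%type) (@open (X * Y)%type)
    (fun E' => measurable_fun setT
      ((fun y => m (U k `&` [set x | E' (x, y)])) : borel Y -> \bar R))).
  - by [].
  - exact: openI.
  - rewrite (_ : (fun _ => _) = cst (m (U k))); first exact: measurable_cst.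
    by apply/funext => y; congr (m _); apply/seteqP; split=> [x []|x].
  - move=> O oO; apply: open_superlevel_measurable => c.
    pose W : set (X * Y) := (U k `*` setT) `&` O.
    have oW : open W by apply: openI => //; apply: open_setX => //; exact: openT.
    have WE y : [set x | W (x, y)] = U k `&` [set x | O (x, y)].
      by apply/seteqP; split=> [x [[Ux _] Ox]|x [Ux Ox]].
    have := open_section_superlevel c%:E oW.
    by under eq_set do rewrite WE.
  - move=> S mS PS; rewrite (_ : (fun _ => _) =
        (fun y => m (U k) - m (U k `&` [set x | S (x, y)]))).
      by apply: emeasurable_funB => //; exact: measurable_cst.
    apply/funext => y.
    have -> : U k `&` [set x | (~` S) (x, y)] = U k `\` [set x | S (x, y)] by [].
    by rewrite measureD//; [exact: section_borel|exact: mU].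
  - move=> F mF tF PF; rewrite (_ : (fun _ => _) =
        (fun y => \sum_(0 <= i <oo) m (U k `&` [set x | F i (x, y)]))).
      by apply: ge0_emeasurable_sum.
    apply/funext => y; rewrite -measure_semi_bigcup.
    + by congr (m _); apply/seteqP; split=> [x [Ux [i _ Fi]]|x [i _ [Ux Fi]]];
        [exists i|split => //; exists i].
    + by move=> i; apply: measurableI => //; exact: section_borel.
    + move=> i j _ _ [x [[_ Fi] [_ Fj]]].
      by apply: (tF i j I I); exists (x, y).
    + apply: bigcupT_measurable => i; apply: measurableI => //.
      exact: section_borel.
apply: (@emeasurable_fun_cvg _ (borel Y) R setT
  (fun k (y : borel Y) => m (U k `&` [set x | E (x, y)]))).
  by move=> k; exact: key.
move=> y _.
rewrite [X in _ --> m X](_ : _ = \bigcup_k (U k `&` [set x | E (x, y)])); last first.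
  by rewrite -setI_bigcupl UT setTI.
apply: nondecreasing_cvg_mu.
- by move=> k; apply: measurableI => //; exact: section_borel.
- by apply: bigcupT_measurable => k; apply: measurableI => //; exact: section_borel.
- by move=> i j ij; apply/subsetPset; apply: setSI; exact/subsetPset/ndU.
Qed.

Lemma measurable_integral_section (w : X * Y -> \bar R) :
  (forall z, 0 <= w z) -> measurable_fun setT (w : borel (X * Y)%type -> \bar R) ->
  measurable_fun setT ((fun y => \int[m]_x w (x, y)) : borel Y -> \bar R).
Proof.
move=> w0 mw.
rewrite (_ : (fun _ => _) =
    (fun y => \int[image_measure m (@continuous_pairr X Y y)]_z w z)).
  apply: (@measurable_fun_integral_kernel _ _ (borel Y) (borel (X * Y)%type) R
    (fun y => image_measure m (@continuous_pairr X Y y))) => // E mE.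
  exact: measurable_section.
by apply/funext => y; rewrite integral_image_measure.
Qed.

End Sections.

(** * Tonelli's theorem for Borel functions *)

Section Rectangles.
Context (R : realType) (X Y : ptopologicalType).
Local Open Scope ereal_scope.

(** The notion of null set is a parameter because two are used: null for a measure on the product,
    and, before any such measure is available, having null sections at almost every point. *)
Definition exhausted_by_rectangles (U : set (X * Y)) (null : set (X * Y) -> Prop) :=
  exists A : nat -> set X, exists B : nat -> set Y,
  [/\ forall i, open (A i) /\ open (B i), forall i, A i `*` B i `<=` U &
      null (U `\` \bigcup_i (A i `*` B i))].

Lemma exhausted_by_rectangles_countable (I : countType) (U : set (X * Y))
    (null : set (X * Y) -> Prop) (A : I -> set X) (B : I -> set Y) :
  (forall i, open (A i) /\ open (B i)) -> (forall i, A i `*` B i `<=` U) ->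
  null (U `\` \bigcup_i (A i `*` B i)) -> exhausted_by_rectangles U null.
Proof.
move=> oAB ABU nU.
pose ext (V : ptopologicalType) (F : I -> set V) (k : nat) :=
    if (choice.unpickle k : option I) is Some i then F i else set0.
exists (ext X A), (ext Y B); split.
- move=> k; rewrite /ext; case: choice.unpickle => [i|]; first exact: oAB.
  by split; exact: open0.
- by move=> k; rewrite /ext; case: choice.unpickle => [i|z []//]; exact: ABU.
- rewrite (_ : \bigcup_k _ = \bigcup_i (A i `*` B i))//.
  apply/seteqP; split=> [z [k _]|z [i _ ABz]].
    by rewrite /ext; case: choice.unpickle => [i ABz|[]//]; exists i.
  by exists (choice.pickle i) => //; rewrite /ext choice.pickleK.
Qed.

Definition rect_regular (nu : {measure set (borel (X * Y)%type) -> \bar R}) :=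
  forall U : set (X * Y), open U ->
    exhausted_by_rectangles U (fun E => nu (E : set (borel (X * Y)%type)) = 0).

Lemma open_rectangle (U : set (X * Y)) (z : X * Y) : open U -> U z ->
  exists AB : set X * set Y, [/\ open AB.1, open AB.2, AB.1 z.1, AB.2 z.2 &
    AB.1 `*` AB.2 `<=` U].
Proof.
case: z => x y oU Uz.
have cx : compact [set x] by exact: compact_set1.
have [A [B [oA oB Ax By AB]]] := tube oU cx (y := y) ltac:(by move=> _ ->).
by exists (A, B); split => //=; exact: Ax.
Qed.

(** Every point of U has a rectangle inside U; the compact sets that fill U up to a null set are
    covered by countably many of these. *)
Lemma sregular_rect_regular (nu : {measure set (borel (X * Y)%type) -> \bar R}) :
  sregular nu -> rect_regular nu.
Proof.
move=> snu U oU; have [C [cC CU nuC]] := sr_inner snu oU.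
have /choice[AB ABP] : forall z : X * Y, exists AB : set X * set Y,
    [/\ open AB.1, open AB.2, AB.1 `*` AB.2 `<=` U & U z -> AB.1 z.1 /\ AB.2 z.2].
  move=> z; have [Uz|nUz] := pselect (U z).
    by have [AB [? ? ? ? ?]] := open_rectangle oU Uz; exists AB; split.
  exists (set0, set0); split => //=; [exact: open0|exact: open0|].
  by move=> ? [].
have oAB z : open ((AB z).1 `*` (AB z).2).
  by have [? ? _ _] := ABP z; exact: open_setX.
have [e Ce] := compact_bigcup_countable_cover oAB cC
  ltac:(by move=> z [k _ /CU Uz]; exists z => //; have [_ _ _] := ABP z; exact).
apply: (@exhausted_by_rectangles_countable nat _ _
  (fun i => (AB (e i)).1) (fun i => (AB (e i)).2)).
- by move=> i; have [] := ABP (e i).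
- by move=> i; have [] := ABP (e i).
- apply: (@subset_measure0 _ _ _ nu _ (U `\` \bigcup_i C i)) => //.
  + apply: measurableD; first exact: open_borel.
    by apply: bigcupT_measurable => i; apply: open_borel; exact: oAB.
  + apply: measurableD; first exact: open_borel.
    apply: bigcupT_measurable => i.
    exact: compact_borel (sr_hausdorff snu) (cC i).
  + by apply: setDS.
Qed.

(** Uniqueness on a generating pi-system is applied twice: first on the sigma-algebra generated by
    open rectangles, then, once open sets are settled, on the Borel sigma-algebra, with the same
    rectangles of finite measure as exhaustion. *)
Lemma rect_regular_unique (nu1 nu2 : {measure set (borel (X * Y)%type) -> \bar R}) :
  rect_regular nu1 -> rect_regular nu2 ->
  (forall A B, open A -> open B -> nu1 (A `*` B) = nu2 (A `*` B)) ->
  (exists A : nat -> set X, exists B : nat -> set Y,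
    [/\ forall i, open (A i) /\ open (B i), \bigcup_i (A i `*` B i) = setT &
        forall i, nu1 (A i `*` B i) < +oo]) ->
  forall E, measurable E -> nu1 E = nu2 E.
Proof.
move=> r1 r2 nu12 [A [B [oAB ABT ABoo]]].
pose rects := [set W : set (borel (X * Y)%type) | exists A' : set X,
  exists B' : set Y, [/\ open A', open B' & W = A' `*` B']].
have rectsE W : <<s rects >> W -> nu1 W = nu2 W.
  apply: (g_sigma_algebra_measure_unique rects _ (fun i => A i `*` B i)) => //.
  - by move=> _ [A' [B' [oA' oB' ->]]]; apply: open_borel; exact: open_setX.
  - by move=> i; have [oA oB] := oAB i; exists (A i), (B i).
  - move=> _ _ [A1 [B1 [oA1 oB1 ->]]] [A2 [B2 [oA2 oB2 ->]]].
    by exists (A1 `&` A2), (B1 `&` B2); rewrite setXI; split => //; exact: openI.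
  - by move=> _ [A' [B' [oA' oB' ->]]]; exact: nu12.
apply: (@measure_unique _ R (borel (X * Y)%type) (@open (X * Y)%type)
  (fun i => A i `*` B i)) => //.
- exact: openI.
- by move=> i; have [oA oB] := oAB i; exact: open_setX.
move=> U oU.
have [A1 [B1 [oAB1 ABU1 nuU1]]] := r1 U oU.
have [A2 [B2 [oAB2 ABU2 nuU2]]] := r2 U oU.
(* Rectangles that fill U for one measure may miss a part charged by the other; the union of the two
   families fills U for both and is still a countable union of rectangles. *)
pose W := \bigcup_i (A1 i `*` B1 i) `|` \bigcup_i (A2 i `*` B2 i).
have sW : <<s rects >> W.
  pose GT : measurableType _ := g_sigma_algebraType rects.
  apply: (@measurableU _ GT); apply: (@bigcupT_measurable _ GT) => i;
    apply: sub_sigma_algebra.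
    by have [oA' oB'] := oAB1 i; exists (A1 i), (B1 i).
  by have [oA' oB'] := oAB2 i; exists (A2 i), (B2 i).
have oW : open W.
  apply: openU; apply: bigcup_open => i _; apply: open_setX;
    by [case: (oAB1 i)|case: (oAB2 i)].
have WU : W `<=` U by move=> z [[i _]|[i _]]; [exact: ABU1|exact: ABU2].
have UE (nu : {measure set (borel (X * Y)%type) -> \bar R}) (V : set (X * Y)) :
    open V -> V `<=` W -> nu (U `\` V) = 0 -> nu U = nu W.
  move=> oV VW nuV.
  have mW : measurable (W : set (borel (X * Y)%type)) by exact: open_borel.
  have mU : measurable (U : set (borel (X * Y)%type)) by exact: open_borel.
  have mV : measurable (V : set (borel (X * Y)%type)) by exact: open_borel.
  rewrite (@measureDI _ _ _ nu U W)// (setIidr WU).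
  rewrite (@subset_measure0 _ _ _ nu (U `\` W) (U `\` V)) ?add0e//.
  - exact: measurableD.
  - exact: measurableD.
  - exact: setDS.
rewrite (UE nu1 (\bigcup_i (A1 i `*` B1 i)))//; last 2 first.
- by apply: bigcup_open => i _; have [oA' oB'] := oAB1 i; exact: open_setX.
- exact: subsetUl.
rewrite (UE nu2 (\bigcup_i (A2 i `*` B2 i)))//.
- exact: rectsE.
- by apply: bigcup_open => i _; have [oA' oB'] := oAB2 i; exact: open_setX.
- exact: subsetUr.
Qed.

End Rectangles.

Section SectionsExhausted.
Context (R : realType) (X Y : ptopologicalType).
Variables (m : {measure set (borel X) -> \bar R}) (sm : sregular m).
Variables (n : {measure set (borel Y) -> \bar R}) (sn : sregular n).
Local Open Scope ereal_scope.

Let swap_open (U : set (X * Y)) : open U ->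
  open ((fun z : Y * X => (z.2, z.1)) @^-1` U).
Proof. by move=> oU; have /continuousP := @continuous_swap X Y; exact. Qed.

Lemma section_borelr (E : set (borel (X * Y)%type)) (x : X) : measurable E ->
  measurable ([set y | E (x, y)] : set (borel Y)).
Proof. exact: (preimage_borel (@continuous_pairl X Y x)). Qed.

Lemma measurable_sectionr (E : set (borel (X * Y)%type)) : measurable E ->
  measurable_fun setT ((fun x => n [set y | E (x, y)]) : borel X -> \bar R).
Proof.
move=> mE; apply: (measurable_section sn
  (E := (fun z : Y * X => (z.2, z.1)) @^-1` E)).
exact: (preimage_borel (@continuous_swap X Y)).
Qed.

(** For every rational q, almost every x with n(U_x) > q lies in the side A of one of countably many
    rectangles A x B inside U with n(B) > q: a compact part of U_x of measure above q thickens to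
    such a rectangle by the tube lemma. Their union W satisfies n(W_x) >= n(U_x) for almost every x,
    and the finite measure of V turns this into a null difference. *)
Lemma rectangles_finite_measure (U : set (X * Y)) (V : set Y) : open U ->
    open V -> n V < +oo -> U `<=` setT `*` V ->
  exhausted_by_rectangles U
    (fun E => \forall x \ae m, n [set y | E (x, y)] = 0).
Proof.
move=> oU oV nV UV.
(* The rationals enumerated by their codes; naturals that are not codes give the level 0, which does
   no harm. *)
pose q (j : nat) : R := ratr (odflt 0%R (choice.unpickle j : option rat)).
pose O j := [set x | (q j)%:E < n [set y | U (x, y)]].
have oO j : open (O j) by exact: (open_section_superlevel sn _ (swap_open oU)).
have oUx x : open [set y | U (x, y)].
  by have /continuousP := @continuous_pairl X Y x; exact.
have rect j x : exists AB : set X * set Y, [/\ open AB.1, open AB.2,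
    AB.1 `*` AB.2 `<=` U, O j x -> AB.1 x & AB.1 !=set0 -> (q j)%:E < n AB.2].
  have [Ox|nOx] := pselect (O j x); last first.
    exists (set0, set0); split => //=; [exact: open0|exact: open0| |].
      by move=> ? [].
    by move=> [].
  have [C [cC CU qC]] := sregular_compact_lt sn (oUx x) Ox.
  have [B [A [oB oA CB Ax BA]]] := tube (swap_open oU) cC (y := x) CU.
  exists (A, B); split => //=.
    by move=> -[x' y'] [/= Ax' By']; apply: (BA (y', x')).
  move=> _; apply: lt_le_trans qC _; apply: le_measure => //.
    by rewrite inE; exact: compact_borel (sr_hausdorff sn) cC.
  by rewrite inE; exact: open_borel.
have /choice[AB ABP] : forall jx : nat * X, exists AB : set X * set Y,
    [/\ open AB.1, open AB.2, AB.1 `*` AB.2 `<=` U, O jx.1 jx.2 -> AB.1 jx.2 &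
        AB.1 !=set0 -> (q jx.1)%:E < n AB.2].
  by move=> [j x]; exact: rect.
have /choice[C CP] j := sr_inner sm (oO j).
have cover j : exists e : nat -> X,
    \bigcup_i C j i `<=` \bigcup_k (AB (j, e k)).1.
  have [|||e he] := @compact_bigcup_countable_cover X X
    (fun x => (AB (j, x)).1) (C j); last by exists e.
  - by move=> x; have [] := ABP (j, x).
  - by move=> k; have [+ _ _] := CP j; exact.
  - move=> x [k _ Cx]; exists x => //; have [_ _ _ h _] := ABP (j, x).
    by have [_ CO _] := CP j; exact: h (CO _ _ Cx).
have [e eP] := choice cover.
apply: (@exhausted_by_rectangles_countable _ _ (nat * nat)%type _ _
  (fun jk => (AB (jk.1, e jk.1 jk.2)).1) (fun jk => (AB (jk.1, e jk.1 jk.2)).2)).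
- by move=> jk; have [] := ABP (jk.1, e jk.1 jk.2).
- by move=> jk; have [] := ABP (jk.1, e jk.1 jk.2).
set W := \bigcup_jk _.
have oW : open W.
  apply: bigcup_open => jk _.
  by have [? ? _ _ _] := ABP (jk.1, e jk.1 jk.2); exact: open_setX.
have WU : W `<=` U.
  by move=> z [jk _]; have [_ _ + _ _] := ABP (jk.1, e jk.1 jk.2); exact.
(* The exceptional points lie, for some level, in [O j] but outside the compact sets chosen
   there. *)
have N0 : m.-negligible (\bigcup_j (O j `\` \bigcup_i C j i)).
  apply: negligible_bigcup => j; have [cC _ mC] := CP j.
  apply/negligibleP; last exact: mC.
  apply: measurableD; first exact: open_borel.
  apply: bigcupT_measurable => i; exact: compact_borel (sr_hausdorff sm) (cC i).
apply: negligibleS N0 => x /=; apply: contra_notP => xN.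
have oWx : open [set y | W (x, y)].
  by have /continuousP := @continuous_pairl X Y x; exact.
have mUx : measurable ([set y | U (x, y)] : set (borel Y)) by exact: open_borel.
have mWx : measurable ([set y | W (x, y)] : set (borel Y)) by exact: open_borel.
have nUx : n [set y | U (x, y)] < +oo.
  apply: le_lt_trans nV; apply: le_measure => //; rewrite ?inE//.
    exact: open_borel.
  by move=> y /UV[].
(* If this failed, a rational r would lie strictly between the two measures; but the rectangle of
   level r through x puts into W_x a set of measure above r. *)
have le : n [set y | U (x, y)] <= n [set y | W (x, y)].
  rewrite leNgt; apply/negP => lt.
  have fU : n [set y | U (x, y)] \is a fin_num by rewrite ge0_fin_numE.
  have fW : n [set y | W (x, y)] \is a fin_num.
    by rewrite ge0_fin_numE// (lt_trans lt).
  move: lt; rewrite -(fineK fU) -(fineK fW) lte_fin => /rat_in_itvoo[r].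
  rewrite in_itv/= => /andP[Wr rU].
  have Ox : O (choice.pickle r) x.
    by rewrite /O /q/= choice.pickleK/= -(fineK fU) lte_fin.
  have Cx : (\bigcup_i C (choice.pickle r) i) x.
    by apply: contrapT => nCx; apply: xN; exists (choice.pickle r).
  have [k _ ABx] := eP _ _ Cx.
  have [_ oB _ _ h] := ABP (choice.pickle r, e (choice.pickle r) k).
  have qB := h (ex_intro _ _ ABx).
  suff : (ratr r)%:E < n [set y | W (x, y)] by rewrite -(fineK fW) lte_fin ltNge (ltW Wr).
  move: qB; rewrite /q/= choice.pickleK/= => /lt_le_trans; apply.
  apply: le_measure; rewrite ?inE//; first exact: open_borel.
  by move=> y By; exists (choice.pickle r, k).
have mD : measurable ([set y | (U `\` W) (x, y)] : set (borel Y)).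
  have -> : [set y | (U `\` W) (x, y)] = [set y | U (x, y)] `\` [set y | W (x, y)].
    by [].
  exact: measurableD.
apply/eqP; rewrite -measure_le0.
rewrite -(@leeD2lE _ (n [set y | W (x, y)])); last first.
  rewrite ge0_fin_numE//; apply: le_lt_trans nUx; apply: le_measure; rewrite ?inE//.
  by move=> y; exact: WU.
rewrite adde0 -measureU//.
- apply: le_trans le; apply: le_measure; rewrite ?inE//; first exact: measurableU.
  by move=> y [/WU//|[]].
- by rewrite -subset0 => y [Wy []].
Qed.

End SectionsExhausted.

Section SectionsExhaustedSigmaFinite.
Context (R : realType) (X Y : ptopologicalType).
Variables (m : {measure set (borel X) -> \bar R}) (sm : sregular m).
Variables (n : {measure set (borel Y) -> \bar R}) (sn : sregular n).
Local Open Scope ereal_scope.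

(** Cutting by the open sets of finite measure that exhaust Y reduces to
    [rectangles_finite_measure]; countably many families and exceptional null sets are then
    merged. *)
Lemma sections_exhausted (U : set (X * Y)) : open U ->
  exhausted_by_rectangles U
    (fun E => \forall x \ae m, n [set y | E (x, y)] = 0).
Proof.
move=> oU; have [V [oV ndV VT nV]] := sr_cover sn.
pose UV k := U `&` (setT `*` V k).
have oUV k : open (UV k).
  by apply: openI => //; apply: open_setX => //; exact: openT.
have /choice[AB ABP] k : exists AB : nat -> set X * set Y,
    [/\ forall i, open (AB i).1 /\ open (AB i).2,
        forall i, (AB i).1 `*` (AB i).2 `<=` UV k &
        \forall x \ae m, n [set y | (UV k `\` \bigcup_i ((AB i).1 `*` (AB i).2)) (x, y)] = 0].
  have [|A [B [oAB ABU h]]] := rectangles_finite_measure sm sn (oUV k) (oV k) (nV k).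
    by move=> z [].
  by exists (fun i => (A i, B i)).
apply: (@exhausted_by_rectangles_countable _ _ (nat * nat)%type _ _
  (fun ki => (AB ki.1 ki.2).1) (fun ki => (AB ki.1 ki.2).2)).
- by move=> ki; have [+ _ _] := ABP ki.1; exact.
- by move=> ki; have [_ + _] := ABP ki.1; move=> /(_ ki.2) h z /h[].
have oAB k i : open ((AB k i).1 `*` (AB k i).2).
  by have [+ _ _] := ABP k; move=> /(_ i)[? ?]; exact: open_setX.
have nAB : \forall x \ae m, forall k,
    n [set y | (UV k `\` \bigcup_i ((AB k i).1 `*` (AB k i).2)) (x, y)] = 0.
  by apply: ae_foralln => k; have [_ _] := ABP k.
apply: ae_mono nAB => x nx; apply/negligibleP.
  apply: (section_borelr (E := U `\` _)); apply: measurableD; first exact: open_borel.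
  by apply: open_borel; apply: bigcup_open => ki _; exact: oAB.
have : n.-negligible (\bigcup_k
    [set y | (UV k `\` \bigcup_i ((AB k i).1 `*` (AB k i).2)) (x, y)]).
  apply: negligible_bigcup => k; apply/negligibleP; last exact: nx.
  apply: (section_borelr (E := UV k `\` _)).
  apply: measurableD; first exact: open_borel.
  by apply: open_borel; apply: bigcup_open => i _; exact: oAB.
apply: negligibleS => y [Uxy nABxy].
have [k _ Vy] : (\bigcup_i V i) y by rewrite VT.
exists k => //; split; first by split.
by move=> [i _ ABxy]; apply: nABxy; exists (k, i).
Qed.

End SectionsExhaustedSigmaFinite.

Section Tonelli.
Context (R : realType) (X Y : ptopologicalType).
Variables (m : {measure set (borel X) -> \bar R}) (sm : sregular m).
Variables (n : {measure set (borel Y) -> \bar R}) (sn : sregular n).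
Local Open Scope ereal_scope.

Section Weighted.
Variables (delta : X -> {nonneg R}).
Hypothesis cdelta : continuous (fun x => (delta x)%:num : R).

Let mdelta : measurable_fun setT ((fun x => (delta x)%:num%:E) : borel X -> \bar R).
Proof. by apply/measurable_EFinP; exact: continuous_borel_real. Qed.

(** delta(x) times n, carried to the fibre over x. [mscale] takes a nonnegative real, hence the type
    of [delta]. *)
Let slice (x : borel X) : {measure set (borel (X * Y)%type) -> \bar R} :=
  mscale (delta x) (image_measure n (@continuous_pairl X Y x)).

Let mslice E : measurable E -> measurable_fun setT (slice ^~ E).
Proof. by move=> mE; apply: emeasurable_funM => //; exact: measurable_sectionr. Qed.

Let product := mixture m mslice.

Let product_rect_regular : rect_regular product.
Proof.
move=> U oU; have [A [B [oAB ABU h]]] := sections_exhausted sm sn oU.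
exists A, B; split => //.
change (\int[m]_x slice x (U `\` \bigcup_i (A i `*` B i)) = 0).
rewrite (ae_eq_integral (cst 0)) ?integral0//.
  apply: mslice; apply: measurableD; first exact: open_borel.
  apply: open_borel; apply: bigcup_open => i _; have [? ?] := oAB i.
  exact: open_setX.
apply: ae_mono h => x h _ /=.
by rewrite /mscale/= [X in _ * X](h : _ = 0) mule0.
Qed.

Let productE (A : set (borel X)) (B : set (borel Y)) : measurable A -> measurable B ->
  product (A `*` B) = (\int[m]_(x in A) (delta x)%:num%:E) * n B.
Proof.
move=> mA mB; rewrite -ge0_integralZr//; last first.
  exact: (measurable_funS measurableT).
rewrite [RHS]integral_mkcond; apply: eq_integral => x _; rewrite patchE.
rewrite /slice/= /mscale/= /image_measure.
case: ifPn => [/set_mem Ax|nAx].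
  by congr (_ * n _); apply/seteqP; split=> [y []//|y].
rewrite (_ : _ @^-1` _ = set0) ?measure0 ?mule0//.
by apply/seteqP; split=> [y [/= /mem_set]|//]; rewrite (negbTE nAx).
Qed.

(** lam and the iterated product measure are both filled by rectangles and agree on the open ones,
    so they coincide; the formula is then the disintegration of the product. *)
Lemma product_disintegration (lam : {measure set (borel (X * Y)%type) -> \bar R}) :
  rect_regular lam ->
  (forall A B, open A -> open B ->
    lam (A `*` B) = (\int[m]_(x in (A : set (borel X))) (delta x)%:num%:E) * n B) ->
  forall w : X * Y -> \bar R, (forall z, 0 <= w z) ->
    measurable_fun setT (w : borel (X * Y)%type -> \bar R) ->
  \int[lam]_z w z = \int[m]_x ((delta x)%:num%:E * \int[n]_y w (x, y)).
Proof.
move=> rlam lamE w w0 mw.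
have eqE E : measurable E -> product E = lam E.
  apply: (rect_regular_unique product_rect_regular rlam).
  - move=> A B oA oB; rewrite lamE//; apply: productE; exact: open_borel.
  have [U [oU ndU UT mU]] := sr_cover sm.
  have [V [oV ndV VT nV]] := sr_cover sn.
  (* The bound on delta is added because the integral of delta over [U k] may be infinite although
     [U k] has finite measure. *)
  pose D k := U k `&` [set x | ((delta x)%:num < k%:R)%R].
  have oD k : open (D k).
    apply: openI => //; have /continuousP cD := cdelta.
    exact: (cD _ (@open_lt R k%:R)).
  exists D, V; split => //.
  - apply/seteqP; split=> // -[x y] _.
    have [i _ Ux] : (\bigcup_i U i) x by rewrite UT.
    have [j _ Vy] : (\bigcup_j V j) y by rewrite VT.
    pose k := maxn (maxn i j) (Num.truncn (delta x)%:num).+1.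
    exists k => //; split => /=.
      split; first by move: Ux; apply/subsetPset/ndU; rewrite /k !leq_max leqnn.
      apply: lt_le_trans (truncnS_gt _) _.
      by rewrite ler_nat /k leq_max leqnn orbT.
    by move: Vy; apply/subsetPset/ndV; rewrite /k !leq_max leqnn orbT.
  - move=> k; rewrite [ltLHS](productE (open_borel (oD k)) (open_borel (oV k))).
    rewrite lte_mul_pinfty//.
    + by apply: integral_ge0 => x _; rewrite lee_fin.
    + rewrite ge0_fin_numE; last by apply: integral_ge0 => x _; rewrite lee_fin.
      apply: (@le_lt_trans _ _ (\int[m]_(x in D k) (k%:R)%:E)).
        apply: ge0_le_integral => //.
        * exact: open_borel.
        * exact: (measurable_funS measurableT).
        * by move=> x [_ /= /ltW]; rewrite lee_fin.
      rewrite integral_cst; last exact: open_borel.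
      rewrite lte_mul_pinfty ?lee_fin//.
      apply: le_lt_trans (mU k); apply: le_measure; rewrite ?inE; [exact: open_borel|exact: open_borel|].
      by move=> x [].
rewrite (eq_measure_integral product) => [|A mA _]; last exact: (esym (eqE _ mA)).
rewrite (@disintegration _ _ _ _ _ m slice mslice product)//.
apply: eq_integral => x _.
by rewrite ge0_integral_mscale// integral_image_measure.
Qed.

End Weighted.

Let mslice2 E : measurable E -> measurable_fun setT
  ((fun y => image_measure m (@continuous_pairr X Y y) E) : borel Y -> \bar R).
Proof. exact: measurable_section. Qed.

Let product2 := mixture n mslice2.

Let product2_rect_regular : rect_regular product2.
Proof.
move=> U oU.
have oU' : open ((fun z : Y * X => (z.2, z.1)) @^-1` U).
  by have /continuousP := @continuous_swap X Y; exact.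
have [B [A [oBA BAU h]]] := sections_exhausted sn sm oU'.
exists A, B; split.
- by move=> i; have [] := oBA i.
- by move=> i [x y] [/= Ax By]; apply: (BAU i (y, x)).
have oAB : open (\bigcup_i (A i `*` B i)).
  by apply: bigcup_open => i _; have [? ?] := oBA i; exact: open_setX.
change (\int[n]_y image_measure m (@continuous_pairr X Y y)
  (U `\` \bigcup_i (A i `*` B i)) = 0).
rewrite (ae_eq_integral (cst 0)) ?integral0//.
  by apply: mslice2; apply: measurableD; exact: open_borel.
apply: ae_mono h => y <- _; congr (m _); apply/seteqP.
by split=> x [Uxy nAB]; split => // -[i _ [Ax By]]; apply: nAB; exists i.
Qed.

(** [product2], the product measure built with the integral over Y outermost, meets the conditions
    of [product_disintegration] with weight 1: it is filled by rectangles and gives m(A) n(B) to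
    each open one. Its integral is therefore also the iterated integral with X outermost. *)
Lemma tonelli (w : X * Y -> \bar R) : (forall z, 0 <= w z) ->
    measurable_fun setT (w : borel (X * Y)%type -> \bar R) ->
  \int[m]_x \int[n]_y w (x, y) = \int[n]_y \int[m]_x w (x, y).
Proof.
move=> w0 mw.
pose one : {nonneg R} := NngNum (@ler01 R).
have c1 : continuous (fun x : X => one%:num : R).
  by move=> x; exact: cvg_cst.
have E1 : \int[product2]_z w z = \int[m]_x (1 * \int[n]_y w (x, y)).
  apply: (product_disintegration c1 product2_rect_regular) => // A B oA oB.
  rewrite integral_cst ?mul1e; last exact: open_borel.
  change (\int[n]_y m [set x | (A `*` B) (x, y)] = m A * n B).
  transitivity (\int[n]_y (m A * (\1_(B : set (borel Y)) y)%:E)).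
    apply: eq_integral => y _; rewrite indicE.
    have [/set_mem By|nBy] := boolP (y \in B).
      by rewrite mule1; congr (m _); apply/seteqP; split=> [x []//|x].
    rewrite mule0 (_ : [set x | _] = set0) ?measure0//.
    by apply/seteqP; split=> [x [_ /= /mem_set]|//]; rewrite (negbTE nBy).
  rewrite ge0_integralZl//.
  - by rewrite integral_indic ?setIT//; exact: open_borel.
  - by apply/measurable_EFinP; apply: measurable_indic; exact: open_borel.
have E2 : \int[product2]_z w z = \int[n]_y \int[m]_x w (x, y).
  rewrite (@disintegration _ _ _ _ _ n _ mslice2 product2)//.
  by apply: eq_integral => y _; rewrite integral_image_measure.
rewrite -[RHS]E2 [RHS]E1; apply: eq_integral => x _.
by rewrite [in RHS]mul1e.
Qed.

End Tonelli.

(** * Open sigma-compact subgroups *)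

Section LocallyCompact.
Context (T : ptopologicalType).
Hypothesis (lcT : locally_compact [set: T]) (hT : hausdorff_space T).

Lemma compact_nbhs_point (x : T) : exists2 N : set T, nbhs x N & compact N.
Proof.
have [U + [cU _]] := lcT (I : setT x).
by rewrite withinET => nU; exists U.
Qed.

Lemma open_precompact_cover (C : set T) : compact C ->
  exists W : set T, [/\ open W, C `<=` W & compact (closure W)].
Proof.
move=> cC.
have /choice[N NP] : forall x : T, exists N : set T, nbhs x N /\ compact N.
  by move=> x; have [N ? ?] := compact_nbhs_point x; exists N.
have := cC; rewrite {1}compact_cover.
move=> /(_ T setT (fun x => interior (N x))) [||D _ CD].
- by move=> x _; exact: open_interior.
- by move=> x _; exists x => //; exact: (NP x).1.
pose Q := \big[setU/set0]_(x <- enum_fset D) N x.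
have cQ : compact Q by apply: bigsetU_compact => x _; have [] := NP x.
exists (cover [set` D] (fun x => interior (N x))); split => //.
  by apply: bigcup_open => x _; exact: open_interior.
apply: (@subclosed_compact _ _ Q) => //; first exact: closed_closure.
have /closure_id -> : closed Q by exact: compact_closed.
apply: closureS => y [x Dx Ny]; rewrite /Q -bigcup_seq; exists x => //.
exact: interior_subset Ny.
Qed.

(** The one-point compactification is compact Hausdorff, hence normal, and supplies the separating
    function. Zero is imposed outside V and also outside a precompact W, which makes the support
    compact. *)
Lemma compact_urysohn (R : realType) (C V : set T) : compact C -> open V -> C `<=` V ->
  exists phi : T -> R, [/\ continuous phi, forall x, 0 <= phi x <= 1,
    forall x, C x -> phi x = 1, forall x, phi x != 0 -> V x &
    compact (closure [set x | phi x != 0])].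
Proof.
move=> cC oV CV; have [W [oW CW cW]] := open_precompact_cover cC.
pose opc := one_point_compactification T.
have hopc : hausdorff_space opc by exact: one_point_compactification_hausdorff.
have sC : continuous (Some : T -> opc).
  exact: one_point_compactification_some_continuous.
have clC : closed (Some @` C : set opc).
  by apply: compact_closed => //; apply: continuous_compact => //;
    exact: continuous_subspaceT.
have oVW : open (Some @` (V `&` W) : set opc).
  by apply: one_point_compactification_open_some; exact: openI.
have nopc : normal_space opc.
  exact: compact_normal hopc one_point_compactification_compact.
have disj : ~` (Some @` (V `&` W) : set opc) `&` (Some @` C) = set0.
  rewrite -subset0 => z [nz [x Cx xz]]; apply: nz; exists x => //.
  by split; [exact: CV|exact: CW].
have us := (@normal_separatorP R opc).1 nopc _ _ (open_closedC oVW) clC disj.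
have [f [cf f01 f0 f1]] := (@uniform_separatorP opc R _ _).1 us.
exists (f \o Some); split.
- by move=> x; apply: continuous_comp; [exact: sC|exact: cf].
- move=> x; have := f01 (f (Some x)) (ex_intro2 _ _ (Some x) I erefl).
  by rewrite /= in_itv.
- by move=> x Cx; apply: f1; exists (Some x) => //; exists x.
- move=> x; apply: contra_neqP => nVx; apply: f0; exists (Some x) => //.
  by move=> [y [Vy _] [yx]]; apply: nVx; rewrite -yx.
- apply: (@subclosed_compact _ _ (closure W)) => //; first exact: closed_closure.
  apply: closureS => x; apply: contra_neqP => nWx; apply: f0; exists (Some x) => //.
  by move=> [y [_ Wy] [yx]]; apply: nWx; rewrite -yx.
Qed.

End LocallyCompact.

Section SigmaCompact.
Context (T : ptopologicalType).

Definition sigma_compact (S : set T) := exists C : nat -> set T,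
  (forall i, compact (C i)) /\ S = \bigcup_i C i.

(** Unlike sigma-compactness, this passes to arbitrary subsets, such as supports and null sets that
    are merely Borel. *)
Definition sub_sigma_compact (S : set T) :=
  exists2 S', sigma_compact S' & S `<=` S'.

Lemma sub_sigma_compact_bigcup (S : nat -> set T) :
  (forall k, sub_sigma_compact (S k)) -> sub_sigma_compact (\bigcup_k S k).
Proof.
move=> sS; have /choice[C CP] k : exists C : nat -> set T,
    (forall i, compact (C i)) /\ S k `<=` \bigcup_i C i.
  by have [_ [C [cC ->]] SC] := sS k; exists C.
pose D (i : nat) :=
  if (choice.unpickle i : option (nat * nat)) is Some ki then C ki.1 ki.2 else set0.
exists (\bigcup_i D i).
  exists D; split => // i; rewrite /D.
  case: (choice.unpickle i : option (nat * nat)) => [ki|]; last exact: compact0.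
  by have [] := CP ki.1.
move=> x [k _ Sx]; have [_ /(_ x Sx)[i _ Cx]] := CP k.
by exists (choice.pickle (k, i)) => //; rewrite /D choice.pickleK.
Qed.

Lemma sigma_compact_increasing (S : set T) : sigma_compact S ->
  exists C : nat -> set T, [/\ forall i, compact (C i), nondecreasing_seq C &
    S = \bigcup_i C i].
Proof.
move=> [C [cC ->]]; exists (fun k => \big[setU/set0]_(i < k) C i); split.
- by move=> k; exact: bigsetU_compact.
- by move=> i j ij; apply/subsetPset; exact: subset_bigsetU.
apply/seteqP; split=> [x [i _ Cx]|x [k _]].
  by exists i.+1 => //; rewrite -bigcup_mkord; exists i => /=.
by rewrite -bigcup_mkord => -[i _ Cx]; exists i.
Qed.

Lemma sub_sigma_compactS (S S' : set T) : S `<=` S' ->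
  sub_sigma_compact S' -> sub_sigma_compact S.
Proof. by move=> SS' [C sC S'C]; exists C => //; exact: subset_trans S'C. Qed.

End SigmaCompact.

Lemma sub_sigma_compact_image (S T : ptopologicalType) (f : S -> T) (A : set S) :
  continuous f -> sub_sigma_compact A -> sub_sigma_compact (f @` A).
Proof.
move=> cf [_ [C [cC ->]] AC]; exists (f @` \bigcup_i C i); last exact: image_subset.
exists (fun i => f @` C i); split; last exact: image_bigcup.
move=> i; apply: continuous_compact => //; exact: continuous_subspaceT.
Qed.

Section Subgroups.
Context (G : topologicalGroupType).

Record sigma_compact_subgroup (A : set G) : Prop := SigmaCompactSubgroup {
  scs_sigma_compact : sigma_compact A ;
  scs_open : open A ;
  scs_closed : closed A ;
  scs_mul : forall x y, A x -> A y -> A (x * y)%g ;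
  scs_inv : forall x, A x -> A (x^-1)%g }.

Lemma continuous_mull (g : G) : continuous (fun x : G => (g * x)%g).
Proof.
move=> x; apply: (continuous_comp (f := fun x => (g, x)) (g := fun z => (z.1 * z.2)%g)).
  exact: continuous_pairl.
exact: mulg_continuous.
Qed.

(** Closing a compact neighbourhood W of 1 under products and inverses, while adding one [C n] per
    stage, keeps each stage compact and makes the union stable. The union contains x W for each of
    its points x, so it is open; its complement does too, because x = y (x^-1 y)^-1 would put x into
    the union if some y in x W were there. *)
Lemma exists_sigma_compact_subgroup (S : set G) : locally_compact_group G ->
  sub_sigma_compact S -> exists2 A, sigma_compact_subgroup A & S `<=` A.
Proof.
move=> [hG lcG] [_ [C [cC ->]] SC].
have [W nW cW] := compact_nbhs_point lcG 1%g.
pose step (Q : set G) n := Q `|` C n `|` (fun z => (z.1 * z.2)%g) @` (Q `*` Q)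
  `|` (fun x => x^-1)%g @` Q.
pose Q := fix Q n := if n is n'.+1 then step (Q n') n' else W.
have cQ n : compact (Q n).
  elim: n => [//|n IHn] /=; rewrite /step; apply: compactU; first apply: compactU.
  - exact: compactU.
  - apply: continuous_compact; last exact: compact_setX.
    exact/continuous_subspaceT/mulg_continuous.
  - apply: continuous_compact => //.
    exact/continuous_subspaceT/invg_continuous.
have Qle i j : (i <= j)%N -> Q i `<=` Q j.
  elim: j => [|j IHj]; first by rewrite leqn0 => /eqP ->.
  rewrite leq_eqVlt ltnS => /predU1P[->//|/IHj ij] x /ij Qx.
  by left; left; left.
pose A := \bigcup_n Q n.
have mulA x y : A x -> A y -> A (x * y)%g.
  move=> [i _ Qx] [j _ Qy]; exists (maxn i j).+1 => //=; left; right.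
  by exists (x, y) => //; split => /=; [apply: Qle Qx|apply: Qle Qy];
    rewrite leq_max leqnn ?orbT.
have invA x : A x -> A (x^-1)%g.
  by move=> [i _ Qx]; exists i.+1 => //=; right; exists x.
have nA (x : G) : nbhs x [set y | W (x^-1 * y)%g].
  have := @continuous_mull (x^-1)%g x; apply; rewrite mulVg; exact: nW.
exists A; last first.
  by apply: subset_trans SC _ => x [i _ Cx]; exists i.+1 => //=; left; left; right.
split => //.
- by exists Q.
- rewrite openE => x Ax; apply: filterS (nA x) => y Wy.
  by rewrite -(mul1g y) -(mulgV x) -mulgA; apply: mulA => //; exists 0%N.
- rewrite -openC openE => x nAx; apply: filterS (nA x) => y Wy Ay.
  apply: nAx; rewrite (_ : x = y * (x^-1 * y)^-1)%g.
    by apply: mulA => //; apply: invA; exists 0%N.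
  by rewrite invgM invgK mulgA mulgV mul1g.
Qed.

End Subgroups.

(** * Restriction of Radon and Haar measures to open, closed, sigma-compact sets *)

Section Radon.
Context (R : realType) (T : ptopologicalType).
Variables (mu : {measure set (borel T) -> \bar R}) (rmu : radon_measure mu).
Hypothesis hT : hausdorff_space T.
Local Open Scope ereal_scope.

Lemma radon_open_superset (E : set T) : measurable (E : set (borel T)) -> mu E < +oo ->
  exists U : set T, [/\ open U, E `<=` U & mu U < +oo].
Proof.
move=> mE; rewrite (radon_outer rmu mE) => /ereal_inf_lt[_ [U [oU EU] <-] Uoo].
by exists U.
Qed.

(** Inner regularity gives compact subsets whose measure is within 1/(i+1) of mu O; as mu O is
    finite, the defects tend to 0. *)
Lemma radon_inner_sigma_compact (O : set T) : open O -> mu O < +oo ->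
  exists C : nat -> set T, [/\ forall i, compact (C i), forall i, C i `<=` O &
    mu (O `\` \bigcup_i C i) = 0].
Proof.
move=> oO Ooo; have mO : measurable (O : set (borel T)) by exact: open_borel.
have fO : mu O \is a fin_num by rewrite ge0_fin_numE.
have /choice[C CP] i : exists C : set T,
    [/\ compact C, C `<=` O & mu O - (i.+1%:R^-1)%:E < mu C].
  have : mu O - (i.+1%:R^-1)%:E < mu O by rewrite lteBlDr// lteDl// lte_fin invr_gt0.
  by rewrite {2}(radon_inner rmu oO) => /ereal_sup_gt[_ [C [cC CO] <-] lt]; exists C.
have mC i : measurable (C i : set (borel T)).
  by have [cC _ _] := CP i; exact: compact_borel.
exists C; split; [by move=> i; have [] := CP i|by move=> i; have [] := CP i|].
apply/eqP; rewrite eq_le measure_ge0 andbT; apply/lee_addgt0Pr => e e0.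
have [i ie] : exists i : nat, (i.+1%:R^-1 < e)%R.
  exists (Num.truncn e^-1); rewrite invf_plt ?posrE//.
  exact: truncnS_gt.
have [cC CO lt] := CP i.
apply: (@le_trans _ _ (mu (O `\` C i))).
  apply: le_measure; rewrite ?inE; [| |by apply: setDS; exact: bigcup_sup].
    by apply: measurableD => //; exact: bigcupT_measurable.
  exact: measurableD.
have -> : mu (O `\` C i) = mu O - mu (C i).
  by rewrite measureD// setIidr.
have fC : mu (C i) \is a fin_num.
  by rewrite ge0_fin_numE// (le_lt_trans _ Ooo)// le_measure ?inE.
rewrite add0e leeBlDr//; move: lt; rewrite lteBlDr// => /ltW/le_trans; apply.
by rewrite addeC leeD2r// lee_fin ltW.
Qed.

Variable A : set T.
Hypotheses (oA : open A) (cA : closed A) (sA : sigma_compact A).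

(** Compact sets that exhaust A have open neighbourhoods of finite measure. The complement of A,
    open because A is closed, is null for the restriction, so adding it to these neighbourhoods
    covers the whole space without changing their restricted measure. *)
Lemma sregular_mrestr : sregular (mrestr mu (open_borel oA)).
Proof.
have [D [cD ndD AE]] := sigma_compact_increasing sA.
have /choice[U UP] k : exists U : set T, [/\ open U, D k `<=` U & mu U < +oo].
  apply: radon_open_superset; first exact: compact_borel.
  exact: radon_compact.
pose V k := (\big[setU/set0]_(i < k.+1) U i) `|` ~` A.
have oU k : open (\big[setU/set0]_(i < k) U i).
  by rewrite -bigcup_mkord; apply: bigcup_open => i _; have [] := UP i.
have Uoo k : mu (\big[setU/set0]_(i < k) U i) < +oo.
  elim: k => [|k IHk]; first by rewrite big_ord0 measure0.
  rewrite big_ord_recr/=.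
  have [oUk _ Ukoo] := UP k.
  apply: (@le_lt_trans _ _ (mu (\big[setU/set0]_(i < k) U i) + mu (U k))).
    by apply: measureU2; [exact: open_borel (oU k)|exact: open_borel].
  exact: lte_add_pinfty.
have oV k : open (V k) by apply: openU => //; exact: closed_openC.
have DV k : D k `<=` V k.
  move=> x Dx; left; rewrite -bigcup_mkord; exists k => //=.
  by have [_ + _] := UP k; exact.
have ndV : nondecreasing_seq V.
  by move=> i j ij; apply/subsetPset; apply: setSU; apply: subset_bigsetU.
have VT : \bigcup_i V i = setT.
  apply/seteqP; split=> // x _; have [Ax|nAx] := pselect (A x).
    by move: Ax; rewrite AE => -[i _ /DV Vx]; exists i.
  by exists 0%N => //; right.
have Voo k : mu (V k `&` A) < +oo.
  apply: le_lt_trans (Uoo k.+1); apply: le_measure; rewrite ?inE.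
  - by apply: open_borel; exact: openI.
  - exact: open_borel.
  - by move=> x [[//|nAx] Ax].
split => //.
- by exists V; split.
- move=> O oO.
  (* A countable compact exhaustion is available for open sets of finite measure, hence the cut by
     [V k]. *)
  have /choice[C CP] k : exists C : nat -> set T, [/\ forall i, compact (C i),
      forall i, C i `<=` O `&` (V k `&` A) &
      mu (O `&` (V k `&` A) `\` \bigcup_i C i) = 0].
    apply: radon_inner_sigma_compact; first by apply: openI => //; exact: openI.
    apply: le_lt_trans (Voo k); apply: le_measure; rewrite ?inE.
    + by apply: open_borel; apply: openI => //; exact: openI.
    + by apply: open_borel; exact: openI.
    + exact: subIsetr.
  pose E (i : nat) : set T :=
    if (choice.unpickle i : option (nat * nat)) is Some ki then C ki.1 ki.2 else set0.
  have cE i : compact (E i).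
    rewrite /E; case: (choice.unpickle i : option (nat * nat)) => [ki|]; last exact: compact0.
    by have [] := CP ki.1.
  exists E; split => //.
    move=> i; rewrite /E; case: (choice.unpickle i : option (nat * nat)) => [ki|//].
    by have [_ h _] := CP ki.1; move=> x /h[].
  change (mu ((O `\` \bigcup_i E i) `&` A) = 0).
  have : mu.-negligible (\bigcup_k (O `&` (V k `&` A) `\` \bigcup_i C k i)).
    apply: negligible_bigcup => k; have [cC _ h] := CP k.
    apply/negligibleP; last exact: h.
    apply: measurableD.
      by apply: open_borel; apply: openI => //; exact: openI.
    by apply: bigcupT_measurable => i; exact: compact_borel.
  have mOE : measurable ((O `\` \bigcup_i E i) `&` A : set (borel T)).
    apply: measurableI; last exact: open_borel.
    apply: measurableD; first exact: open_borel.
    by apply: bigcupT_measurable => i; exact: compact_borel.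
  move=> neg; apply/(negligibleP mu mOE); apply: negligibleS neg.
  move=> x [[Ox nEx] Ax]; have [k _ Vx] : (\bigcup_i V i) x by rewrite VT.
  exists k => //; split => // -[i _ Cx]; apply: nEx.
  by exists (choice.pickle (k, i)) => //; rewrite /E choice.pickleK.
Qed.

End Radon.

Section IntegralRestriction.
Context d (T : measurableType d) (R : realType).
Variables (mu : {measure set T -> \bar R}) (A : set T) (mA : measurable A).
Local Open Scope ereal_scope.

Let weight (x : T) : {nonneg R} := NngNum (ler0n R (x \in A)).

(** The restriction to A is the mixture of the measures 1_A(x) times the Dirac mass at x, so
    [disintegration] applies. *)
Lemma ge0_integral_mrestr (f : T -> \bar R) : (forall x, 0 <= f x) ->
  measurable_fun setT f -> (forall x, ~ A x -> f x = 0) ->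
  \int[mrestr mu mA]_x f x = \int[mu]_x f x.
Proof.
move=> f0 mf fA; pose l x : {measure set T -> \bar R} := mscale (weight x) (dirac x).
have lE x E : l x E = (\1_(E `&` A) x)%:E.
  by rewrite /l/= /mscale/= diracE -EFinM indicI mulrC.
rewrite (@disintegration _ _ _ _ _ mu l _ (mrestr mu mA)) => //.
- apply: eq_integral => x _; rewrite ge0_integral_mscale// integral_dirac//.
  rewrite diracT mul1e /=; have [/set_mem Ax|nAx] := boolP (x \in A).
    by rewrite mul1e.
  by rewrite mul0e fA// => /mem_set; rewrite (negbTE nAx).
- move=> E mE; rewrite (_ : (fun _ => _) = (fun x => (\1_(E `&` A) x)%:E)).
    by apply/measurable_EFinP; apply: measurable_indic; exact: measurableI.
  by apply/funext.
- move=> E mE; under eq_integral do rewrite lE.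
  by rewrite integral_indic ?setIT//; exact: measurableI.
Qed.

Lemma integral_mrestr (f : T -> \bar R) :
  measurable_fun setT f -> (forall x, ~ A x -> f x = 0) ->
  \int[mrestr mu mA]_x f x = \int[mu]_x f x.
Proof.
move=> mf fA; rewrite [in LHS]integralE [in RHS]integralE; congr (_ - _).
- apply: ge0_integral_mrestr => //; first exact: measurable_funepos.
  by move=> x /fA fx; rewrite funeposE fx maxxx.
- apply: ge0_integral_mrestr => //; first exact: measurable_funeneg.
  by move=> x /fA fx; rewrite funenegE fx oppe0 maxxx.
Qed.

End IntegralRestriction.

Section HaarSupport.
Context (R : realType).
Local Open Scope ereal_scope.

(** If U were null, finitely many translates of U would cover any compact set, so all compact sets
    would be null and, by inner regularity, so would the whole group. *)
Lemma haar_open_gt0 (G : topologicalGroupType) (mu : {measure set (borel G) -> \bar R})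
    (U : set G) : hausdorff_space G -> left_haar_measure mu -> open U -> U !=set0 ->
  0 < mu U.
Proof.
move=> hG hmu oU [u Uu]; rewrite lt0e measure_ge0 andbT; apply/eqP => U0.
have translate g : [set (g * x)%g | x in U] = (fun x => g^-1 * x)%g @^-1` U.
  apply/seteqP; split=> [_ [x Ux <-]|x Ux]; first by rewrite /= mulgA mulVg mul1g.
  by exists (g^-1 * x)%g => //; rewrite mulgA mulgV mul1g.
have oW g : open [set (g * x)%g | x in U].
  rewrite translate; have /continuousP := @continuous_mull G g^-1%g; exact.
have C0 (C : set G) : compact C -> mu C = 0.
  move=> cC; have := cC; rewrite {1}compact_cover.
  move=> /(_ G setT (fun g => [set (g * x)%g | x in U])) [||D _ CD].
  - by move=> g _; exact: oW.
  - move=> g _; exists (g * u^-1)%g => //; exists u => //.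
    by rewrite -mulgA mulVg mulg1.
  have mC : measurable (C : set (borel G)) by exact: compact_borel.
  apply/(negligibleP mu mC).
  suff : mu.-negligible (\big[setU/set0]_(g <- enum_fset D) [set (g * x)%g | x in U]).
    apply: negligibleS; apply: subset_trans CD _ => x [g Dg Ux].
    by rewrite -bigcup_seq; exists g.
  elim/big_ind : _ => [||g _]; first exact: negligible_set0.
    by move=> X Y nX nY; exact: (negligibleU nX nY).
  apply/negligibleP; first exact: open_borel.
  by rewrite -U0; apply: (haar_left hmu); exact: open_borel.
have := haar_neq0 hmu; rewrite (radon_inner (haar_radon hmu) openT) => /negP; apply.
rewrite eq_le; apply/andP; split.
  by apply: ge_ereal_sup => _ [C [cC _] <-]; rewrite C0.
by apply: ereal_sup_ubound; exists set0; [split => //; exact: compact0|exact: measure0].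
Qed.

Context (H K : topologicalGroupType) (tau : cont_hom_aut H K).
Hypotheses (lcH : locally_compact_group H) (lcK : locally_compact_group K).
Local Notation G := (semidirect tau).

Lemma hausdorff_prod (X Y : topologicalType) :
  hausdorff_space X -> hausdorff_space Y -> hausdorff_space (X * Y)%type.
Proof.
move=> hX hY [x1 y1] [x2 y2] cl; congr (_, _).
  apply: hX => A B nA nB; have [] := cl (A `*` setT) (B `*` setT).
  - by exists (A, setT) => //=; split => //; exact: filterT.
  - by exists (B, setT) => //=; split => //; exact: filterT.
  by move=> [x y] [[Ax _] [Bx _]]; exists x.
apply: hY => A B nA nB; have [] := cl (setT `*` A) (setT `*` B).
- by exists (setT, A) => //=; split => //; exact: filterT.
- by exists (setT, B) => //=; split => //; exact: filterT.
by move=> [x y] [[_ Ax] [_ Bx]]; exists y.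
Qed.

Lemma sub_sigma_compact_box (S : set G) : sub_sigma_compact S ->
  exists A : set H, exists B : set K,
    [/\ sigma_compact_subgroup A, sigma_compact_subgroup B & S `<=` A `*` B].
Proof.
move=> sS.
have c1 : continuous (fst : G -> H) by move=> x; exact: (@cvg_fst H K).
have c2 : continuous (snd : G -> K) by move=> x; exact: (@cvg_snd H K).
have [A sA SA] := exists_sigma_compact_subgroup lcH (sub_sigma_compact_image c1 sS).
have [B sB SB] := exists_sigma_compact_subgroup lcK (sub_sigma_compact_image c2 sS).
exists A, B; split => // x Sx; split; [apply: SA|apply: SB]; by exists x.
Qed.

Lemma closed_setX (X Y : topologicalType) (A : set X) (B : set Y) :
  closed A -> closed B -> closed (A `*` B).
Proof.
move=> cA cB; rewrite (_ : A `*` B = fst @^-1` A `&` snd @^-1` B)//.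
apply: closedI.
  by apply: preimage_closed => // x _; exact: cvg_fst.
by apply: preimage_closed => // x _; exact: cvg_snd.
Qed.

Lemma box_open_closed (A : set H) (B : set K) : sigma_compact_subgroup A ->
  sigma_compact_subgroup B ->
  [/\ open (A `*` B : set G), closed (A `*` B : set G) & sigma_compact (A `*` B : set G)].
Proof.
move=> sA sB; split.
- exact: (open_setX (scs_open sA) (scs_open sB)).
- exact: (closed_setX (scs_closed sA) (scs_closed sB)).
have [C [cC ndC ->]] := sigma_compact_increasing (scs_sigma_compact sA).
have [D [cD ndD ->]] := sigma_compact_increasing (scs_sigma_compact sB).
exists (fun k => C k `*` D k); split.
  by move=> k; apply: (@compact_setX H K).
apply/seteqP; split=> [[x y] [[i _ Cx] [j _ Dy]]|[x y] [i _ [Cx Dy]]]; last first.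
  by split; exists i.
exists (maxn i j) => //; split => /=.
  by move: Cx; apply/subsetPset/ndC; exact: leq_maxl.
by move: Dy; apply/subsetPset/ndD; exact: leq_maxr.
Qed.

Variables (lam : {measure set (borel G) -> \bar R}) (hlam : left_haar_measure lam).

Let hG : hausdorff_space G.
Proof. exact: hausdorff_prod lcH.1 lcK.1. Qed.

(** The box encloses a sigma-compact set that fills U up to a null set. What is left of U is open,
    since the box is closed, and null, so [haar_open_gt0] makes it empty. *)
Lemma open_finite_sub_sigma_compact (U : set G) : open U -> lam U < +oo ->
  sub_sigma_compact U.
Proof.
move=> oU Uoo.
have [C [cC CU lamC]] := radon_inner_sigma_compact (haar_radon hlam) hG oU Uoo.
have [A [B [sA sB CAB]]] : exists A : set H, exists B : set K,
    [/\ sigma_compact_subgroup A, sigma_compact_subgroup B &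
        \bigcup_i C i `<=` (A `*` B : set G)].
  by apply: sub_sigma_compact_box; exists (\bigcup_i C i) => //; exists C.
have [oAB cAB sAB] := box_open_closed sA sB.
exists (A `*` B : set G) => //; apply: contrapT => nUAB.
have oD : open (U `\` (A `*` B) : set G).
  by rewrite setDE; apply: openI => //; exact: closed_openC.
have nD : (U `\` (A `*` B) : set G) !=set0.
  apply: contrapT => nD; apply: nUAB => x Ux; apply: contrapT => nx.
  by apply: nD; exists x.
have := haar_open_gt0 hG hlam oD nD; rewrite ltNge => /negP; apply.
rewrite -[leRHS]lamC; apply: le_measure; rewrite ?inE.
- exact: open_borel.
- apply: measurableD; first exact: open_borel.
  by apply: bigcupT_measurable => i; exact: compact_borel.
- by apply: setDS.
Qed.

Lemma measurable_finite_sub_sigma_compact (E : set G) :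
  measurable (E : set (borel G)) -> lam E < +oo -> sub_sigma_compact E.
Proof.
move=> mE Eoo; have [U [oU EU Uoo]] := radon_open_superset (haar_radon hlam) mE Eoo.
exact: sub_sigma_compactS EU (open_finite_sub_sigma_compact oU Uoo).
Qed.

(** The sets where f >= 1/(k+1) have finite measure by Markov's inequality, and countably many of
    them make up the set where f is not 0. *)
Lemma integrable_sub_sigma_compact (f : G -> \bar R) : (forall x, 0 <= f x) ->
  measurable_fun setT (f : borel G -> \bar R) -> \int[lam]_x f x < +oo ->
  sub_sigma_compact [set x | f x != 0].
Proof.
move=> f0 mf foo.
have -> : [set x | f x != 0] = \bigcup_k [set x | (k.+1%:R^-1)%:E <= f x].
  apply/seteqP; split=> [x /= fx|x [k _ /= kf]]; last first.
    by rewrite gt_eqF// (lt_le_trans _ kf)// lte_fin invr_gt0.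
  have [foo'|foo'] := eqVneq (f x) +oo; first by exists 0%N; rewrite //= foo' leey.
  have fE : f x = (fine (f x))%:E by rewrite fineK// ge0_fin_numE// lt_neqAle foo' leey.
  have r0 : (0 < fine (f x))%R by rewrite -lte_fin -fE lt0e fx f0.
  exists (Num.truncn (fine (f x))^-1) => //=; rewrite fE lee_fin ltW// invf_plt ?posrE//.
  exact: truncnS_gt.
have mE k : measurable ([set x | (k.+1%:R^-1)%:E <= f x] : set (borel G)).
  by rewrite -[X in measurable X]setTI; exact: emeasurable_fun_c_infty.
apply: sub_sigma_compact_bigcup => k; apply: measurable_finite_sub_sigma_compact => //.
have : (k.+1%:R^-1)%:E * lam [set x | (k.+1%:R^-1)%:E <= f x] <= \int[lam]_x f x.
  rewrite -integral_cst//.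
  apply: (@le_trans _ _ (\int[lam]_(x in [set x | (k.+1%:R^-1)%:E <= f x]) f x)).
    apply: ge0_le_integral => //.
    - by move=> x _; rewrite lee_fin invr_ge0.
    - exact: (measurable_funS measurableT).
  exact: ge0_subset_integral.
move=> /le_lt_trans /(_ foo); rewrite -[X in _ < X]mule1.
by case: (lam _) => [r| |] //; rewrite ?ltry// gt0_muley ?lte_fin ?invr_gt0// mule1 ltxx.
Qed.

End HaarSupport.

Section CompactSupport.
Context (R : realType) (T : ptopologicalType).
Variables (mu : {measure set (borel T) -> \bar R}) (rmu : radon_measure mu).
Hypothesis hT : hausdorff_space T.
Local Open Scope ereal_scope.

Lemma compact_support_integrable (phi : T -> R) : continuous phi ->
  compact (closure [set x | phi x != 0%R]) -> mu.-integrable setT (EFin \o phi).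
Proof.
move=> cphi cS; set S := closure _ in cS.
have mphi := continuous_borel_real cphi.
have mS : measurable (S : set (borel T)) by exact: compact_borel.
have [M [M0 phiM]] : exists M : R, (0 <= M)%R /\ forall x, (`|phi x| <= M * \1_S x)%R.
  have : compact (phi @` S).
    by apply: continuous_compact => //; exact: continuous_subspaceT.
  move=> /(@compact_bounded R R^o)[M [_ SM]].
  exists (`|M| + 1)%R; split; first by rewrite addr_ge0.
  move=> x; rewrite indicE; have [xS|nxS] := boolP (x \in S).
    rewrite mulr1; apply: SM; last by exists x => //; exact: set_mem.
    by rewrite (le_lt_trans (ler_norm _))// ltrDl.
  have -> : phi x = 0%R; last by rewrite normr0 mulr0.
  by apply: contraNeq nxS => nphi0; apply/mem_set; exact: subset_closure.
apply: (@le_integrable _ _ _ mu setT measurableT _ (fun x => (M * \1_S x)%:E)).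
- exact/measurable_EFinP.
- move=> x _ /=; rewrite lee_fin [leRHS]ger0_norm//.
  by rewrite mulr_ge0.
apply/integrableP; split.
  by apply/measurable_EFinP; apply: measurable_funM => //; exact: measurable_indic.
under eq_integral do rewrite gee0_abs ?lee_fin ?mulr_ge0// EFinM.
rewrite ge0_integralZl//; last first.
  by apply/measurable_EFinP; exact: measurable_indic.
rewrite integral_indic// setIT lte_mul_pinfty ?lee_fin//.
exact: (radon_compact rmu).
Qed.

End CompactSupport.

(** * Haar measure of the semidirect product *)

Section Limits.
Context (R : realType).
Local Open Scope ereal_scope.

(** Products need not converge to the product of the limits when one limit is +oo and the other 0.
    Separate indices allow one limit at a time: multiplication by a finite [b j] is continuous, and
    if I = +oo then either some [b j] is positive, so L = +oo, or w = 0. *)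
Lemma mule_limits_le (a b : nat -> \bar R) (I w L : \bar R) :
  (forall k, 0 <= a k) -> (forall k, 0 <= b k) -> (forall k, b k \is a fin_num) ->
  a k @[k --> \oo] --> I -> b k @[k --> \oo] --> w ->
  (forall k j, a k * b j <= L) -> I * w <= L.
Proof.
move=> a0 b0 bfin aI bw abL.
have lim_le (u : nat -> \bar R) l : u k @[k --> \oo] --> l -> (forall k, u k <= L) -> l <= L.
  move=> ul uL; rewrite -(cvg_lim _ ul)//; apply: lime_le; first exact: cvgP ul.
  exact: nearW.
have IbL j : I * b j <= L.
  by apply: (lim_le _ _ (cvgeZr (bfin j) aI)) => k; exact: abL.
have I0 : 0 <= I.
  by rewrite -(cvg_lim _ aI)//; apply: lime_ge; [exact: cvgP aI|exact: nearW].
have L0 : 0 <= L by apply: le_trans (abL 0%N 0%N); exact: mule_ge0.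
have [Ifin|] := boolP (I \is a fin_num).
  by apply: (lim_le _ _ (cvgeZl Ifin bw)).
rewrite ge0_fin_numE// -leNgt leye_eq => /eqP Ioo.
have [[j bj]|nb] := pselect (exists j, 0 < b j).
  by have := IbL j; rewrite Ioo gt0_mulye// leye_eq => /eqP ->; rewrite leey.
have b00 j : b j = 0.
  apply/eqP; rewrite eq_le b0 andbT leNgt; apply/negP => bj; apply: nb; exists j.
  exact: bj.
have -> : w = 0.
  rewrite -(cvg_lim _ bw)//; under eq_fun do rewrite b00.
  by rewrite lim_cst.
by rewrite mule0.
Qed.

End Limits.

Section CutoffIntegrals.
Context (R : realType) (T : ptopologicalType).
Variables (mu : {measure set (borel T) -> \bar R}).
Variables (A : set T) (mA : measurable (A : set (borel T))).
Variables (delta phi : T -> R).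
Hypotheses (delta0 : forall x, (0 <= delta x)%R) (phi01 : forall x, (0 <= phi x <= 1)%R).
Hypotheses (mdelta : measurable_fun setT (delta : borel T -> R)).
Hypotheses (mphi : measurable_fun setT (phi : borel T -> R)).
Local Open Scope ereal_scope.

Let phi0 x : (0 <= phi x)%R. Proof. by have /andP[] := phi01 x. Qed.

Let mpd : measurable_fun setT ((fun x => (phi x * delta x)%:E) : borel T -> \bar R).
Proof. by apply/measurable_EFinP; exact: measurable_funM. Qed.

(** With [integral_le_cutoff] this sandwiches the integral of a cutoff between restricted integrals
    over a smaller and a larger set; both are applied with the weight delta on H and the weight 1 on
    K. *)
Lemma cutoff_le_integral (V : set T) : measurable (V : set (borel T)) ->
  (forall x, phi x != 0%R -> V x /\ A x) ->
  \int[mu]_x (phi x * delta x)%:E <= \int[mrestr mu mA]_(x in V) (delta x)%:E.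
Proof.
move=> mV phiV; rewrite -(ge0_integral_mrestr mu mA)//; last 2 first.
- by move=> x; rewrite lee_fin mulr_ge0.
- move=> x nAx; have [->|/phiV[]//] := eqVneq (phi x) 0%R.
  by rewrite mul0r.
rewrite [leRHS]integral_mkcond; apply: ge0_le_integral => //.
- by move=> x _; rewrite lee_fin mulr_ge0.
- apply/(measurable_restrictT _ mV); apply: (measurable_funS measurableT) => //.
  exact/measurable_EFinP.
- move=> x _; rewrite patchE; have [xV|nxV] := boolP (x \in V).
    by rewrite lee_fin ler_piMl//; have /andP[] := phi01 x.
  have [->|/phiV[/mem_set]] := eqVneq (phi x) 0%R; first by rewrite mul0r.
  by rewrite (negbTE nxV).
Qed.

Lemma integral_le_cutoff (C : set T) : measurable (C : set (borel T)) -> C `<=` A ->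
  (forall x, C x -> phi x = 1%R) ->
  \int[mrestr mu mA]_(x in C) (delta x)%:E <= \int[mu]_x (phi x * delta x)%:E.
Proof.
move=> mC CA phi1; rewrite integral_mkcond ge0_integral_mrestr//.
- apply: ge0_le_integral => //.
  + by move=> x _; rewrite patchE; case: ifPn => // _; rewrite lee_fin.
  + apply/(measurable_restrictT _ mC); apply: (measurable_funS measurableT) => //.
    exact/measurable_EFinP.
  + move=> x _; rewrite patchE; have [/set_mem xC|nxC] := boolP (x \in C).
      by rewrite phi1// mul1r.
    by rewrite lee_fin mulr_ge0.
- by move=> x; rewrite patchE; case: ifPn => // _; rewrite lee_fin.
- apply/(measurable_restrictT _ mC); apply: (measurable_funS measurableT) => //.
  exact/measurable_EFinP.
- by move=> x nAx; rewrite patchE; case: ifPn => // /set_mem/CA.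
Qed.

End CutoffIntegrals.

Section CompactExhaustion.
Context (R : realType) (T : ptopologicalType).
Variables (m : {measure set (borel T) -> \bar R}) (sm : sregular m).
Local Open Scope ereal_scope.

Lemma sregular_integral_compacts (O : set T) (f : T -> \bar R) : open O ->
  (forall x, 0 <= f x) -> measurable_fun setT (f : borel T -> \bar R) ->
  exists C : nat -> set T, [/\ forall k, compact (C k), forall k, C k `<=` O &
    \int[m]_(x in C k) f x @[k --> \oo] --> \int[m]_(x in O) f x].
Proof.
move=> oO f0 mf; have [C [cC CO mC]] := sr_inner sm oO.
have [|D [cD ndD CD]] := @sigma_compact_increasing T (\bigcup_i C i); first by exists C.
have mD k : measurable (D k : set (borel T)).
  exact: compact_borel (sr_hausdorff sm) (cD k).
have mUD : measurable (\bigcup_k D k : set (borel T)) by exact: bigcupT_measurable.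
have mO : measurable (O : set (borel T)) by exact: open_borel.
have DO : \bigcup_k D k `<=` O by rewrite -CD; exact: bigcup_sub.
exists D; split => //.
  by move=> k; apply: subset_trans DO; exact: bigcup_sup.
rewrite (@ge0_negligible_integral _ _ _ m O (O `\` \bigcup_k D k))//.
- rewrite setDD setIidr//; apply: ge0_nondecreasing_set_cvg_integral => //.
  by move=> k; exact: (measurable_funS measurableT).
- exact: measurableD.
- exact: (measurable_funS measurableT).
- by rewrite -CD.
Qed.

End CompactExhaustion.

Section DeltaMeasure.
Context (R : realType) (H K : topologicalGroupType) (tau : cont_hom_aut H K).
Hypotheses (lcH : locally_compact_group H) (lcK : locally_compact_group K).
Variables (muH : {measure set (borel H) -> \bar R}) (hmuH : left_haar_measure muH).
Variables (muK : {measure set (borel K) -> \bar R}) (hmuK : left_haar_measure muK).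
Variables (delta : H -> R) (hdelta : is_modulus tau muK delta).
Local Notation G := (semidirect tau).
Variables (lam : {measure set (borel G) -> \bar R}) (hlam : left_haar_measure lam).
Hypothesis lamE : is_delta_dh_dk muH muK delta lam.
Local Open Scope ereal_scope.

Let cdelta := modulus_continuous hdelta.

Let hG : hausdorff_space G.
Proof. exact: hausdorff_prod lcH.1 lcK.1. Qed.

Let cfst : continuous (fst : G -> H).
Proof. by move=> x; exact: (@cvg_fst H K). Qed.

Let csnd : continuous (snd : G -> K).
Proof. by move=> x; exact: (@cvg_snd H K). Qed.

(** The assumption on lam speaks of [Rintegral], where an infinite integral reads as 0.
    Integrability of the three functions, from continuity and compact support, turns it into an
    identity of extended reals. *)
Lemma integral_tensor (phi : H -> R) (psi : K -> R) :
  continuous phi -> compact (closure [set x | phi x != 0%R]) ->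
  continuous psi -> compact (closure [set x | psi x != 0%R]) ->
  [/\ \int[lam]_z (phi z.1 * psi z.2)%:E =
       (\int[muH]_h (phi h * delta h)%:E) * \int[muK]_k (psi k)%:E,
      \int[muH]_h (phi h * delta h)%:E \is a fin_num &
      \int[muK]_k (psi k)%:E \is a fin_num].
Proof.
move=> cphi sphi cpsi spsi.
pose chi (z : G) : R := (phi z.1 * psi z.2)%R.
have cchi : continuous chi.
  move=> z; apply: continuousM.
    by apply: continuous_comp; [exact: cfst|exact: cphi].
  by apply: continuous_comp; [exact: csnd|exact: cpsi].
have schi : compact (closure [set z | chi z != 0%R]).
  apply: (subclosed_compact _ (compact_setX sphi spsi)); first exact: closed_closure.
  rewrite (_ : _ `*` _ = closure (closure [set x | phi x != 0%R] `*`
    closure [set x | psi x != 0%R] : set G)); last first.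
    by apply/closure_id; apply: closed_setX; exact: closed_closure.
  apply: closureS => z; rewrite /= /chi mulf_eq0 negb_or => /andP[pz sz].
  by split; apply: subset_closure.
have cphid : continuous (fun h => phi h * delta h)%R.
  by move=> h; apply: continuousM; [exact: cphi|exact: cdelta].
have sphid : compact (closure [set h | (phi h * delta h)%R != 0%R]).
  apply: (subclosed_compact _ sphi); first exact: closed_closure.
  by apply: closureS => h /=; rewrite mulf_eq0 negb_or => /andP[].
have ichi := compact_support_integrable (haar_radon hlam) hG cchi schi.
have iphid := compact_support_integrable (haar_radon hmuH) lcH.1 cphid sphid.
have ipsi := compact_support_integrable (haar_radon hmuK) lcK.1 cpsi spsi.
have f1 := integrable_fin_num measurableT ichi.
have f2 := integrable_fin_num measurableT iphid.
have f3 := integrable_fin_num measurableT ipsi.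
split => //.
have E1 h : Rintegral muK setT (fun k => chi (h, k)) = (phi h * Rintegral muK setT psi)%R.
  by rewrite -RintegralZl.
have E2 : Rintegral lam setT chi =
    (Rintegral muK setT psi * Rintegral muH setT (fun h => phi h * delta h))%R.
  rewrite lamE// -RintegralZl//; congr Rintegral; apply/funext => h.
  by rewrite E1 /= mulrA (mulrC (phi h)).
rewrite -[LHS]fineK// -(fineK f2) -(fineK f3) -EFinM; congr (_%:E).
by rewrite mulrC; exact: E2.
Qed.

Variables (A : set H) (B : set K).
Hypotheses (sA : sigma_compact_subgroup A) (sB : sigma_compact_subgroup B).

Let mA : measurable (A : set (borel H)) := open_borel (scs_open sA).
Let mB : measurable (B : set (borel K)) := open_borel (scs_open sB).

Let oAB : open (A `*` B : set G).
Proof. by have [] := box_open_closed tau sA sB. Qed.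

Let mAB : measurable (A `*` B : set (borel G)) := open_borel oAB.

Let smuA : sregular (mrestr muH mA).
Proof.
exact: (sregular_mrestr (haar_radon hmuH) lcH.1 (scs_open sA) (scs_closed sA)
  (scs_sigma_compact sA)).
Qed.

Let smuB : sregular (mrestr muK mB).
Proof.
exact: (sregular_mrestr (haar_radon hmuK) lcK.1 (scs_open sB) (scs_closed sB)
  (scs_sigma_compact sB)).
Qed.

Let smuAB : sregular (mrestr lam mAB).
Proof.
have [oAB' cAB' sAB'] := box_open_closed tau sA sB.
exact: (sregular_mrestr (haar_radon hlam) hG oAB cAB' sAB').
Qed.

Let delta0 h : (0 <= delta h)%R := ltW (modulus_gt0 hdelta h).

(** Both inequalities compare indicators with tensor products of Urysohn functions, on which lam is
    known: from above through compact subsets of the rectangle, by inner regularity of lam, and from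
    below through compact subsets of the two sides. *)
Lemma open_rectangle_measure (V : set H) (W : set K) : open V -> open W ->
  mrestr lam mAB (V `*` W) =
  (\int[mrestr muH mA]_(h in V) (delta h)%:E) * mrestr muK mB W.
Proof.
move=> oV oW.
have mV : measurable (V : set (borel H)) by exact: open_borel.
have mW : measurable (W : set (borel K)) by exact: open_borel.
have mdelta : measurable_fun setT (delta : borel H -> R) by exact: continuous_borel_real.
have mone : measurable_fun setT ((fun=> 1%R) : borel K -> R) by exact: measurable_cst.
have WE (E : set (borel K)) : measurable E ->
    mrestr muK mB E = \int[mrestr muK mB]_(k in E) (1%R : R)%:E.
  by move=> mE; rewrite integral_cst// mul1e.
have tensor (phi : H -> R) (psi : K -> R) : continuous phi -> compact (closure [set x | phi x != 0%R]) ->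
    continuous psi -> compact (closure [set x | psi x != 0%R]) ->
    \int[lam]_z (phi z.1 * psi z.2)%:E = (\int[muH]_h (phi h * delta h)%:E) *
      \int[muK]_k (psi k * 1)%:E.
  move=> c1 s1 c2 s2; under [X in _ = _ * X]eq_integral do rewrite mulr1.
  by have [] := integral_tensor c1 s1 c2 s2.
have mtensor (phi : H -> R) (psi : K -> R) : continuous phi -> continuous psi ->
    measurable_fun setT ((fun z : G => (phi z.1 * psi z.2)%:E) : borel G -> \bar R).
  move=> c1 c2; apply/measurable_EFinP; apply: continuous_borel_real => z.
  apply: continuousM.
    by apply: continuous_comp; [exact: cfst|exact: c1].
  by apply: continuous_comp; [exact: csnd|exact: c2].
apply/eqP; rewrite eq_le; apply/andP; split.
  change (lam ((V `*` W) `&` (A `*` B) : set G) <=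
    (\int[mrestr muH mA]_(h in V) (delta h)%:E) * mrestr muK mB W).
  have oVWAB : open ((V `*` W) `&` (A `*` B) : set G).
    by apply: openI => //; exact: (open_setX oV oW).
  rewrite (radon_inner (haar_radon hlam) oVWAB); apply: ge_ereal_sup => _ [C [cC CV] <-].
  (* The projections of C are compact and lie in the open sides, so cutoffs equal to 1 on them
     dominate the indicator of C. *)
  have cC1 : compact (fst @` C : set H).
    by apply: continuous_compact => //; exact: (continuous_subspaceT cfst).
  have cC2 : compact (snd @` C : set K).
    by apply: continuous_compact => //; exact: (continuous_subspaceT csnd).
  have [||phi [cphi phi01 phi1 phiV sphi]] := compact_urysohn lcH.2 lcH.1 R cC1
      (V := V `&` A).
  - by apply: openI => //; exact: scs_open.
  - by move=> _ [z /CV[[Vz _] [Az _]] <-].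
  have [||psi [cpsi psi01 psi1 psiV spsi]] := compact_urysohn lcK.2 lcK.1 R cC2
      (V := W `&` B).
  - by apply: openI => //; exact: scs_open.
  - by move=> _ [z /CV[[_ Wz] [_ Bz]] <-].
  have mC : measurable (C : set (borel G)) by exact: compact_borel.
  apply: (@le_trans _ _ (\int[lam]_z (phi z.1 * psi z.2)%:E)).
    have -> : lam C = \int[lam]_z (\1_(C : set (borel G)) z)%:E.
      by rewrite integral_indic// setIT.
    apply: ge0_le_integral => //.
    + by apply/measurable_EFinP; exact: measurable_indic.
    + exact: mtensor.
    + move=> z _; rewrite lee_fin indicE; have [/set_mem Cz|_] := boolP (z \in C).
        by rewrite phi1 ?psi1 ?mulr1//; exists z.
      by apply: mulr_ge0; [have /andP[] := phi01 z.1|have /andP[] := psi01 z.2].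
  rewrite tensor//; apply: lee_pmul.
  + apply: integral_ge0 => h _; rewrite lee_fin mulr_ge0//.
    by have /andP[] := phi01 h.
  + by apply: integral_ge0 => k _; rewrite lee_fin mulr1; have /andP[] := psi01 k.
  + by apply: cutoff_le_integral => //; exact: continuous_borel_real.
  + rewrite WE//; apply: cutoff_le_integral => //; exact: continuous_borel_real.
have oVA : open (V `&` A) by apply: openI => //; exact: scs_open sA.
have oWB : open (W `&` B) by apply: openI => //; exact: scs_open sB.
have mVA : measurable (V `&` A : set (borel H)) by exact: open_borel.
have [C [cC CVA Clim]] := sregular_integral_compacts smuA oVA
  (f := fun h => (delta h)%:E) delta0 ltac:(exact/measurable_EFinP).
have [D [cD DWB Dlim]] := sregular_integral_compacts smuB oWB
  (f := fun k => 1) (fun=> lee01) ltac:(exact: measurable_cst).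
have mC k : measurable (C k : set (borel H)) by exact: compact_borel lcH.1 (cC k).
have mD k : measurable (D k : set (borel K)) by exact: compact_borel lcK.1 (cD k).
have IE : \int[mrestr muH mA]_(h in V) (delta h)%:E =
    \int[mrestr muH mA]_(h in V `&` A) (delta h)%:E.
  rewrite (@ge0_negligible_integral _ _ _ (mrestr muH mA) V (V `\` A))//.
  - by rewrite setDD.
  - exact: measurableD.
  - by apply: (measurable_funS measurableT) => //; exact/measurable_EFinP.
  - by move=> x _; rewrite lee_fin.
  - transitivity (muH set0); last exact: measure0.
    by congr (muH _); rewrite -subset0 => x [[]].
have wE : mrestr muK mB W = \int[mrestr muK mB]_(k in W `&` B) 1.
  rewrite -WE; last exact: open_borel.
  by congr (muK _); rewrite -setIA setIid.
(* Each pair of compact subsets of the two sides has cutoffs whose tensor product lies below the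
   indicator of the rectangle, which gives the bound with separate indices. *)
rewrite IE wE; apply: (mule_limits_le _ _ _ Clim Dlim).
- by move=> k; apply: integral_ge0 => h _; rewrite lee_fin.
- by move=> k; apply: integral_ge0 => h _; exact: lee01.
- move=> k; rewrite -WE// ge0_fin_numE//.
  apply: (@le_lt_trans _ _ (muK (D k))); last exact: radon_compact (haar_radon hmuK) _ _.
  by apply: le_measure; rewrite ?inE//; exact: measurableI.
move=> i j.
have [phi [cphi phi01 phi1 phiV sphi]] := compact_urysohn lcH.2 lcH.1 R (cC i) oVA (@CVA i).
have [psi [cpsi psi01 psi1 psiV spsi]] := compact_urysohn lcK.2 lcK.1 R (cD j) oWB (@DWB j).
apply: (@le_trans _ _ (\int[lam]_z (phi z.1 * psi z.2)%:E)).
  rewrite tensor//; apply: lee_pmul.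
  - by apply: integral_ge0 => h _; rewrite lee_fin.
  - by apply: integral_ge0 => h _; exact: lee01.
  - apply: integral_le_cutoff => //; first exact: continuous_borel_real.
    by move=> x /CVA[].
  - apply: integral_le_cutoff => //; first exact: continuous_borel_real.
    by move=> x /DWB[].
have mVW : measurable ((V `*` W) `&` (A `*` B) : set (borel G)).
  by apply: open_borel; apply: openI => //; exact: (open_setX oV oW).
have -> : mrestr lam mAB (V `*` W) =
    \int[lam]_z (\1_((V `*` W) `&` (A `*` B) : set (borel G)) z)%:E.
  by rewrite integral_indic// setIT.
apply: ge0_le_integral => //.
- move=> z _; rewrite lee_fin mulr_ge0//; first by have /andP[] := phi01 z.1.
  by have /andP[] := psi01 z.2.
- exact: mtensor.
- by apply/measurable_EFinP; exact: measurable_indic.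
move=> z _; rewrite lee_fin indicE.
have [phi0|/phiV[Vz Az]] := eqVneq (phi z.1) 0%R; first by rewrite phi0 mul0r.
have [psi0|/psiV[Wz Bz]] := eqVneq (psi z.2) 0%R; first by rewrite psi0 mulr0.
rewrite mem_set//= mulr_ile1//; first by have /andP[] := phi01 z.1.
- by have /andP[] := psi01 z.2.
- by have /andP[] := phi01 z.1.
- by have /andP[] := psi01 z.2.
Qed.

(** As w vanishes outside the box, the three measures may be replaced by their restrictions, to
    which [product_disintegration] applies, and then restored. *)
Lemma integral_delta_iterated (w : G -> \bar R) : (forall z, 0 <= w z) ->
  measurable_fun setT (w : borel G -> \bar R) ->
  (forall z, ~ (A `*` B) z -> w z = 0) ->
  \int[lam]_z w z = \int[muH]_h ((delta h)%:E * \int[muK]_k w (h, k)).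
Proof.
move=> w0 mw wAB.
pose d (h : H) : {nonneg R} := NngNum (delta0 h).
have cd : continuous (fun h => (d h)%:num : R) by exact: cdelta.
rewrite -(ge0_integral_mrestr lam mAB)//.
have mw2 h : measurable_fun setT ((fun k => w (h, k)) : borel K -> \bar R).
  apply: (@measurableT_comp _ _ _ (borel K) (borel G) _ w) => //.
  exact: (continuous_borel (@continuous_pairl H K h)).
have miw : measurable_fun setT
    ((fun h => \int[mrestr muK mB]_k w (h, k)) : borel H -> \bar R).
  apply: (@measurable_integral_section R K H (mrestr muK mB) smuB (fun z => w (z.2, z.1))) => //.
  apply: (@measurableT_comp _ _ _ (borel (K * H)%type) (borel G) _ w) => //.
  exact: (continuous_borel (@continuous_swap H K)).
rewrite (@product_disintegration R H K (mrestr muH mA) smuA (mrestr muK mB) smuB d cd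
  (mrestr lam mAB) (sregular_rect_regular smuAB))//; last exact: open_rectangle_measure.
have miw0 h : 0 <= \int[mrestr muK mB]_k w (h, k) by exact: integral_ge0.
rewrite ge0_integral_mrestr.
- apply: eq_integral => h _; congr (_ * _); apply: ge0_integral_mrestr => //.
  by move=> k nBk; apply: wAB => -[].
- by move=> h; apply: mule_ge0 => //; rewrite lee_fin.
- by apply: emeasurable_funM => //; apply/measurable_EFinP; exact: continuous_borel_real.
- by move=> h nAh; under eq_integral do [rewrite wAB; last by case]; rewrite integral0 mule0.
Qed.

End DeltaMeasure.

(** * Convolution of nonnegative functions *)

Section NonnegativeConvolution.
Context (R : realType) (H K : topologicalGroupType) (tau : cont_hom_aut H K).
Hypotheses (lcH : locally_compact_group H) (lcK : locally_compact_group K).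
Local Notation G := (semidirect tau).
Variables (lam : {measure set (borel G) -> \bar R}) (hlam : left_haar_measure lam).
Local Open Scope ereal_scope.

Let hG : hausdorff_space G.
Proof. exact: hausdorff_prod lcH.1 lcK.1. Qed.

(** Left translation by the inverse of (1, s) in the semidirect product: the automorphism attached
    to 1 is the identity, so tau does not show. *)
Definition fshift (s : K) (x : G) : G := (x.1, (s^-1 * x.2)%g).

Lemma shiftM s s' x : fshift (s * s')%g x = fshift s' (fshift s x).
Proof. by rewrite /fshift/= invgM mulgA. Qed.

Lemma continuous_shift_pair : continuous (fun z : G * G => fshift z.1.2 z.2 : G).
Proof.
pose Z := ((H * K) * (H * K))%type.
have c1 : continuous (fun z : Z => z.1) by exact/Defs.continuous_fst_comp/Defs.continuous_idfun.
have c2 : continuous (fun z : Z => z.2) by exact/Defs.continuous_snd_comp/Defs.continuous_idfun.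
have c12 := Defs.continuous_snd_comp c1.
have c21 := Defs.continuous_fst_comp c2; have c22 := Defs.continuous_snd_comp c2.
apply: (@Defs.continuous_pair_fun Z H K) => //.
exact: (Defs.continuous_comp_fun (Defs.continuous_pair_fun
  (Defs.continuous_comp_fun c12 (@invg_continuous K)) c22) (@mulg_continuous K)).
Qed.

Lemma continuous_shift s : continuous (fshift s).
Proof.
move=> x; apply: (continuous_comp (f := fun x : G => ((1%g, s) : G, x))
  (g := fun z : G * G => fshift z.1.2 z.2)); last exact: continuous_shift_pair.
exact: continuous_pairl.
Qed.

Lemma shift_image s (E : set G) :
  fshift s @^-1` E = [set (((1%g, s) : G) * x)%g | x in E].
Proof.
have mulE (x : G) : (((1%g, s) : G) * x)%g = (x.1, (s * x.2)%g) :> G.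
  by rewrite [LHS](_ : _ = ((1 * x.1)%g, (s * tau 1%g x.2)%g))// Defs.cha1 mul1g.
apply/seteqP; split=> [[a b] Eab|_ [[a b] Eab <-]].
  by exists (fshift s (a, b)) => //; rewrite mulE /= mulgA mulgV mul1g.
by rewrite mulE /fshift/= mulgA mulVg mul1g.
Qed.

Lemma integral_shift s (v : G -> \bar R) : (forall x, 0 <= v x) ->
  measurable_fun setT (v : borel G -> \bar R) ->
  \int[lam]_x v (fshift s x) = \int[lam]_x v x.
Proof.
move=> v0 mv; rewrite -(integral_image_measure (@continuous_shift s) lam)//.
apply: eq_measure_integral => E mE _.
change (lam (fshift s @^-1` E) = lam E).
by rewrite shift_image; exact: (haar_left hlam).
Qed.

Lemma measurable_shift_pair (v : G -> \bar R) :
  measurable_fun setT (v : borel G -> \bar R) ->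
  measurable_fun setT ((fun z : G * G => v (fshift z.1.2 z.2)) : borel (G * G)%type -> \bar R).
Proof.
move=> mv; apply: (@measurableT_comp _ _ _ (borel (G * G)%type) (borel G) _ v) => //.
exact: continuous_borel continuous_shift_pair.
Qed.

Lemma measurable_shift s (v : G -> \bar R) :
  measurable_fun setT (v : borel G -> \bar R) ->
  measurable_fun setT ((fun x => v (fshift s x)) : borel G -> \bar R).
Proof.
move=> mv; apply: (@measurableT_comp _ _ _ (borel G) (borel G) _ v) => //.
exact: continuous_borel (@continuous_shift s).
Qed.

(* For F, u >= 0 this is the left tau-convolution: the factor delta(t) is part of lam
   and the variable t of y enters only through F. *)
Definition nconv (F u : G -> \bar R) (x : G) : \bar R :=
  \int[lam]_y (F y * u (fshift y.2 x)).

Section Box.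
Variables (A : set H) (B : set K).
Hypotheses (sA : sigma_compact_subgroup A) (sB : sigma_compact_subgroup B).
Local Notation M := (A `*` B : set G).

Let oM : open M. Proof. by have [] := box_open_closed tau sA sB. Qed.
Let mM : measurable (M : set (borel G)) := open_borel oM.
Let smM : sregular (mrestr lam mM).
Proof.
have [oAB cAB sAB] := box_open_closed tau sA sB.
exact: (sregular_mrestr (haar_radon hlam) hG oM cAB sAB).
Qed.

Lemma shift_box (s : K) (x : G) : B s -> M (fshift s x) <-> M x.
Proof.
move=> Bs; split=> -[/= Ax Bx]; split => //=.
  rewrite -[x.2]mul1g -(mulgV s) -mulgA; exact: scs_mul sB _ _ Bs Bx.
exact: scs_mul sB _ _ (scs_inv sB Bs) Bx.
Qed.

Lemma measurable_box_integral (T : ptopologicalType) (w : G * T -> \bar R) :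
  (forall z, 0 <= w z) -> measurable_fun setT (w : borel (G * T)%type -> \bar R) ->
  (forall y x, ~ M y -> w (y, x) = 0) ->
  measurable_fun setT ((fun x => \int[lam]_y w (y, x)) : borel T -> \bar R).
Proof.
move=> w0 mw wM; rewrite (_ : (fun _ => _) = fun x => \int[mrestr lam mM]_y w (y, x)).
  exact: measurable_integral_section.
apply/funext => x; rewrite ge0_integral_mrestr//.
  apply: (@measurableT_comp _ _ _ (borel G) (borel (G * T)%type) _ w) => //.
  exact: (continuous_borel (@continuous_pairr G T x)).
by move=> y; exact: wM.
Qed.

Lemma tonelli_box (w : G * G -> \bar R) :
  (forall z, 0 <= w z) -> measurable_fun setT (w : borel (G * G)%type -> \bar R) ->
  (forall y x, ~ (M y /\ M x) -> w (y, x) = 0) ->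
  \int[lam]_y \int[lam]_x w (y, x) = \int[lam]_x \int[lam]_y w (y, x).
Proof.
move=> w0 mw wM.
have m1 y : measurable_fun setT ((fun x => w (y, x)) : borel G -> \bar R).
  apply: (@measurableT_comp _ _ _ (borel G) (borel (G * G)%type) _ w) => //.
  exact: (continuous_borel (@continuous_pairl G G y)).
have m2 x : measurable_fun setT ((fun y => w (y, x)) : borel G -> \bar R).
  apply: (@measurableT_comp _ _ _ (borel G) (borel (G * G)%type) _ w) => //.
  exact: (continuous_borel (@continuous_pairr G G x)).
have E1 y : \int[lam]_x w (y, x) = \int[mrestr lam mM]_x w (y, x).
  by rewrite ge0_integral_mrestr// => x nMx; apply: wM => -[].
have E2 x : \int[lam]_y w (y, x) = \int[mrestr lam mM]_y w (y, x).
  by rewrite ge0_integral_mrestr// => y nMy; apply: wM => -[].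
have mI2 := @measurable_integral_section _ G G _ smM w w0 mw.
have mI1 := @measurable_integral_section _ G G _ smM (fun z => w (z.2, z.1)) (fun=> w0 _)
  ltac:(exact: (@measurableT_comp _ _ _ (borel (G * G)%type) (borel (G * G)%type) _ w _ _
    mw (continuous_borel (@continuous_swap G G)))).
under eq_integral do rewrite E1.
under [RHS]eq_integral do rewrite E2.
rewrite -(ge0_integral_mrestr lam mM)//; last 2 first.
- by move=> y; exact: integral_ge0.
- by move=> y nMy; apply: integral0_eq => x _; apply: wM => -[].
rewrite -[RHS](ge0_integral_mrestr lam mM)//; last 2 first.
- by move=> y; exact: integral_ge0.
- by move=> x nMx; apply: integral0_eq => y _; apply: wM => -[].
exact: tonelli.
Qed.

Lemma measurable_nconv_integrand (F u : G -> \bar R) :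
  measurable_fun setT (F : borel G -> \bar R) ->
  measurable_fun setT (u : borel G -> \bar R) ->
  measurable_fun setT ((fun z : G * G => F z.1 * u (fshift z.1.2 z.2)) :
    borel (G * G)%type -> \bar R).
Proof.
move=> mF mu; apply: emeasurable_funM; last exact: measurable_shift_pair.
apply: (@measurableT_comp _ _ _ (borel (G * G)%type) (borel G) _ F) => //.
by apply: continuous_borel => z; exact: cvg_fst.
Qed.

Lemma nconv_ge0 (F u : G -> \bar R) x : (forall x, 0 <= F x) -> (forall x, 0 <= u x) ->
  0 <= nconv F u x.
Proof. by move=> F0 u0; apply: integral_ge0 => y _; exact: mule_ge0. Qed.

Variable F : G -> \bar R.
Hypotheses (F0 : forall x, 0 <= F x) (mF : measurable_fun setT (F : borel G -> \bar R)).
Hypothesis FM : forall x, ~ M x -> F x = 0.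

(** It is F that confines the variable of integration to the box; u may be any nonnegative Borel
    function, as the case p = +oo requires. *)
Lemma measurable_nconv (u : G -> \bar R) : (forall x, 0 <= u x) ->
  measurable_fun setT (u : borel G -> \bar R) ->
  measurable_fun setT (nconv F u : borel G -> \bar R).
Proof.
move=> u0 mu; apply: (@measurable_box_integral G
  (fun z : G * G => F z.1 * u (fshift z.1.2 z.2))).
- by move=> z; exact: mule_ge0.
- exact: measurable_nconv_integrand.
- by move=> y x nMy; rewrite /= FM// mul0e.
Qed.

(** After the exchange of integrals, invariance of lam makes every translate of u integrate to the
    same value. The exchange stays within the box: for y in it, x lies in it exactly when
    [fshift y.2 x] does. *)
Lemma integral_nconv (u : G -> \bar R) : (forall x, 0 <= u x) ->
  measurable_fun setT (u : borel G -> \bar R) -> (forall x, ~ M x -> u x = 0) ->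
  \int[lam]_x nconv F u x = (\int[lam]_x F x) * \int[lam]_x u x.
Proof.
move=> u0 mu uM.
rewrite -(@tonelli_box (fun z : G * G => F z.1 * u (fshift z.1.2 z.2))).
- rewrite -ge0_integralZr//; last exact: integral_ge0.
  apply: eq_integral => y _; rewrite /= ge0_integralZl// ?integral_shift//.
  exact: measurable_shift.
- by move=> z; exact: mule_ge0.
- exact: measurable_nconv_integrand.
- move=> y x nM /=; have [[Ay By]|nMy] := pselect (M y); last by rewrite FM// mul0e.
  by rewrite uM ?mule0// => /(shift_box _ By) Mx; apply: nM.
Qed.

(** Tonelli exchanges y and z. In the inner convolution at [fshift z.2 x], invariance lets y be
    replaced by [fshift z.2 y]; the two translations of x then compose to the one by y.2, which is
    the integrand of the other side. The identity holds at every x. *)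
Lemma nconvA (g u : G -> \bar R) x : (forall x, 0 <= g x) -> (forall x, 0 <= u x) ->
  measurable_fun setT (g : borel G -> \bar R) ->
  measurable_fun setT (u : borel G -> \bar R) -> (forall x, ~ M x -> g x = 0) ->
  nconv (nconv F g) u x = nconv F (nconv g u) x.
Proof.
move=> g0 u0 mg mu gM.
pose w (z : G * G) := F z.1 * g (fshift z.1.2 z.2) * u (fshift z.2.2 x).
have mux : measurable_fun setT ((fun y : G => u (fshift y.2 x)) : borel G -> \bar R).
  apply: (@measurableT_comp _ _ _ (borel G) (borel G) _ u) => //.
  apply: continuous_borel => y.
  apply: (continuous_comp (f := fun y : G => (y, x)) (g := fun z : G * G => fshift z.1.2 z.2)).
    exact: continuous_pairr.
  exact: continuous_shift_pair.
have mw : measurable_fun setT (w : borel (G * G)%type -> \bar R).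
  apply: emeasurable_funM; first exact: measurable_nconv_integrand.
  apply: (@measurableT_comp _ _ _ (borel (G * G)%type) (borel G) _
    (fun y => u (fshift y.2 x))) => //.
  by apply: continuous_borel => z; exact: cvg_snd.
have w0 z : 0 <= w z by rewrite /w !mule_ge0.
have mgs y : measurable_fun setT ((fun z => F z * g (fshift z.2 y)) : borel G -> \bar R).
  exact: (@measurableT_comp _ _ _ (borel G) (borel (G * G)%type) _
    (fun z : G * G => F z.1 * g (fshift z.1.2 z.2)) _ _
    (measurable_nconv_integrand mF mg) (continuous_borel (@continuous_pairr G G y))).
transitivity (\int[lam]_y \int[lam]_z w (z, y)).
  apply: eq_integral => y _; rewrite -ge0_integralZr//.
  by move=> z _; exact: mule_ge0.
rewrite -tonelli_box//; last first.
  move=> z y nM; rewrite /w/=; have [[Az Bz]|nMz] := pselect (M z); last first.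
    by rewrite FM// !mul0e.
  by rewrite gM ?mule0 ?mul0e// => /(shift_box _ Bz) My; apply: nM.
apply: eq_integral => z _.
have mgu : measurable_fun setT
    ((fun y => g y * u (fshift y.2 (fshift z.2 x))) : borel G -> \bar R).
  apply: emeasurable_funM => //.
  apply: (@measurableT_comp _ _ _ (borel G) (borel G) _ u) => //.
  apply: continuous_borel => y.
  apply: (continuous_comp (f := fun y : G => (y, fshift z.2 x))
    (g := fun z : G * G => fshift z.1.2 z.2)); first exact: continuous_pairr.
  exact: continuous_shift_pair.
have -> : nconv g u (fshift z.2 x) =
    \int[lam]_y (g (fshift z.2 y) * u (fshift (fshift z.2 y).2 (fshift z.2 x))).
  rewrite (integral_shift z.2 (v := fun y => g y * u (fshift y.2 (fshift z.2 x))))//.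
  by move=> y; exact: mule_ge0.
rewrite -ge0_integralZl//.
- apply: eq_integral => y _; rewrite /w/= muleA; congr (_ * u _).
  by rewrite -shiftM /= mulgA mulgV mul1g.
- by apply: (@measurable_shift z.2 (fun y => g y * u (fshift y.2 (fshift z.2 x)))).
- by move=> y _; exact: mule_ge0.
Qed.

End Box.

End NonnegativeConvolution.

(** * Young's inequality *)

Section LnormExtended.
Context d (T : measurableType d) (R : realType) (mu : {measure set T -> \bar R}).
Local Open Scope ereal_scope.

(** Stated for extended-real functions because the convolutions to be compared may be infinite at
    some points. *)
Lemma ae_le_Lnorm (p : \bar R) (f g : T -> \bar R) : 1 <= p ->
  measurable_fun setT f -> measurable_fun setT g ->
  (\forall x \ae mu, `|f x| <= `|g x|) -> 'N[mu]_p[f] <= 'N[mu]_p[g].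
Proof.
move=> p1 mf mg fg; rewrite unlock /Lnorm; case: p p1 => [r|_|//].
- rewrite lee_fin => r1; have r0 : (0 <= r)%R by rewrite (le_trans _ r1).
  have mpow (h : T -> \bar R) : measurable_fun setT h ->
      measurable_fun setT (fun x => `|h x| `^ r).
    by move=> mh; apply: (measurableT_comp (measurable_poweR _)); exact: measurableT_comp.
  have le0 (h : T -> \bar R) : 0 <= \int[mu]_x `|h x| `^ r.
    by apply: integral_ge0 => x _; exact: poweR_ge0.
  rewrite gt0_ler_poweR ?invr_ge0 ?in_itv/= ?le0 ?leey//.
  apply: ae_ge0_le_integral => //.
  + by move=> x _; exact: poweR_ge0.
  + exact: mpow.
  + by move=> x _; exact: poweR_ge0.
  + exact: mpow.
  + apply: ae_mono fg => x fgx _; rewrite gt0_ler_poweR ?in_itv/= ?leey ?andbT//.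
- by case: ifPn => // _; apply: le_ess_sup.
Qed.

Lemma Lnorm_lty_ae (p : \bar R) (f : T -> \bar R) : 1 <= p ->
  measurable_fun setT f -> 'N[mu]_p[f] < +oo -> \forall x \ae mu, `|f x| < +oo.
Proof.
move=> p1 mf; rewrite unlock /Lnorm; case: p p1 => [r|_|//].
- rewrite lee_fin => r1; have r0 : (0 < r)%R by rewrite (lt_le_trans _ r1).
  have mp : measurable_fun setT (fun x => `|f x| `^ r).
    by apply: (measurableT_comp (measurable_poweR _)); exact: measurableT_comp.
  move=> /lty_poweRy; rewrite invr_eq0 gt_eqF// => /(_ erefl) foo.
  have : mu.-integrable setT (fun x => `|f x| `^ r).
    apply/integrableP; split => //.
    by under eq_integral do rewrite gee0_abs ?poweR_ge0//.
  move=> /(integrable_ae measurableT); apply: ae_mono => x /(_ I) fin.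
  have : `|f x| `^ r < +oo by rewrite -ge0_fin_numE// poweR_ge0.
  by move=> /lty_poweRy; rewrite gt_eqF//; apply.
- case: ifPn => [mu0|].
    move=> foo; apply: ae_mono (ess_sup_ge mu (abse \o f)) => x /= /le_lt_trans; exact.
  (* On a space of measure 0 the norm for p = +oo is 0 by convention, and the whole space serves as
     exceptional null set. *)
  rewrite -leNgt measure_le0 => /eqP mu0 _.
  by exists setT; split => //.
Qed.

(** Hoelder's inequality for the measure F dmu, obtained from the unweighted one by splitting F =
    F^(1/q) F^(1/r) with the conjugate exponent q = r / (r - 1); raising to the power r leaves the
    exponent r / q = r - 1 on the total mass. *)
Lemma hoelder_weight (F v : T -> R) (r : R) : (1 < r)%R ->
  (forall x, 0 <= F x)%R -> (forall x, 0 <= v x)%R ->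
  measurable_fun setT F -> measurable_fun setT v ->
  (\int[mu]_x (F x * v x)%:E) `^ r <=
  (\int[mu]_x (F x)%:E) `^ (r - 1) * \int[mu]_x (F x * v x `^ r)%:E.
Proof.
move=> r1 F0 v0 mF mv; have r0 : (0 < r)%R by exact: lt_trans r1.
have rm1 : (0 < r - 1)%R by rewrite subr_gt0.
pose q := (r / (r - 1))%R; have q0 : (0 < q)%R by exact: divr_gt0.
have qV : (q^-1 = 1 - r^-1)%R.
  by rewrite /q invf_div mulrBl mul1r divff// gt_eqF.
have qr : (q^-1 + r^-1 = 1)%R by rewrite qV subrK.
have mf : measurable_fun setT (fun x => F x `^ q^-1)%R.
  exact: (measurableT_comp (measurable_powR _)).
have mg : measurable_fun setT (fun x => F x `^ r^-1 * v x)%R.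
  apply: measurable_funM => //; exact: (measurableT_comp (measurable_powR _)).
have := hoelder mu mf mg q0 r0 qr.
rewrite Lnorm1.
have -> : \int[mu]_x `|(EFin \o ((fun x => F x `^ q^-1) \* (fun x => F x `^ r^-1 * v x))%R) x| =
    \int[mu]_x (F x * v x)%:E.
  apply: eq_integral => x _ /=; congr (_%:E).
  rewrite mulrA -powRD ?qr ?powRr1 ?ger0_norm ?mulr_ge0//.
  by rewrite oner_eq0.
have -> : 'N[mu]_q%:E[EFin \o (fun x => F x `^ q^-1)%R] = (\int[mu]_x (F x)%:E) `^ q^-1.
  rewrite unlock; congr (_ `^ _); apply: eq_integral => x _ /=.
  by rewrite ger0_norm ?powR_ge0// -powRrM mulVf ?powRr1 ?gt_eqF.
have -> : 'N[mu]_r%:E[EFin \o (fun x => F x `^ r^-1 * v x)%R] =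
    (\int[mu]_x (F x * v x `^ r)%:E) `^ r^-1.
  rewrite unlock; congr (_ `^ _); apply: eq_integral => x _ /=.
  rewrite ger0_norm ?mulr_ge0 ?powR_ge0// powRM ?powR_ge0//.
  by rewrite -powRrM mulVf ?powRr1 ?gt_eqF.
have I0 : 0 <= \int[mu]_x (F x)%:E by apply: integral_ge0 => x _; rewrite lee_fin.
have J0 : 0 <= \int[mu]_x (F x * v x `^ r)%:E.
  by apply: integral_ge0 => x _; rewrite lee_fin mulr_ge0 ?powR_ge0.
have L0 : 0 <= \int[mu]_x (F x * v x)%:E.
  by apply: integral_ge0 => x _; rewrite lee_fin mulr_ge0.
move=> h; apply: le_trans.
  apply: (gt0_ler_poweR (ltW r0) _ _ h); rewrite in_itv/= ?leey ?L0//.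
  by rewrite mule_ge0 ?poweR_ge0.
rewrite poweRM ?poweR_ge0// -!poweRrM mulVf ?gt_eqF// poweRe1//.
rewrite (_ : q^-1 * r = r - 1)%R// qV mulrBl mul1r mulVf ?gt_eqF//.
Qed.

End LnormExtended.

Section Young.
Context (R : realType) (H K : topologicalGroupType) (tau : cont_hom_aut H K).
Hypotheses (lcH : locally_compact_group H) (lcK : locally_compact_group K).
Local Notation G := (semidirect tau).
Variables (lam : {measure set (borel G) -> \bar R}) (hlam : left_haar_measure lam).
Local Open Scope ereal_scope.

Lemma exists_box (S : nat -> set G) : (forall k, sub_sigma_compact (S k)) ->
  exists A : set H, exists B : set K,
    [/\ sigma_compact_subgroup A, sigma_compact_subgroup B &
        forall k, S k `<=` A `*` B].
Proof.
move=> /sub_sigma_compact_bigcup /(sub_sigma_compact_box lcH lcK)[A [B [sA sB SAB]]].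
by exists A, B; split => // k; apply: subset_trans SAB; exact: bigcup_sup.
Qed.

Lemma exists_box2 (S1 S2 : set G) : sub_sigma_compact S1 -> sub_sigma_compact S2 ->
  exists A : set H, exists B : set K,
    [/\ sigma_compact_subgroup A, sigma_compact_subgroup B,
        S1 `<=` A `*` B & S2 `<=` A `*` B].
Proof.
move=> s1 s2; have [|A [B [sA sB SAB]]] := @exists_box (fun k => if k is 0%N then S1 else S2).
  by case.
by exists A, B; split => //; [exact: (SAB 0%N)|exact: (SAB 1%N)].
Qed.

Variable F : G -> \bar R.
Hypotheses (F0 : forall x, 0 <= F x) (mF : measurable_fun setT (F : borel G -> \bar R)).
Hypothesis Foo : \int[lam]_x F x < +oo.

Let sF : sub_sigma_compact [set x | F x != 0].
Proof. exact: (integrable_sub_sigma_compact lcH lcK hlam F0 mF Foo). Qed.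

Let off (S : set G) (f : G -> \bar R) : [set x | f x != 0] `<=` S ->
  forall x, ~ S x -> f x = 0.
Proof. by move=> fS x nS; apply: contra_notP nS => /eqP fx; exact: fS. Qed.

Lemma measurable_nconv_L1 (u : G -> \bar R) : (forall x, 0 <= u x) ->
  measurable_fun setT (u : borel G -> \bar R) ->
  measurable_fun setT (nconv lam F u : borel G -> \bar R).
Proof.
move=> u0 mu; have [A [B [sA sB FAB _]]] := exists_box2 sF sF.
exact: (measurable_nconv lcH lcK hlam sA sB F0 mF (off FAB)).
Qed.

(** A box holds N because null sets have finite measure. The convolution of F with the indicator of
    N has integral 0, so it vanishes at almost every x, and then its integrand vanishes at almost
    every y. Hence changing u on a null set does not matter, and essential bounds on u survive
    translation. *)
Lemma null_shift (N : set G) : measurable (N : set (borel G)) -> lam N = 0 ->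
  {ae lam, forall x : G, {ae lam, forall y : G, F y = 0 \/ ~ N (fshift y.2 x)}}.
Proof.
move=> mN N0.
have sN : sub_sigma_compact N.
  by apply: (measurable_finite_sub_sigma_compact lcH lcK hlam mN); rewrite N0.
have [A [B [sA sB FAB NAB]]] := exists_box2 sF sN.
pose v (x : G) : \bar R := (\1_(N : set (borel G)) x)%:E.
have mv : measurable_fun setT (v : borel G -> \bar R).
  by apply/measurable_EFinP; exact: measurable_indic.
have v0 x : 0 <= v x by rewrite lee_fin.
have vAB x : ~ (A `*` B) x -> v x = 0.
  by move=> nx; rewrite /v indicE memNset// => /NAB.
have mnc := measurable_nconv lcH lcK hlam sA sB F0 mF (off FAB) v0 mv.
have : \int[lam]_x `|nconv lam F v x| = 0.
  under eq_integral do rewrite gee0_abs ?nconv_ge0//.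
  rewrite (integral_nconv lcH lcK hlam sA sB F0 mF (off FAB))//.
  by rewrite integral_indic// setIT N0 mule0.
move=> /(ae_eq_integral_abs _ measurableT mnc).
apply: ae_mono => x /(_ I) /= nc0.
have mi : measurable_fun setT ((fun y => F y * v (fshift y.2 x)) : borel G -> \bar R).
  exact: (@measurableT_comp _ _ _ (borel G) (borel (G * G)%type) _
    (fun z : G * G => F z.1 * v (fshift z.1.2 z.2)) _ _
    (measurable_nconv_integrand mF mv) (continuous_borel (@continuous_pairr G G x))).
have : \int[lam]_y `|F y * v (fshift y.2 x)| = 0.
  by under eq_integral do rewrite gee0_abs ?mule_ge0//.
move=> /(ae_eq_integral_abs _ measurableT mi).
apply: ae_mono => y /(_ I) /= /eqP; rewrite mule_eq0 => /orP[/eqP ->|/eqP vy]; first by left.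
right=> Ny; move: vy; rewrite /v indicE mem_set//= => -[] /eqP.
by rewrite oner_eq0.
Qed.

Lemma nconv_ae_eq (u v : G -> \bar R) : measurable_fun setT (u : borel G -> \bar R) ->
  measurable_fun setT (v : borel G -> \bar R) ->
  (\forall x \ae lam, u x = v x) -> \forall x \ae lam, nconv lam F u x = nconv lam F v x.
Proof.
move=> mu mv [N [mN N0 uvN]]; apply: ae_mono (null_shift mN N0) => x Nx.
have mi (w : G -> \bar R) : measurable_fun setT (w : borel G -> \bar R) ->
    measurable_fun setT ((fun y => F y * w (fshift y.2 x)) : borel G -> \bar R).
  move=> mw; exact: (@measurableT_comp _ _ _ (borel G) (borel (G * G)%type) _
    (fun z : G * G => F z.1 * w (fshift z.1.2 z.2)) _ _
    (measurable_nconv_integrand mF mw) (continuous_borel (@continuous_pairr G G x))).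
apply: ae_eq_integral => //; [exact: mi|exact: mi|].
apply: ae_mono Nx => y [-> _|nN _]; first by rewrite !mul0e.
by congr (_ * _); apply: contrapT => neq; apply: nN; exact: uvN.
Qed.

End Young.

Section YoungLp.
Context (R : realType) (H K : topologicalGroupType) (tau : cont_hom_aut H K).
Hypotheses (lcH : locally_compact_group H) (lcK : locally_compact_group K).
Local Notation G := (semidirect tau).
Variables (lam : {measure set (borel G) -> \bar R}) (hlam : left_haar_measure lam).
Local Open Scope ereal_scope.
Variables (f u : G -> R).
Hypotheses (f0 : forall x, (0 <= f x)%R) (u0 : forall x, (0 <= u x)%R).
Hypotheses (mf : measurable_fun setT (f : borel G -> R)).
Hypotheses (mu : measurable_fun setT (u : borel G -> R)).
Hypothesis foo : \int[lam]_x (f x)%:E < +oo.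

Let F x := (f x)%:E.
Let U x := (u x)%:E.
Let F0 x : 0 <= F x. Proof. by rewrite lee_fin. Qed.
Let U0 x : 0 <= U x. Proof. by rewrite lee_fin. Qed.
Let mF : measurable_fun setT (F : borel G -> \bar R). Proof. exact/measurable_EFinP. Qed.
Let mU : measurable_fun setT (U : borel G -> \bar R). Proof. exact/measurable_EFinP. Qed.
Let sF : sub_sigma_compact [set x | F x != 0].
Proof. exact: (integrable_sub_sigma_compact lcH lcK hlam F0 mF foo). Qed.
Let off (S : set G) (v : G -> \bar R) : [set x | v x != 0] `<=` S ->
  forall x, ~ S x -> v x = 0.
Proof. by move=> vS x nS; apply: contra_notP nS => /eqP vx; exact: vS. Qed.

(** For finite p the pointwise Hoelder bound is integrated; u^p is integrable, so one box holds both
    F and u. For p = +oo, u need not fit in a box, and [null_shift] controls the translates of the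
    set where u exceeds its essential supremum. *)
Lemma Lnorm_nconv (p : \bar R) : 1 <= p -> 'N[lam]_p[U] < +oo ->
  'N[lam]_p[nconv lam F U] <= (\int[lam]_x F x) * 'N[lam]_p[U].
Proof.
move=> p1 Up.
have nc0 x : 0 <= nconv lam F U x by exact: nconv_ge0.
have I0 : 0 <= \int[lam]_x F x by exact: integral_ge0.
have Ifin : \int[lam]_x F x \is a fin_num by rewrite ge0_fin_numE.
case: p p1 Up => [r|_|//].
- rewrite lee_fin => r1 Up; have r0 : (0 < r)%R by rewrite (lt_le_trans _ r1).
  pose Ur x := (u x `^ r)%:E.
  have mUr : measurable_fun setT (Ur : borel G -> \bar R).
    by apply/measurable_EFinP; exact: (measurableT_comp (measurable_powR _)).
  have Ur0 x : 0 <= Ur x by rewrite lee_fin powR_ge0.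
  have UrE : \int[lam]_x `|U x| `^ r = \int[lam]_x Ur x.
    by apply: eq_integral => x _; rewrite gee0_abs.
  have Uroo : \int[lam]_x Ur x < +oo.
    move: Up; rewrite unlock UrE => /lty_poweRy; rewrite invr_eq0 gt_eqF//; exact.
  have sU : sub_sigma_compact [set x | Ur x != 0].
    exact: (integrable_sub_sigma_compact lcH lcK hlam Ur0 mUr Uroo).
  have [A [B [sA sB FAB UAB]]] := exists_box2 lcH lcK sF sU.
  have mnc := measurable_nconv lcH lcK hlam sA sB F0 mF (off FAB) U0 mU.
  have mncr := measurable_nconv lcH lcK hlam sA sB F0 mF (off FAB) Ur0 mUr.
  rewrite unlock UrE.
  have key : \int[lam]_x `|nconv lam F U x| `^ r <=
      (\int[lam]_x F x) `^ r * \int[lam]_x Ur x.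
    have pw x : `|nconv lam F U x| `^ r <=
        (\int[lam]_x F x) `^ (r - 1) * nconv lam F Ur x.
      (* At r = 1 the conjugate exponent would be infinite; there both sides are the same
         integral. *)
      rewrite gee0_abs//; move: r1; rewrite le_eqVlt => /predU1P[r1E|r1].
        rewrite -r1E subrr poweRe0 mul1e poweRe1; last exact: nc0.
        rewrite (_ : nconv lam F U x = nconv lam F Ur x); first exact: lexx.
        by apply: eq_integral => y _; rewrite /Ur -r1E powRr1.
      apply: (hoelder_weight lam r1 f0 _ mf) => [y|]; first exact: u0.
      apply: (@measurableT_comp _ _ _ (borel G) (borel (G * G)%type) _
        (fun z : G * G => u (fshift z.1.2 z.2)) _ _ _
        (continuous_borel (@continuous_pairr G G x))).
      by apply/measurable_EFinP; exact: (measurable_shift_pair mU).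
    apply: (@le_trans _ _ (\int[lam]_x ((\int[lam]_x F x) `^ (r - 1) * nconv lam F Ur x))).
      apply: ge0_le_integral => //.
      + by move=> x _; exact: poweR_ge0.
      + by apply: (measurableT_comp (measurable_poweR _)); exact: measurableT_comp.
      + exact: measurable_funeM.
    rewrite ge0_integralZl ?poweR_ge0//; last by move=> x _; apply: nconv_ge0.
    rewrite (integral_nconv lcH lcK hlam sA sB F0 mF (off FAB) Ur0 mUr (off UAB)).
    rewrite muleA lee_wpmul2r ?integral_ge0//.
    have [->|In0] := eqVneq (\int[lam]_x F x) 0.
      by rewrite mule0 poweR_ge0.
    rewrite -[X in _ * X](poweRe1 I0) -poweRD ?subrK//.
    by rewrite /poweRD_def subrK gt_eqF.
  apply: le_trans.
    apply: (gt0_ler_poweR _ _ _ key); rewrite ?invr_ge0 ?ltW// in_itv/= leey andbT.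
      by apply: integral_ge0 => x _; exact: poweR_ge0.
    by apply: mule_ge0; [exact: poweR_ge0|exact: integral_ge0].
  rewrite poweRM ?poweR_ge0 ?integral_ge0// -poweRrM divff ?gt_eqF// poweRe1//.
- move=> Uoo.
  have [A [B [sA sB FAB _]]] := exists_box2 lcH lcK sF sF.
  have mnc := measurable_nconv lcH lcK hlam sA sB F0 mF (off FAB) U0 mU.
  move: Uoo; rewrite unlock /Lnorm; case: ifPn => [mu0|]; last by rewrite mule0.
  set M := ess_sup _ _ => Moo.
  have [N [mN N0 UN]] := ess_sup_ge lam (abse \o U).
  apply/ess_supP; apply: ae_mono (null_shift lcH lcK hlam F0 mF foo mN N0) => x Nx.
  rewrite /= gee0_abs//.
  have M0 : 0 <= M by apply: ess_sup_gee => //; apply: ae_all => z; exact: abse_ge0.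
  rewrite -ge0_integralZr//; apply: ae_ge0_le_integral => //.
  + by move=> y _; exact: mule_ge0.
  + exact: (@measurableT_comp _ _ _ (borel G) (borel (G * G)%type) _
      (fun z : G * G => F z.1 * U (fshift z.1.2 z.2)) _ _
      (measurable_nconv_integrand mF mU) (continuous_borel (@continuous_pairr G G x))).
  + by move=> y _; exact: mule_ge0.
  + by apply: emeasurable_funM => //; exact: measurable_cst.
  apply: ae_mono Nx => y [-> _|nN _]; first by rewrite !mul0e.
  apply: lee_wpmul2l => //; apply: contrapT => nle; apply: nN; apply: UN => /= le.
  by apply: nle; move: le; rewrite ger0_norm.
Qed.

End YoungLp.

(** * Complex-valued functions *)

Section ComplexIntegral.
Context d (T : measurableType d) (R : realType) (mu : {measure set T -> \bar R}).
Implicit Types f g : T -> R[i].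
Local Notation Re := complex.Re.
Local Notation Im := complex.Im.

Lemma normr_Re_le (z : R[i]) : `|Re z| <= normc z.
Proof. by rewrite Defs.normcE -sqrtr_sqr ler_wsqrtr// lerDl sqr_ge0. Qed.

Lemma normr_Im_le (z : R[i]) : `|Im z| <= normc z.
Proof. by rewrite Defs.normcE -sqrtr_sqr ler_wsqrtr// lerDr sqr_ge0. Qed.

Lemma cmeasurable_norm f : cmeasurable f ->
  measurable_fun setT (fun x => (normc (f x))%:E).
Proof. by move=> mf; apply/measurable_EFinP; exact: Defs.measurable_normc. Qed.

Lemma cmeasurableM f g : cmeasurable f -> cmeasurable g -> cmeasurable (fun x => f x * g x).
Proof.
move=> [f1 f2] [g1 g2]; split.
- by under eq_fun do rewrite Defs.ReM; apply: measurable_funB; exact: measurable_funM.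
- by under eq_fun do rewrite Defs.ImM; apply: measurable_funD; exact: measurable_funM.
Qed.

Lemma cintegrable_norm f : cmeasurable f ->
  (\int[mu]_x (normc (f x))%:E < +oo)%E -> cintegrable mu f.
Proof.
move=> mf foo; have inorm : mu.-integrable setT (fun x => (normc (f x))%:E).
  apply/integrableP; split; first exact: cmeasurable_norm.
  by under eq_integral do rewrite gee0_abs ?lee_fin ?Defs.normc_ge0//.
split; apply: (le_integrable measurableT _ _ inorm).
- by apply/measurable_EFinP; case: mf.
- move=> x _; rewrite /= lee_fin (le_trans (normr_Re_le _))//.
  by rewrite ger0_norm ?Defs.normc_ge0.
- by apply/measurable_EFinP; case: mf.
- move=> x _; rewrite /= lee_fin (le_trans (normr_Im_le _))//.
  by rewrite ger0_norm ?Defs.normc_ge0.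
Qed.

Lemma eq_ae_cintegral f g : cmeasurable f -> cmeasurable g ->
  (\forall x \ae mu, f x = g x) -> cintegral mu f = cintegral mu g.
Proof.
move=> [f1 f2] [g1 g2] fg; rewrite /cintegral /Rintegral; congr (fine _ +i* fine _)%C.
- apply: ae_eq_integral => //; [exact/measurable_EFinP|exact/measurable_EFinP|].
  by apply: ae_mono fg => x ->.
- apply: ae_eq_integral => //; [exact/measurable_EFinP|exact/measurable_EFinP|].
  by apply: ae_mono fg => x ->.
Qed.

Lemma integrable_realZl (k : R) (h : T -> R) : mu.-integrable setT (EFin \o h) ->
  mu.-integrable setT (EFin \o (fun x => k * h x)).
Proof. by move=> ih; exact: (integrableZl measurableT k ih). Qed.

Lemma integrable_realD (h1 h2 : T -> R) : mu.-integrable setT (EFin \o h1) ->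
  mu.-integrable setT (EFin \o h2) ->
  mu.-integrable setT (EFin \o (fun x => h1 x + h2 x)).
Proof. by move=> i1 i2; exact: (integrableD measurableT i1 i2). Qed.

Lemma integrable_realB (h1 h2 : T -> R) : mu.-integrable setT (EFin \o h1) ->
  mu.-integrable setT (EFin \o h2) ->
  mu.-integrable setT (EFin \o (fun x => h1 x - h2 x)).
Proof. by move=> i1 i2; exact: (integrableB measurableT i1 i2). Qed.

Lemma cintegral_linear (a : R[i]) f g : cintegrable mu f -> cintegrable mu g ->
  cintegral mu (fun x => a * f x + g x) = a * cintegral mu f + cintegral mu g.
Proof.
move=> [f1 f2] [g1 g2].
have iZ (k : R) (h : T -> R) := @integrable_realZl k h.
apply/eqP; rewrite eq_complex; apply/andP; split; apply/eqP.
- rewrite Defs.ReD Defs.ReM /=.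
  rewrite -!RintegralZl// -RintegralB//; [|exact: integrable_realZl|exact: integrable_realZl].
  rewrite -RintegralD//; last by apply: integrable_realB; exact: iZ.
  by congr Rintegral; apply/funext => x; rewrite Defs.ReD Defs.ReM.
- rewrite Defs.ImD Defs.ImM /=.
  rewrite -!RintegralZl// -RintegralD//; [|exact: integrable_realZl|exact: integrable_realZl].
  rewrite -RintegralD//; last by apply: integrable_realD; exact: iZ.
  by congr Rintegral; apply/funext => x; rewrite Defs.ImD Defs.ImM.
Qed.

(** With z the integral, |z|^2 is the integral of Re(conj(z) f), at most |z| times that of |f|. An
    infinite right side makes the claim trivial, so it can be used before convergence is known. *)
Lemma le_normc_cintegral f : cmeasurable f ->
  ((normc (cintegral mu f))%:E <= \int[mu]_x (normc (f x))%:E)%E.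
Proof.
move=> mf; have [foo|] := ltP (\int[mu]_x (normc (f x))%:E)%E +oo%E; last first.
  by rewrite leye_eq => /eqP ->; rewrite leey.
have [i1 i2] := cintegrable_norm mf foo.
set z := cintegral mu f; have [->|z0] := eqVneq (normc z) 0.
  by apply: integral_ge0 => x _; rewrite lee_fin Defs.normc_ge0.
have nz0 : 0 < normc z by rewrite lt0r z0 Defs.normc_ge0.
rewrite -(@lee_pmul2l _ (normc z)%:E)// -EFinM.
have -> : normc z * normc z = Rintegral mu setT (fun x => Re z * Re (f x) + Im z * Im (f x)).
  rewrite RintegralD//; [|exact: integrable_realZl|exact: integrable_realZl].
  rewrite !RintegralZl// -[Rintegral mu setT (fun x => Re _)]/(Re z).
  rewrite -[Rintegral mu setT (fun x => Im _)]/(Im z).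
  by rewrite -expr2 Defs.normcE sqr_sqrtr ?addr_ge0 ?sqr_ge0// !expr2.
have iz : mu.-integrable setT (fun x => (Re z * Re (f x) + Im z * Im (f x))%:E).
  by apply: integrable_realD; exact: integrable_realZl.
rewrite /Rintegral fineK ?integrable_fin_num//.
rewrite -ge0_integralZl//; last 3 first.
- exact: cmeasurable_norm.
- by move=> x _; rewrite lee_fin Defs.normc_ge0.
- by rewrite lee_fin ltW.
apply: (le_trans (lee_abs _)); apply: (le_trans (le_abse_integral _ _ _)) => //.
  exact: measurable_int iz.
apply: ge0_le_integral => //.
- exact/measurableT_comp/measurable_int/iz.
- by apply: measurable_funeM; exact: cmeasurable_norm.
- move=> x _.
  suff : `|Re z * Re (f x) + Im z * Im (f x)| <= normc z * normc (f x) by [].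
  rewrite -normcM.
  have -> : Re z * Re (f x) + Im z * Im (f x) = Re ((z^*)%C * f x).
    by case: (z) (f x) => [a b] [c e] /=; rewrite mulNr opprK.
  have -> : normc (z * f x) = normc ((z^*)%C * f x).
    by rewrite !normcM; congr (_ * _); case: (z) => a b /=; rewrite sqrrN.
  exact: normr_Re_le.
Qed.

End ComplexIntegral.

Lemma cintegral_real d (T : measurableType d) (R : realType)
    (mu : {measure set T -> \bar R}) (h : T -> R) :
  cintegral mu (fun x => (h x)%:C%C) = (Rintegral mu setT h)%:C%C.
Proof. by rewrite /cintegral /= Rintegral_cst// mul0r. Qed.

Section SignedSections.
Context (R : realType) (X Y : ptopologicalType).
Variables (mu : {measure set (borel X) -> \bar R}) (D : set X).
Hypothesis mD : measurable (D : set (borel X)).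
Hypothesis sD : sregular (mrestr mu mD).

(** Positive and negative parts reduce to nonnegative integrands; the vanishing of w confines the
    integral to D, where the restricted measure is [sregular] although mu may not be. *)
Lemma measurable_Rintegral_section (w : X * Y -> R) :
  measurable_fun setT (w : borel (X * Y)%type -> R) ->
  (forall x y, ~ D x -> w (x, y) = 0) ->
  measurable_fun setT ((fun y => Rintegral mu setT (fun x => w (x, y))) : borel Y -> R).
Proof.
move=> mw wD; pose W z := (w z)%:E.
have mW : measurable_fun setT (W : borel (X * Y)%type -> \bar R) by exact/measurable_EFinP.
rewrite (_ : (fun _ => _) = fun y => fine (\int[mrestr mu mD]_x W^\+ (x, y) -
    \int[mrestr mu mD]_x W^\- (x, y))%E).
  apply: measurableT_comp => //; apply: emeasurable_funB.
  - apply: (measurable_integral_section sD) => //; exact: measurable_funepos.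
  - apply: (measurable_integral_section sD) => //; exact: measurable_funeneg.
apply/funext => y; rewrite /Rintegral; congr fine.
rewrite -(integral_mrestr mu mD).
- rewrite [LHS]integralE; congr (_ - _)%E; apply: eq_integral => x _.
    by rewrite !funeposE.
  by rewrite !funenegE.
- exact: (@measurableT_comp _ _ _ (borel X) (borel (X * Y)%type) _ W _ _ mW
    (continuous_borel (@continuous_pairr X Y y))).
- by move=> x nDx; rewrite wD.
Qed.

End SignedSections.

Section TauConvolution.
Context (R : realType) (H K : topologicalGroupType) (tau : cont_hom_aut H K).
Hypotheses (lcH : locally_compact_group H) (lcK : locally_compact_group K).
Variables (muH : {measure set (borel H) -> \bar R}) (hmuH : left_haar_measure muH).
Variables (muK : {measure set (borel K) -> \bar R}) (hmuK : left_haar_measure muK).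
Variables (delta : H -> R) (hdelta : is_modulus tau muK delta).
Local Notation G := (semidirect tau).
Variables (lam : {measure set (borel G) -> \bar R}) (hlam : left_haar_measure lam).
Hypothesis lamE : is_delta_dh_dk muH muK delta lam.
Local Notation Re := complex.Re.
Local Notation Im := complex.Im.

Lemma cmeasurable_comp (S T : ptopologicalType) (g : S -> T) (f : T -> R[i]) :
  continuous g -> cmeasurable (f : borel T -> R[i]) ->
  cmeasurable ((fun x => f (g x)) : borel S -> R[i]).
Proof.
move=> cg [f1 f2]; split.
- exact: (@measurableT_comp _ _ _ (borel S) (borel T) _ (fun z => Re (f z)) _ _ f1
    (continuous_borel cg)).
- exact: (@measurableT_comp _ _ _ (borel S) (borel T) _ (fun z => Im (f z)) _ _ f2
    (continuous_borel cg)).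
Qed.

(** The inner integral of [tau_conv], with both coordinates of x kept in one point so that it is a
    function on H x G whose joint measurability can be studied. *)
Definition fiber_conv (f u : G -> R[i]) (t : H) (x : G) : R[i] :=
  cintegral muK (fun s => f (t, s) * u (fshift s x)).

Lemma tau_convE (f u : G -> R[i]) (x : G) :
  tau_conv (tau := tau) muH muK delta f u x =
  cintegral muH (fun t => fiber_conv f u t x * (delta t)%:C%C).
Proof. by []. Qed.

Variables (f u : G -> R[i]).
Hypotheses (mf : cmeasurable (f : borel G -> R[i])) (mu : cmeasurable (u : borel G -> R[i])).
Hypothesis foo : (\int[lam]_x (normc (f x))%:E < +oo)%E.

Let F x := (normc (f x))%:E.
Let U x := (normc (u x))%:E.

Let F0 x : (0 <= F x)%E. Proof. by rewrite lee_fin Defs.normc_ge0. Qed.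
Let U0 x : (0 <= U x)%E. Proof. by rewrite lee_fin Defs.normc_ge0. Qed.
Let mF : measurable_fun setT (F : borel G -> \bar R). Proof. exact: cmeasurable_norm. Qed.
Let mU : measurable_fun setT (U : borel G -> \bar R). Proof. exact: cmeasurable_norm. Qed.

Lemma exists_box_L1 : exists A : set H, exists B : set K,
  [/\ sigma_compact_subgroup A, sigma_compact_subgroup B &
      forall z, ~ (A `*` B) z -> f z = 0].
Proof.
have sF := integrable_sub_sigma_compact lcH lcK hlam F0 mF foo.
have [A [B [sA sB FAB _]]] := exists_box2 lcH lcK sF sF.
exists A, B; split => // z; apply: contra_notP => fz; apply: FAB => /=.
by apply/eqP => -[/eq0_normc].
Qed.

Let continuous_fiber : continuous (fun z : K * (H * G) => (z.2.1, z.1) : G).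
Proof.
have c1 : continuous (fun z : K * (H * G) => z.1).
  exact/Defs.continuous_fst_comp/Defs.continuous_idfun.
have c2 : continuous (fun z : K * (H * G) => z.2).
  exact/Defs.continuous_snd_comp/Defs.continuous_idfun.
have c21 := Defs.continuous_fst_comp c2.
exact: (Defs.continuous_pair_fun c21 c1).
Qed.

Let continuous_fiber_shift :
  continuous (fun z : K * (H * G) => fshift z.1 z.2.2 : G).
Proof.
have c1 : continuous (fun z : K * (H * G) => z.1).
  exact/Defs.continuous_fst_comp/Defs.continuous_idfun.
have c2 : continuous (fun z : K * (H * G) => z.2).
  exact/Defs.continuous_snd_comp/Defs.continuous_idfun.
have c22 := Defs.continuous_snd_comp c2.
have c0 : continuous (fun z : K * (H * G) => ((1%g, z.1) : G)).
  apply: (@Defs.continuous_pair_fun (K * (H * G))%type H K) => //.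
  by move=> z; exact: cvg_cst.
have cp := Defs.continuous_pair_fun c0 c22.
exact: (Defs.continuous_comp_fun cp (@continuous_shift_pair H K tau)).
Qed.

(** As f vanishes outside a box A x B, for every (t, x) the integration runs over B only, where Haar
    measure is sigma-finite; sections are taken with H x G as parameter space. *)
Lemma cmeasurable_fiber_conv :
  cmeasurable ((fun z : H * G => fiber_conv f u z.1 z.2) : borel (H * G)%type -> R[i]).
Proof.
have [A [B [sA sB fAB]]] := exists_box_L1.
have sregB : sregular (mrestr muK (open_borel (scs_open sB))).
  exact: (sregular_mrestr (haar_radon hmuK) lcK.1 (scs_open sB) (scs_closed sB)
    (scs_sigma_compact sB)).
have [w1 w2] : cmeasurable ((fun z : K * (H * G) =>
    f (z.2.1, z.1) * u (fshift z.1 z.2.2)) : borel (K * (H * G))%type -> R[i]).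
  apply: cmeasurableM.
  - exact: (cmeasurable_comp continuous_fiber mf).
  - exact: (cmeasurable_comp continuous_fiber_shift mu).
split.
- apply: (measurable_Rintegral_section sregB w1) => s z nBs.
  by rewrite fAB ?mul0r// => -[].
- apply: (measurable_Rintegral_section sregB w2) => s z nBs.
  by rewrite fAB ?mul0r// => -[].
Qed.

Let cdelta : continuous delta := modulus_continuous hdelta.
Let delta0 t : 0 <= delta t := ltW (modulus_gt0 hdelta t).

Lemma cmeasurable_weighted_fiber_conv : cmeasurable ((fun z : H * G =>
  fiber_conv f u z.1 z.2 * (delta z.1)%:C%C) : borel (H * G)%type -> R[i]).
Proof.
apply: cmeasurableM; first exact: cmeasurable_fiber_conv.
split; last exact: measurable_cst.
apply: (@measurableT_comp _ _ _ (borel (H * G)%type) (borel H) _ delta).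
  exact: continuous_borel_real.
by apply: continuous_borel => z; exact: cvg_fst.
Qed.

Lemma cmeasurable_fiber_conv_at x : cmeasurable
  ((fun t => fiber_conv f u t x * (delta t)%:C%C) : borel H -> R[i]).
Proof.
exact: (cmeasurable_comp (@continuous_pairr H G x) cmeasurable_weighted_fiber_conv).
Qed.

Lemma cmeasurable_tau_conv :
  cmeasurable (tau_conv muH muK delta f u : borel G -> R[i]).
Proof.
have [A [B [sA sB fAB]]] := exists_box_L1.
have sregA : sregular (mrestr muH (open_borel (scs_open sA))).
  exact: (sregular_mrestr (haar_radon hmuH) lcH.1 (scs_open sA) (scs_closed sA)
    (scs_sigma_compact sA)).
have [w1 w2] := cmeasurable_weighted_fiber_conv.
have z0 t x : ~ A t -> fiber_conv f u t x = 0.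
  move=> nAt; rewrite /fiber_conv (_ : (fun _ => _) = fun=> 0).
    by rewrite /cintegral /= Rintegral_cst// mul0r.
  by apply/funext => s; rewrite fAB ?mul0r// => -[].
split.
- apply: (measurable_Rintegral_section sregA w1) => t x nAt.
  by transitivity (Re (0 : R[i])) => //; congr Re; rewrite [X in X * _]z0// mul0r.
- apply: (measurable_Rintegral_section sregA w2) => t x nAt.
  by transitivity (Im (0 : R[i])) => //; congr Im; rewrite [X in X * _]z0// mul0r.
Qed.

Lemma cmeasurable_fiber t x :
  cmeasurable ((fun s => f (t, s) * u (fshift s x)) : borel K -> R[i]).
Proof.
apply: cmeasurableM.
  exact: (cmeasurable_comp (@continuous_pairl H K t) mf).
apply: (cmeasurable_comp (g := fun s : K => fshift s x : G)) => //.
move=> s; apply: (continuous_comp (f := fun s : K => (s, (t, x)) : K * (H * G))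
  (g := fun z : K * (H * G) => fshift z.1 z.2.2 : G)); last exact: continuous_fiber_shift.
exact: continuous_pairr.
Qed.

(** Bridge between the two forms of convolution: finiteness of the left side is absolute convergence
    of the iterated integral behind [tau_conv]. *)
Lemma nconv_iterated x :
  nconv lam F U x = (\int[muH]_t ((delta t)%:E *
    \int[muK]_s (normc (f (t, s) * u (fshift s x)))%:E))%E.
Proof.
have [A [B [sA sB fAB]]] := exists_box_L1.
rewrite /nconv (integral_delta_iterated lcH lcK hmuH hmuK hdelta hlam lamE sA sB).
- apply: eq_integral => t _; congr (_ * _)%E; apply: eq_integral => s _.
  by rewrite normcM.
- by move=> z; exact: mule_ge0.
- exact: (@measurableT_comp _ _ _ (borel G) (borel (G * G)%type) _
    (fun z : G * G => F z.1 * U (fshift z.1.2 z.2))%E _ _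
    (measurable_nconv_integrand mF mU) (continuous_borel (@continuous_pairr G G x))).
- by move=> z /fAB fz; rewrite /F fz normc0 mul0e.
Qed.

Lemma normc_fiber_conv_le t x : ((normc (fiber_conv f u t x * (delta t)%:C%C))%:E <=
  (delta t)%:E * \int[muK]_s (normc (f (t, s) * u (fshift s x)))%:E)%E.
Proof.
rewrite normcM EFinM muleC (Defs.normcE (delta t)%:C%C)/= expr0n/= addr0 sqrtr_sqr ger0_norm//.
by apply: lee_wpmul2l; [rewrite lee_fin|exact/le_normc_cintegral/cmeasurable_fiber].
Qed.

Let miter x : measurable_fun setT ((fun t => (delta t)%:E *
    \int[muK]_s (normc (f (t, s) * u (fshift s x)))%:E)%E : borel H -> \bar R).
Proof.
have [A [B [sA sB fAB]]] := exists_box_L1.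
have sregB : sregular (mrestr muK (open_borel (scs_open sB))).
  exact: (sregular_mrestr (haar_radon hmuK) lcK.1 (scs_open sB) (scs_closed sB)
    (scs_sigma_compact sB)).
have mw : measurable_fun setT ((fun z : K * H =>
    (normc (f (z.2, z.1) * u (fshift z.1 x)))%:E) : borel (K * H)%type -> \bar R).
  apply: cmeasurable_norm.
  have cp : continuous (fun z : K * H => (z.1, (z.2, x)) : K * (H * G)).
    apply: (@Defs.continuous_pair_fun (K * H)%type K (H * G)%type).
      by move=> z; exact: cvg_fst.
    apply: (@Defs.continuous_pair_fun (K * H)%type H G).
      by move=> z; exact: cvg_snd.
    by move=> z; exact: cvg_cst.
  apply: cmeasurableM.
  - apply: (cmeasurable_comp (g := fun z : K * H => (z.2, z.1) : G)) => //.
    exact: (@continuous_swap H K).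
  - apply: (cmeasurable_comp (g := fun z : K * H => fshift z.1 x : G)) => //.
    exact: (Defs.continuous_comp_fun cp continuous_fiber_shift).
apply: emeasurable_funM.
  by apply/measurable_EFinP; exact: continuous_borel_real.
rewrite (_ : (fun _ => _) = (fun t => \int[mrestr muK (open_borel (scs_open sB))]_s
    (normc (f (t, s) * u (fshift s x)))%:E)%E).
  apply: (measurable_integral_section sregB (w := fun z : K * H =>
    (normc (f (z.2, z.1) * u (fshift z.1 x)))%:E)) => // z.
  by rewrite lee_fin Defs.normc_ge0.
apply/funext => t; rewrite ge0_integral_mrestr//.
- by move=> s; rewrite lee_fin Defs.normc_ge0.
- exact: cmeasurable_norm (cmeasurable_fiber t x).
- by move=> s nBs; rewrite fAB ?mul0r ?normc0// => -[].
Qed.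

(** Valid at every x: where the iterated integral of absolute values diverges, the right side is
    +oo, so junk values of [tau_conv] cause no exception. *)
Lemma normc_tau_conv_le x :
  ((normc (tau_conv muH muK delta f u x))%:E <= nconv lam F U x)%E.
Proof.
rewrite tau_convE; apply: le_trans (le_normc_cintegral _ (cmeasurable_fiber_conv_at x)) _.
rewrite nconv_iterated; apply: ge0_le_integral => //.
- by move=> t _; rewrite lee_fin Defs.normc_ge0.
- exact: cmeasurable_norm (cmeasurable_fiber_conv_at x).
- by move=> t _; exact: normc_fiber_conv_le.
Qed.

Let ae_fiber_finite x : (nconv lam F U x < +oo)%E -> \forall t \ae muH,
  (\int[muK]_s (normc (f (t, s) * u (fshift s x)))%:E < +oo)%E.
Proof.
rewrite nconv_iterated => oo.
have J0 t : (0 <= \int[muK]_s (normc (f (t, s) * u (fshift s x)))%:E)%E.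
  by apply: integral_ge0 => s _; rewrite lee_fin Defs.normc_ge0.
have : muH.-integrable setT (fun t => (delta t)%:E *
    \int[muK]_s (normc (f (t, s) * u (fshift s x)))%:E)%E.
  apply/integrableP; split; first exact: miter.
  by under eq_integral do rewrite gee0_abs ?mule_ge0 ?lee_fin//.
move=> /(integrable_ae measurableT); apply: ae_mono => t /(_ I) fin.
(* Positivity of delta prevents an infinite fibre integral from being hidden by a zero weight. *)
rewrite ltNge leye_eq; apply/negP => /eqP ioo; move: fin.
by rewrite ioo gt0_muley// lte_fin; exact: modulus_gt0 hdelta t.
Qed.

Lemma nconv_finite_converges x : (nconv lam F U x < +oo)%E ->
  tau_conv_converges muH muK delta f u x.
Proof.
move=> oo; split.
  apply: ae_mono (ae_fiber_finite oo) => t; apply: cintegrable_norm.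
  exact: cmeasurable_fiber.
rewrite nconv_iterated in oo.
apply: cintegrable_norm; first exact: cmeasurable_fiber_conv_at.
apply: le_lt_trans oo; apply: ge0_le_integral => //.
- by move=> t _; rewrite lee_fin Defs.normc_ge0.
- exact: cmeasurable_norm (cmeasurable_fiber_conv_at x).
- by move=> t _; exact: normc_fiber_conv_le.
Qed.

Lemma tau_conv_nonneg x : (forall y, f y = (normc (f y))%:C%C) ->
  (forall y, u y = (normc (u y))%:C%C) -> (nconv lam F U x < +oo)%E ->
  tau_conv muH muK delta f u x = (fine (nconv lam F U x))%:C%C.
Proof.
move=> fE uE oo; rewrite nconv_iterated.
pose J t := (\int[muK]_s (normc (f (t, s) * u (fshift s x)))%:E)%E.
have J0 t : (0 <= J t)%E by apply: integral_ge0 => s _; rewrite lee_fin Defs.normc_ge0.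
have dJ0 t : (0 <= (delta t)%:E * J t)%E by apply: mule_ge0; rewrite ?lee_fin.
have fib : (fun t => fiber_conv f u t x * (delta t)%:C%C) =
    (fun t => (fine (J t) * delta t)%:C%C) :> (borel H -> R[i]).
  apply/funext => t; rewrite rmorphM; congr (_ * _).
  transitivity (cintegral muK (fun s => (normc (f (t, s) * u (fshift s x)))%:C%C)).
    by congr cintegral; apply/funext => s; rewrite {1}fE {1}uE normcM -rmorphM.
  exact: cintegral_real.
have := cmeasurable_fiber_conv_at x; rewrite fib => -[mfib _].
rewrite tau_convE fib cintegral_real /Rintegral; congr (fine _)%:C%C.
apply: ae_eq_integral.
- exact: measurableT.
- by apply/measurable_EFinP; exact: mfib.
- exact: (miter x).
(* The two integrands agree where the fibre integral is finite; where it is infinite [fine] reads it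
   as 0, but only on a null set of t. *)
- apply: ae_mono (ae_fiber_finite oo) => t Joo _.
  by rewrite EFinM fineK ?ge0_fin_numE// muleC.
Qed.

End TauConvolution.

(** * The module action *)

Section Classes.
Context d (T : measurableType d) (R : realType).
Variables (mu : {measure set T -> \bar R}) (p : \bar R) (p1 : (1 <= p)%E).
Implicit Types (f g : T -> R[i]).
Local Notation Lf := (cLfun mu p1).
Local Notation class := (cLclass mu p1).

Lemma mem_cLfun f : (f \in Lf) <-> cmeasurable f /\ (cLnorm mu p f < +oo)%E.
Proof. by split => [/Defs.cLfunP|h]; [|exact/Defs.cLfunP]. Qed.

Lemma repr_mem_cLfun (x : cLspace mu p1) : (repr x : T -> R[i]) \in Lf.
Proof. by case: (repr x). Qed.

Lemma cLclassE f (fL : f \in Lf) : class f = \pi_(cLspace mu p1)%qT (CLfunType fL).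
Proof.
rewrite /cLclass; congr (\pi_(_)%qT _); apply: val_inj.
by rewrite val_insubd fL.
Qed.

Lemma cLclass_repr (x : cLspace mu p1) : class (repr x) = x.
Proof.
rewrite (cLclassE (repr_mem_cLfun x)) -[RHS]Defs.class_repr; congr (\pi_(_)%qT _).
by apply: val_inj.
Qed.

Lemma eq_cLclass f g : f \in Lf -> g \in Lf ->
  class f = class g <-> (\forall x \ae mu, f x = g x).
Proof.
move=> fL gL; rewrite !cLclassE Defs.eq_class; split.
  move=> /Defs.cLnullP; apply: ae_mono => x.
  rewrite [X in X = 0](_ : _ = f x - g x)// => /eqP.
  by rewrite subr_eq0 => /eqP.
move=> fg; apply/Defs.cLnullP; apply: ae_mono fg => x fgx.
by rewrite [LHS](_ : _ = f x - g x)// fgx subrr.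
Qed.

Lemma ae_repr_cLclass f : f \in Lf -> \forall x \ae mu, (repr (class f) : T -> R[i]) x = f x.
Proof.
move=> fL; apply/(eq_cLclass (repr_mem_cLfun _) fL); exact: cLclass_repr.
Qed.

Lemma cLclass_linear (a : R[i]) f g : f \in Lf -> g \in Lf ->
  class (a *: f + g) = a *: class f + class g.
Proof.
move=> fL gL.
have hL : a *: f + g \in Lf by apply: rpredD => //; exact: rpredZ.
rewrite !cLclassE [RHS](_ : _ = cLspace_scale a
  (\pi_(cLspace mu p1)%qT (CLfunType fL)) + \pi_(cLspace mu p1)%qT (CLfunType gL))//.
rewrite Defs.class_scale -Defs.classD.
by congr (\pi_(_)%qT _); apply: val_inj.
Qed.

Lemma norm_cLclass f : f \in Lf -> `|class f| = (fine (cLnorm mu p f))%:C%C.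
Proof. by move=> fL; rewrite cLclassE -[LHS]/(cLspace_norm _) Defs.norm_class. Qed.

Lemma cLnorm_fin f : f \in Lf -> cLnorm mu p f \is a fin_num.
Proof. by move=> /mem_cLfun[_ fin]; rewrite ge0_fin_numE// Defs.cLnorm_ge0. Qed.

Lemma le_normc_cLfun f (g : T -> R) : cmeasurable f -> measurable_fun setT g ->
  (forall x, normc (f x) <= g x) -> ('N[mu]_p[EFin \o g] < +oo)%E -> f \in Lf.
Proof.
move=> mf mg fg goo; apply/mem_cLfun; split => //; apply: le_lt_trans goo.
apply: Defs.le_Lnorm => //; first exact: Defs.measurable_normc.
by move=> x; rewrite Defs.normc_ge0 fg.
Qed.

Lemma normc_real (r : R) : 0 <= r -> normc r%:C%C = r.
Proof. by move=> r0; rewrite Defs.normcE/= expr0n/= addr0 sqrtr_sqr ger0_norm. Qed.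

Lemma cmeasurable_real (h : T -> R) : measurable_fun setT h ->
  cmeasurable (fun x => (h x)%:C%C).
Proof. by move=> mh; split => //; exact: measurable_cst. Qed.

(** Each f is a combination, with coefficients 1, -1, i and -i, of the positive and negative parts
    of its real and imaginary parts; these are bounded by |f| and hence lie in the same L^p
    space. *)
Lemma cLspace_ext (V : lmodType R[i]) (A1 A2 : cLspace mu p1 -> V) :
  linear A1 -> linear A2 ->
  (forall h : T -> R, (forall x : T, 0 <= h x) -> measurable_fun setT h ->
    (fun x => (h x)%:C%C) \in Lf ->
    A1 (class (fun x => (h x)%:C%C)) = A2 (class (fun x => (h x)%:C%C))) ->
  forall x, A1 x = A2 x.
Proof.
move=> l1 l2 A12 x.
have lin0 (A : cLspace mu p1 -> V) : linear A -> A 0 = 0.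
  by move=> lA; have := lA (-1) 0 0; rewrite scaler0 addr0 scaleN1r addNr.
rewrite -(cLclass_repr x); have /mem_cLfun[mf foo] := repr_mem_cLfun x.
move: (repr x : T -> R[i]) mf foo => f mf foo; have [f1 f2] := mf.
have part (g : T -> R) : measurable_fun setT g -> (forall x : T, `|g x| <= normc (f x)) ->
    let h x := (Num.max (g x) 0)%:C%C in
    h \in Lf /\ A1 (class h) = A2 (class h).
  move=> mg gf h.
  have mh : measurable_fun setT (fun x => Num.max (g x) 0).
    by apply: measurable_maxr => //; exact: measurable_cst.
  have h0 y : 0 <= Num.max (g y) 0 by rewrite le_max lexx orbT.
  have hL : h \in Lf.
    apply: (@le_normc_cLfun h (fun x => normc (f x))) => //.
    - exact: Defs.measurable_normc.
    - move=> y; rewrite normc_real//; apply: le_trans (gf y).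
      by rewrite ge_max normr_ge0 andbT ler_norm.
  by split => //; exact: A12.
have [L1 e1] := part _ f1 (fun y => normr_Re_le (f y)).
have [|L2 e2] := part (fun y => - complex.Re (f y)) (measurable_funN f1).
  by move=> y; rewrite normrN; exact: normr_Re_le.
have [L3 e3] := part _ f2 (fun y => normr_Im_le (f y)).
have [|L4 e4] := part (fun y => - complex.Im (f y)) (measurable_funN f2).
  by move=> y; rewrite normrN; exact: normr_Im_le.
set h1 := fun x => _ in L1 e1; set h2 := fun x => _ in L2 e2.
set h3 := fun x => _ in L3 e3; set h4 := fun x => _ in L4 e4.
have L0 : (0 : T -> R[i]) \in Lf by exact: rpred0.
have L40 : (- 'i%C) *: h4 + 0 \in Lf by apply: rpredD => //; exact: rpredZ.
have L34 : 'i%C *: h3 + ((- 'i%C) *: h4 + 0) \in Lf by apply: rpredD => //; exact: rpredZ.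
have L24 : (-1) *: h2 + ('i%C *: h3 + ((- 'i%C) *: h4 + 0)) \in Lf.
  by apply: rpredD => //; exact: rpredZ.
have maxE (r : R) : Num.max r 0 - Num.max (- r) 0 = r.
  have [r0|] := boolP (0 <= r); first by rewrite max_l// max_r ?oppr_le0// subr0.
  rewrite -ltNge => r0; rewrite max_r ?ltW//.
  by rewrite max_l ?oppr_ge0 ?ltW// sub0r opprK.
(* The nesting with a final 0 iterates [a *: x + y], the form in which [linear] can be rewritten. *)
have -> : f = 1 *: h1 + ((-1) *: h2 + ('i%C *: h3 + ((- 'i%C) *: h4 + 0))).
  apply/funext => y; rewrite [RHS](_ : _ = 1 * h1 y + (-1 * h2 y + ('i%C * h3 y + (- 'i%C * h4 y + 0))))//.
  rewrite mul1r mulN1r addr0 mulNr addrA -mulrBr /h1 /h2 /h3 /h4 -!rmorphB/= !maxE.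
  exact: complexE.
have c0 : class 0 = 0.
  have := cLclass_linear 1 L0 L0; rewrite !scale1r addr0 => e.
  by apply: (@addIr _ (class 0)); rewrite -e add0r.
rewrite !cLclass_linear// c0 !l1 !l2 e1 e2 e3 e4 !lin0//.
Qed.

End Classes.
Arguments mem_cLfun {d T R mu p p1 f}.
Arguments le_normc_cLfun {d T R mu p p1 f}.

Section TauConvolutionLp.
Context (R : realType) (H K : topologicalGroupType) (tau : cont_hom_aut H K).
Hypotheses (lcH : locally_compact_group H) (lcK : locally_compact_group K).
Variables (muH : {measure set (borel H) -> \bar R}) (hmuH : left_haar_measure muH).
Variables (muK : {measure set (borel K) -> \bar R}) (hmuK : left_haar_measure muK).
Variables (delta : H -> R) (hdelta : is_modulus tau muK delta).
Local Notation G := (semidirect tau).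
Variables (lam : {measure set (borel G) -> \bar R}) (hlam : left_haar_measure lam).
Hypothesis lamE : is_delta_dh_dk muH muK delta lam.
Local Notation Re := complex.Re.
Local Notation Im := complex.Im.
Local Notation TC := (tau_conv (tau := tau) muH muK delta).
Local Notation L1 := (cLfun lam (lexx (1 : \bar R)%E)).
Local Notation norm f := (fun x : G => (normc (f x))%:E).

Lemma mem_L1 (f : G -> R[i]) : f \in L1 -> [/\ cmeasurable (f : borel G -> R[i]),
  (\int[lam]_x (normc (f x))%:E < +oo)%E &
  cLnorm lam 1%E f = (\int[lam]_x (normc (f x))%:E)%E].
Proof.
move=> fL; have [mf foo] := (mem_cLfun (p1 := lexx (1 : \bar R)%E)).1 fL.
have e : cLnorm lam 1%E f = (\int[lam]_x (normc (f x))%:E)%E.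
  rewrite /cLnorm Lnorm1; apply: eq_integral => x _ /=.
  by rewrite ger0_norm ?Defs.normc_ge0.
by rewrite -e.
Qed.

Let delta0 t : 0 <= delta t := ltW (modulus_gt0 hdelta t).

(** The condition on the integrands at x covers linearity in f and in u at once. The inner integrals
    combine for almost every t, which is enough for the outer one. *)
Lemma tau_conv_linear_at (a : R[i]) (f1 u1 f2 u2 f u : G -> R[i]) x :
  cmeasurable ((fun t => fiber_conv muK f u t x * (delta t)%:C%C) : borel H -> R[i]) ->
  cmeasurable ((fun t => fiber_conv muK f1 u1 t x * (delta t)%:C%C) : borel H -> R[i]) ->
  cmeasurable ((fun t => fiber_conv muK f2 u2 t x * (delta t)%:C%C) : borel H -> R[i]) ->
  tau_conv_converges muH muK delta f1 u1 x -> tau_conv_converges muH muK delta f2 u2 x ->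
  (forall t s, f (t, s) * u (fshift s x) =
    a * (f1 (t, s) * u1 (fshift s x)) + f2 (t, s) * u2 (fshift s x)) ->
  TC f u x = a * TC f1 u1 x + TC f2 u2 x.
Proof.
move=> mc mc1 mc2 [c1 i1] [c2 i2] fuE; rewrite !tau_convE.
rewrite -(cintegral_linear a i1 i2); apply: eq_ae_cintegral => //.
  apply: Defs.cmeasurableD => //; exact: Defs.cmeasurableZ.
have c12 : \forall t \ae muH,
    cintegrable muK ((fun s => f1 (t, s) * u1 (x.1, (s^-1 * x.2)%g)) : borel K -> R[i]) /\
    cintegrable muK ((fun s => f2 (t, s) * u2 (x.1, (s^-1 * x.2)%g)) : borel K -> R[i]).
  exact: (@filterS2 _ _ (ae_filter_ringOfSetsType muH) _ _ _ _ c1 c2).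
apply: ae_mono c12 => t [j1 j2].
rewrite /fiber_conv (_ : (fun s => f (t, s) * _) = fun s => a * (f1 (t, s) * u1 (fshift s x))
    + f2 (t, s) * u2 (fshift s x)); last exact/funext.
rewrite cintegral_linear// mulrDl -mulrA//.
Qed.

Section Exponent.
Variables (p : \bar R) (p1 : (1 <= p)%E).
Local Notation Lp := (cLfun lam p1).
Local Notation class1 := (cLclass lam (lexx (1 : \bar R)%E)).
Local Notation classp := (cLclass lam p1).

Lemma Lnorm_nconv_cLfun (f u : G -> R[i]) : f \in L1 -> u \in Lp ->
  ('N[lam]_p[nconv lam (norm f) (norm u)] <= cLnorm lam 1%E f * cLnorm lam p u)%E.
Proof.
move=> fL uL; have [mf foo ->] := mem_L1 fL; have [mu uoo] := (mem_cLfun (p1 := p1)).1 uL.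
apply: (Lnorm_nconv lcH lcK hlam) => //.
- by move=> x; exact: Defs.normc_ge0.
- by move=> x; exact: Defs.normc_ge0.
- exact: Defs.measurable_normc.
- exact: Defs.measurable_normc.
Qed.

Lemma measurable_nconv_cLfun (f u : G -> R[i]) : f \in L1 ->
  cmeasurable (u : borel G -> R[i]) ->
  measurable_fun setT (nconv lam (norm f) (norm u) : borel G -> \bar R).
Proof.
move=> fL mu; have [mf foo _] := mem_L1 fL; apply: (measurable_nconv_L1 lcH lcK hlam) => //.
- by move=> x; rewrite lee_fin Defs.normc_ge0.
- exact: cmeasurable_norm.
- by move=> x; rewrite lee_fin Defs.normc_ge0.
- exact: cmeasurable_norm.
Qed.

Lemma ae_nconv_finite (f u : G -> R[i]) : f \in L1 -> u \in Lp ->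
  \forall x \ae lam, (nconv lam (norm f) (norm u) x < +oo)%E.
Proof.
move=> fL uL; have [mu _] := (mem_cLfun (p1 := p1)).1 uL.
have mn := measurable_nconv_cLfun fL mu.
apply: ae_mono (Lnorm_lty_ae p1 mn _) => [x|].
  rewrite gee0_abs//; apply: nconv_ge0 => y; by rewrite lee_fin Defs.normc_ge0.
apply: le_lt_trans (Lnorm_nconv_cLfun fL uL) _.
by rewrite -ge0_fin_numE ?fin_numM ?cLnorm_fin ?mule_ge0 ?Defs.cLnorm_ge0.
Qed.

Lemma ae_tau_conv_converges (f u : G -> R[i]) : f \in L1 -> u \in Lp ->
  \forall x \ae lam, tau_conv_converges muH muK delta f u x.
Proof.
move=> fL uL; have [mf foo _] := mem_L1 fL; have [mu _] := (mem_cLfun (p1 := p1)).1 uL.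
apply: ae_mono (ae_nconv_finite fL uL) => x.
exact: (nconv_finite_converges lcH lcK hmuH hmuK hdelta hlam lamE mf mu foo).
Qed.

Lemma cLnorm_tau_conv_le (f u : G -> R[i]) : f \in L1 -> u \in Lp ->
  (cLnorm lam p (TC f u) <= cLnorm lam 1%E f * cLnorm lam p u)%E.
Proof.
move=> fL uL; have [mf foo _] := mem_L1 fL; have [mu _] := (mem_cLfun (p1 := p1)).1 uL.
apply: le_trans (Lnorm_nconv_cLfun fL uL); apply: ae_le_Lnorm => //.
- apply/measurable_EFinP/Defs.measurable_normc.
  exact: (cmeasurable_tau_conv lcH lcK hmuH hmuK hdelta hlam mf mu foo).
- exact: measurable_nconv_cLfun.
- apply: ae_all => x; rewrite !gee0_abs.
  + exact: (normc_tau_conv_le lcH lcK hmuH hmuK hdelta hlam lamE mf mu foo).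
  + by apply: nconv_ge0 => y; rewrite lee_fin Defs.normc_ge0.
  + by rewrite lee_fin Defs.normc_ge0.
Qed.

Lemma tau_conv_cLfun (f u : G -> R[i]) : f \in L1 -> u \in Lp -> TC f u \in Lp.
Proof.
move=> fL uL; have [mf foo _] := mem_L1 fL; have [mu _] := (mem_cLfun (p1 := p1)).1 uL.
apply: (mem_cLfun (p1 := p1)).2; split.
  exact: (cmeasurable_tau_conv lcH lcK hmuH hmuK hdelta hlam mf mu foo).
apply: le_lt_trans (cLnorm_tau_conv_le fL uL) _.
by rewrite -ge0_fin_numE ?fin_numM ?cLnorm_fin ?mule_ge0 ?Defs.cLnorm_ge0.
Qed.

Let mfc (f u : G -> R[i]) x : f \in L1 -> cmeasurable (u : borel G -> R[i]) ->
  cmeasurable ((fun t => fiber_conv muK f u t x * (delta t)%:C%C) : borel H -> R[i]).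
Proof.
move=> fL mu; have [mf foo _] := mem_L1 fL.
exact: (cmeasurable_fiber_conv_at lcH lcK hmuK hdelta hlam mf mu foo).
Qed.

Lemma ae_tau_conv_linearl (a : R[i]) (f g u : G -> R[i]) :
  f \in L1 -> g \in L1 -> u \in Lp ->
  \forall x \ae lam, TC (a *: f + g) u x = a * TC f u x + TC g u x.
Proof.
move=> fL gL uL; have [mu _] := (mem_cLfun (p1 := p1)).1 uL.
have hL : a *: f + g \in L1 by apply: rpredD => //; exact: rpredZ.
have c12 : \forall x \ae lam, tau_conv_converges muH muK delta f u x /\
    tau_conv_converges muH muK delta g u x.
  exact: (@filterS2 _ _ (ae_filter_ringOfSetsType lam) _ _ _ _
    (ae_tau_conv_converges fL uL) (ae_tau_conv_converges gL uL)).
apply: ae_mono c12 => x [c1 c2].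
apply: tau_conv_linear_at => //; [exact: mfc|exact: mfc|exact: mfc|].
by move=> t s; rewrite [X in X * _](_ : _ = a * f (t, s) + g (t, s))// mulrDl mulrA.
Qed.

Lemma ae_tau_conv_linearr (a : R[i]) (f u v : G -> R[i]) :
  f \in L1 -> u \in Lp -> v \in Lp ->
  \forall x \ae lam, TC f (a *: u + v) x = a * TC f u x + TC f v x.
Proof.
move=> fL uL vL; have [mu _] := (mem_cLfun (p1 := p1)).1 uL; have [mv _] := (mem_cLfun (p1 := p1)).1 vL.
have uvL : a *: u + v \in Lp by apply: rpredD => //; exact: rpredZ.
have [muv _] := (mem_cLfun (p1 := p1)).1 uvL.
have c12 : \forall x \ae lam, tau_conv_converges muH muK delta f u x /\
    tau_conv_converges muH muK delta f v x.
  exact: (@filterS2 _ _ (ae_filter_ringOfSetsType lam) _ _ _ _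
    (ae_tau_conv_converges fL uL) (ae_tau_conv_converges fL vL)).
apply: ae_mono c12 => x [c1 c2].
apply: tau_conv_linear_at => //; [exact: mfc|exact: mfc|exact: mfc|].
move=> t s; rewrite [X in _ * X](_ : _ = a * u (fshift s x) + v (fshift s x))//.
by rewrite mulrDr mulrCA.
Qed.

(** The convolution of |f - g| with |u| vanishes at every x, because f - g enters under the integral
    untranslated; that of |g| with |u - v| vanishes at almost every x, by [nconv_ae_eq]. Linearity
    in each variable then connects the two convolutions. *)
Lemma ae_eq_tau_conv (f g u v : G -> R[i]) : f \in L1 -> g \in L1 -> u \in Lp -> v \in Lp ->
  (\forall x \ae lam, f x = g x) -> (\forall x \ae lam, u x = v x) ->
  \forall x \ae lam, TC f u x = TC g v x.
Proof.
move=> fL gL uL vL fg uv.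
have fgL : (-1) *: g + f \in L1 by apply: rpredD => //; exact: rpredZ.
have uvL : (-1) *: v + u \in Lp by apply: rpredD => //; exact: rpredZ.
have [mfg fgoo _] := mem_L1 fgL; have [muv _] := (mem_cLfun (p1 := p1)).1 uvL.
have [mg goo _] := mem_L1 gL; have [mu _] := (mem_cLfun (p1 := p1)).1 uL.
have z1 x : nconv lam (norm ((-1) *: g + f)) (norm u) x = 0%E.
  rewrite /nconv (ae_eq_integral (cst 0%E)) ?integral0//.
    exact: (@measurableT_comp _ _ _ (borel G) (borel (G * G)%type) _
      (fun z : G * G => (normc (((-1) *: g + f) z.1))%:E *
        (normc (u (fshift z.1.2 z.2)))%:E)%E _ _
      (measurable_nconv_integrand (cmeasurable_norm mfg) (cmeasurable_norm mu))
      (continuous_borel (@continuous_pairr G G x))).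
  apply: ae_mono fg => y fgy _ /=.
  rewrite [X in normc X](_ : _ = -1 * g y + f y)// fgy mulN1r addNr.
  by rewrite normc0 mul0e.
have z2 : \forall x \ae lam, nconv lam (norm g) (norm ((-1) *: v + u)) x = 0%E.
  have e : \forall x \ae lam, (norm ((-1) *: v + u)) x = (cst 0%E : G -> \bar R) x.
    apply: ae_mono uv => y uvy /=.
    by rewrite [X in normc X](_ : _ = -1 * v y + u y)// uvy mulN1r addNr normc0.
  have := nconv_ae_eq lcH lcK hlam _ (cmeasurable_norm mg) goo
    (cmeasurable_norm muv) (measurable_cst _) e.
  move=> /(_ (fun y => _)) h; apply: ae_mono (h _) => [x ->|y].
    by rewrite /nconv; under eq_integral do rewrite mule0; rewrite integral0.
  by rewrite lee_fin Defs.normc_ge0.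
have l1 := ae_tau_conv_linearl (-1) gL fL uL.
have l2 := ae_tau_conv_linearr (-1) gL vL uL.
have all3 := @filterS3 _ _ (ae_filter_ringOfSetsType lam) _ _ _ _
  (fun x a b c => conj a (conj b c)) l1 l2 z2.
apply: ae_mono all3 => x [l1x [l2x z2x]].
have n0 (z : R[i]) (r : \bar R) : ((normc z)%:E <= r)%E -> r = 0%E -> z = 0.
  move=> + r0; rewrite r0 lee_fin => zr; apply: eq0_normc; apply/eqP.
  by rewrite eq_le zr Defs.normc_ge0.
have e1 := n0 _ _ (normc_tau_conv_le lcH lcK hmuH hmuK hdelta hlam lamE mfg mu fgoo x) (z1 x).
have e2 := n0 _ _ (normc_tau_conv_le lcH lcK hmuH hmuK hdelta hlam lamE mg muv goo x) z2x.
move: l1x l2x; rewrite e1 e2 !mulN1r => /esym/eqP; rewrite addrC subr_eq0 => /eqP ->.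
by move=> /esym/eqP; rewrite addrC subr_eq0 => /eqP.
Qed.

(** Independence of the representatives that [repr] chooses in [tau_act]. *)
Lemma tau_act_class (f u : G -> R[i]) : f \in L1 -> u \in Lp ->
  tau_act muH muK delta (class1 f) (classp u) = classp (TC f u).
Proof.
move=> fL uL; rewrite /tau_act; apply/eq_cLclass.
- by apply: tau_conv_cLfun; exact: repr_mem_cLfun.
- exact: tau_conv_cLfun.
- apply: ae_eq_tau_conv => //; try exact: repr_mem_cLfun; exact: ae_repr_cLclass.
Qed.

Lemma bilinear_tau_act :
  bilinear_map (tau_act muH muK delta (lam := lam) (p1 := p1)).
Proof.
split.
- move=> y a x1 x2; rewrite -(cLclass_repr x1) -(cLclass_repr x2) -(cLclass_repr y).
  have [[L1x L2x] Ly] := (repr_mem_cLfun x1, repr_mem_cLfun x2, repr_mem_cLfun y).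
  have L12 : a *: (repr x1 : G -> R[i]) + repr x2 \in L1 by apply: rpredD => //; exact: rpredZ.
  rewrite -(cLclass_linear a L1x L2x) (tau_act_class L12 Ly).
  rewrite (tau_act_class L1x Ly) (tau_act_class L2x Ly).
  rewrite -(cLclass_linear a (tau_conv_cLfun L1x Ly) (tau_conv_cLfun L2x Ly)).
  apply/eq_cLclass.
  + exact: tau_conv_cLfun.
  + by apply: rpredD; [apply: rpredZ|]; exact: tau_conv_cLfun.
  + exact: ae_tau_conv_linearl.
- move=> y a x1 x2; rewrite -(cLclass_repr x1) -(cLclass_repr x2) -(cLclass_repr y).
  have [[L1x L2x] Ly] := (repr_mem_cLfun x1, repr_mem_cLfun x2, repr_mem_cLfun y).
  have L12 : a *: (repr x1 : G -> R[i]) + repr x2 \in Lp by apply: rpredD => //; exact: rpredZ.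
  rewrite -(cLclass_linear a L1x L2x) (tau_act_class Ly L12).
  rewrite (tau_act_class Ly L1x) (tau_act_class Ly L2x).
  rewrite -(cLclass_linear a (tau_conv_cLfun Ly L1x) (tau_conv_cLfun Ly L2x)).
  apply/eq_cLclass.
  + exact: tau_conv_cLfun.
  + by apply: rpredD; [apply: rpredZ|]; exact: tau_conv_cLfun.
  + exact: ae_tau_conv_linearr.
Qed.

Lemma norm_tau_act_le a x :
  `|tau_act muH muK delta (lam := lam) (p1 := p1) a x| <= `|a| * `|x|.
Proof.
rewrite -(cLclass_repr a) -(cLclass_repr x).
have [La Lx] := (repr_mem_cLfun a, repr_mem_cLfun x).
rewrite tau_act_class// !norm_cLclass ?tau_conv_cLfun// -rmorphM/= lecR.
rewrite -fineM ?cLnorm_fin//; apply: fine_le.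
- by apply: cLnorm_fin; exact: tau_conv_cLfun.
- by rewrite fin_numM// ?cLnorm_fin.
- exact: cLnorm_tau_conv_le.
Qed.

End Exponent.

End TauConvolutionLp.

(** * Associativity of the action *)

Section TauConvolutionAssociative.
Context (R : realType) (H K : topologicalGroupType) (tau : cont_hom_aut H K).
Hypotheses (lcH : locally_compact_group H) (lcK : locally_compact_group K).
Variables (muH : {measure set (borel H) -> \bar R}) (hmuH : left_haar_measure muH).
Variables (muK : {measure set (borel K) -> \bar R}) (hmuK : left_haar_measure muK).
Variables (delta : H -> R) (hdelta : is_modulus tau muK delta).
Local Notation G := (semidirect tau).
Variables (lam : {measure set (borel G) -> \bar R}) (hlam : left_haar_measure lam).
Hypothesis lamE : is_delta_dh_dk muH muK delta lam.
Local Notation Re := complex.Re.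
Local Notation Im := complex.Im.
Local Notation TC := (tau_conv (tau := tau) muH muK delta).
Local Notation L1 := (cLfun lam (lexx (1 : \bar R)%E)).
Local Notation norm f := (fun x : G => (normc (f x))%:E).

Lemma mem_cLfun_ae (p : \bar R) (p1 : (1 <= p)%E) (f g : G -> R[i]) :
  f \in cLfun lam p1 -> cmeasurable (g : borel G -> R[i]) ->
  (\forall x \ae lam, f x = g x) -> g \in cLfun lam p1.
Proof.
move=> fL mg fg; have [mf foo] := (mem_cLfun (p1 := p1)).1 fL.
apply: (mem_cLfun (p1 := p1)).2; split => //; apply: le_lt_trans foo.
apply: ae_le_Lnorm => //; [exact: cmeasurable_norm|exact: cmeasurable_norm|].
by apply: ae_mono fg => x /= ->.
Qed.

Section Nonneg.
Variables (p : \bar R) (p1 : (1 <= p)%E) (f u : G -> R).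
Hypotheses (f0 : forall x, 0 <= f x) (u0 : forall x, 0 <= u x).
Local Notation rc h := (fun x : G => (h x)%:C%C).
Local Notation E h := (fun x : G => (h x)%:E).
Hypotheses (fL : rc f \in L1) (uL : rc u \in cLfun lam p1).

Let normE (h : G -> R) : (forall x, 0 <= h x) -> norm (rc h) = E h.
Proof. by move=> h0; apply/funext => y; rewrite normc_real. Qed.

Lemma ae_nconv_real_finite : \forall x \ae lam, (nconv lam (E f) (E u) x < +oo)%E.
Proof. rewrite -(normE f0) -(normE u0); exact: (ae_nconv_finite lcH lcK hlam fL uL). Qed.

Lemma measurable_nconv_real : measurable_fun setT (nconv lam (E f) (E u) : borel G -> \bar R).
Proof.
have [mu _] := (mem_cLfun (p1 := p1)).1 uL.
rewrite -(normE f0) -(normE u0); exact: (measurable_nconv_cLfun lcH lcK hlam fL mu).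
Qed.

Lemma ae_tau_conv_real :
  \forall x \ae lam, TC (rc f) (rc u) x = (fine (nconv lam (E f) (E u) x))%:C%C.
Proof.
have [mf foo _] := mem_L1 fL; have [mu _] := (mem_cLfun (p1 := p1)).1 uL.
apply: ae_mono ae_nconv_real_finite => x; rewrite -(normE f0) -(normE u0).
apply: (tau_conv_nonneg lcH lcK hmuH hmuK hdelta hlam lamE mf mu foo) => y;
  by rewrite normc_real.
Qed.

Lemma fine_nconv_cLfun : (fun x => (fine (nconv lam (E f) (E u) x))%:C%C) \in cLfun lam p1.
Proof.
apply: mem_cLfun_ae ae_tau_conv_real.
  exact: (tau_conv_cLfun lcH lcK hmuH hmuK hdelta hlam lamE).
by apply: cmeasurable_real; apply: measurableT_comp => //; exact: measurable_nconv_real.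
Qed.

End Nonneg.

Section Associativity.
Variables (p : \bar R) (p1 : (1 <= p)%E).
Local Notation class1 := (cLclass lam (lexx (1 : \bar R)%E)).
Local Notation classp := (cLclass lam p1).
Local Notation act := (tau_act muH muK delta (lam := lam) (p1 := p1)).
Local Notation mul := (tau_act muH muK delta (lam := lam) (p1 := lexx (1 : \bar R)%E)).
Local Notation rc h := (fun x : G => (h x)%:C%C).
Local Notation E h := (fun x : G => (h x)%:E).

(** Convolutions may be infinite on a null set, so their classes are represented by the real
    functions [a] and [b] obtained with [fine]. Replacing [a] by the convolution of f and g changes
    nothing at any x, as it enters untranslated under the integral; replacing [b] changes nothing at
    almost every x. Between the two stands [nconvA]. *)
Lemma tau_act_assoc_nonneg (f g u : G -> R) : (forall x, 0 <= f x) ->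
  (forall x, 0 <= g x) -> (forall x, 0 <= u x) ->
  rc f \in L1 -> rc g \in L1 -> rc u \in cLfun lam p1 ->
  act (mul (class1 (rc f)) (class1 (rc g))) (classp (rc u)) =
  act (class1 (rc f)) (act (class1 (rc g)) (classp (rc u))).
Proof.
move=> f0 g0 u0 fL gL uL.
have Ege0 (h : G -> R) : (forall x, 0 <= h x) -> forall x, (0 <= E h x)%E.
  by move=> h0 x; rewrite lee_fin.
have mE q (q1 : (1 <= q)%E) (h : G -> R) : (rc h \in cLfun lam q1) ->
    measurable_fun setT (E h : borel G -> \bar R).
  by move=> hL; have [[mh _] _] := (mem_cLfun (p1 := q1)).1 hL; exact/measurable_EFinP.
have aeE (F : G -> \bar R) : (forall x, 0 <= F x)%E -> (\forall x \ae lam, F x < +oo)%E ->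
    \forall x \ae lam, (fine (F x))%:E = F x.
  by move=> F0; apply: ae_mono => x Foo; rewrite fineK// ge0_fin_numE.
pose a x := fine (nconv lam (E f) (E g) x); pose b x := fine (nconv lam (E g) (E u) x).
have N0 (h k : G -> R) x : (forall x, 0 <= h x) -> (forall x, 0 <= k x) ->
    (0 <= nconv lam (E h) (E k) x)%E.
  by move=> h0 k0; apply: nconv_ge0; exact: Ege0.
have a0 x : 0 <= a x by apply: fine_ge0; exact: N0.
have b0 x : 0 <= b x by apply: fine_ge0; exact: N0.
have aL : rc a \in L1 by exact: fine_nconv_cLfun.
have bL : rc b \in cLfun lam p1 by exact: fine_nconv_cLfun.
have class_ab q (q1 : (1 <= q)%E) (h k : G -> R) (h0 : forall x, 0 <= h x)
    (k0 : forall x, 0 <= k x) (hL : rc h \in L1) (kL : rc k \in cLfun lam q1) :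
    tau_act muH muK delta (class1 (rc h)) (cLclass lam q1 (rc k)) =
    cLclass lam q1 (fun x => (fine (nconv lam (E h) (E k) x))%:C%C).
  rewrite (tau_act_class lcH lcK hmuH hmuK hdelta hlam lamE)//; apply/eq_cLclass.
  - exact: (tau_conv_cLfun lcH lcK hmuH hmuK hdelta hlam lamE).
  - exact: fine_nconv_cLfun.
  - exact: (ae_tau_conv_real h0 k0 hL kL).
rewrite !class_ab// -/a -/b.
have [sf sg] : sub_sigma_compact [set x | E f x != 0%E] /\ sub_sigma_compact [set x | E g x != 0%E].
  have sc (h : G -> R) : (forall x, 0 <= h x) -> rc h \in L1 ->
      sub_sigma_compact [set x | E h x != 0%E].
    move=> h0 hL; have [_ hoo _] := mem_L1 hL.
    apply: (integrable_sub_sigma_compact lcH lcK hlam (Ege0 _ h0) (mE _ _ _ hL)).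
    by under eq_integral do rewrite -(normc_real (h0 _)).
  by split; exact: sc.
(* The box has to hold f and g; u may spread outside it, as it can when p = +oo. *)
have [A [B [sA sB fAB gAB]]] := exists_box2 lcH lcK sf sg.
apply/eq_cLclass; [exact: fine_nconv_cLfun|exact: fine_nconv_cLfun|].
have mN1 := measurable_nconv_real f0 g0 fL gL.
have mN2 := measurable_nconv_real g0 u0 gL uL.
have ea : \forall x \ae lam, E a x = nconv lam (E f) (E g) x.
  by apply: aeE => [x|]; [exact: N0|exact: (ae_nconv_real_finite f0 g0 fL gL)].
have eb : \forall x \ae lam, E b x = nconv lam (E g) (E u) x.
  by apply: aeE => [x|]; [exact: N0|exact: (ae_nconv_real_finite g0 u0 gL uL)].
have e2 := nconv_ae_eq lcH lcK hlam (Ege0 _ f0) (mE _ _ _ fL) _ (mE _ _ _ bL) mN2 eb.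
apply: ae_mono (e2 _) => [x e2x|]; last first.
  by have [_ + _] := mem_L1 fL; under eq_integral do rewrite normc_real//.
have off (h : G -> R) : [set x | E h x != 0%E] `<=` A `*` B ->
    forall x, ~ (A `*` B) x -> E h x = 0%E.
  by move=> hS y nS; apply: contra_notP nS => /eqP hy; exact: hS.
congr (fine _)%:C%C.
transitivity (nconv lam (E f) (nconv lam (E g) (E u)) x); last first.
  by rewrite -e2x.
rewrite -(nconvA lcH lcK hlam sA sB (Ege0 _ f0) (mE _ _ _ fL) (off _ fAB) x (Ege0 _ g0)
  (Ege0 _ u0) (mE _ _ _ gL) (mE _ _ _ uL) (off _ gAB)).
have mi (F : G -> \bar R) : measurable_fun setT (F : borel G -> \bar R) ->
    measurable_fun setT ((fun y => F y * (u (fshift y.2 x))%:E)%E : borel G -> \bar R).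
  move=> mF; exact: (@measurableT_comp _ _ _ (borel G) (borel (G * G)%type) _
    (fun z : G * G => F z.1 * (u (fshift z.1.2 z.2))%:E)%E _ _
    (measurable_nconv_integrand mF (mE _ _ _ uL)) (continuous_borel (@continuous_pairr G G x))).
apply: ae_eq_integral => //; [exact: mi (mE _ _ _ aL)|exact: mi mN1|].
by apply: ae_mono ea => y eay _; rewrite eay.
Qed.

Lemma tau_act_assoc a b x : act (mul a b) x = act a (act b x).
Proof.
have [linl linr] := bilinear_tau_act lcH lcK hmuH hmuK hdelta hlam lamE p1.
have [linl1 linr1] := bilinear_tau_act lcH lcK hmuH hmuK hdelta hlam lamE (lexx (1 : \bar R)%E).
move: a; apply: cLspace_ext.
- by move=> k y z; rewrite linl1 linl.
- by move=> k y z; rewrite linl.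
move=> f f0 mf fL; move: b; apply: cLspace_ext.
- by move=> k y z; rewrite linr1 linl.
- by move=> k y z; rewrite linl linr.
move=> g g0 mg gL; move: x; apply: cLspace_ext.
- by move=> k y z; rewrite linr.
- by move=> k y z; rewrite !linr.
by move=> u u0 mu uL; exact: tau_act_assoc_nonneg.
Qed.

End Associativity.

End TauConvolutionAssociative.

(** * Completeness *)

Section CountableMinkowski.
Context d (T : measurableType d) (R : realType) (mu : {measure set T -> \bar R}).
Variables (p : \bar R) (p1 : (1 <= p)%E).
Local Open Scope ereal_scope.

Lemma nondecreasing_le_limn (v : (\bar R)^nat) k : nondecreasing_seq v -> v k <= limn v.
Proof.
move=> ndv; rewrite (cvg_lim _ (ereal_nondecreasing_cvgn ndv))//.
by apply: ereal_sup_ubound; exists k.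
Qed.

(** Monotone convergence for finite p, a countable union of null sets for p = +oo. The limit may be
    infinite at some points. *)
Lemma Lnorm_sup_le (P : nat -> T -> R) (C : R) :
  (forall k, measurable_fun setT (P k)) -> (forall k x, (0 <= P k x)%R) ->
  (forall x, nondecreasing_seq (P ^~ x)) ->
  (forall k, 'N[mu]_p[EFin \o P k] <= C%:E) ->
  'N[mu]_p[(fun x => limn (fun k => (P k x)%:E))] <= C%:E.
Proof.
move=> mP P0 ndP PC.
have ndE x : nondecreasing_seq (fun k => (P k x)%:E).
  by move=> m n mn; rewrite lee_fin; exact: ndP.
have cP x : cvgn (fun k => (P k x)%:E) by exact: ereal_nondecreasing_is_cvgn.
have S0 x : 0 <= limn (fun k => (P k x)%:E).
  by apply: lime_ge => //; apply: nearW => k; rewrite lee_fin.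
have C0 : 0 <= C%:E by apply: le_trans (PC 0%N); exact: Lnorm_ge0.
move: PC; rewrite unlock /Lnorm; case: p p1 => [r|_|//].
- rewrite lee_fin => r1 PC; have r0 : (0 < r)%R by rewrite (lt_le_trans _ r1).
  have powK (y : \bar R) : 0 <= y -> y `^ r `^ r^-1 = y.
    by move=> y0; rewrite -poweRrM mulfV ?gt_eqF// poweRe1.
  have Kpow (y : \bar R) : 0 <= y -> y `^ r^-1 `^ r = y.
    by move=> y0; rewrite -poweRrM mulVf ?gt_eqF// poweRe1.
  have le_pow (a b : \bar R) : 0 <= a -> a <= b -> a `^ r <= b `^ r.
    move=> a0 ab; rewrite gt0_ler_poweR// ?in_itv/= ?leey ?andbT//.
      exact: ltW.
    exact: le_trans ab.
  have le_powV (a b : \bar R) : 0 <= a -> a <= b -> a `^ r^-1 <= b `^ r^-1.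
    move=> a0 ab; rewrite gt0_ler_poweR// ?in_itv/= ?leey ?andbT ?invr_ge0//.
      exact: ltW.
    exact: le_trans ab.
  rewrite -[leRHS]powK//; apply: (le_powV).
    by apply: integral_ge0 => x _; exact: poweR_ge0.
  have mQ k : measurable_fun setT (fun x => `|(EFin \o P k) x| `^ r).
    apply: (measurableT_comp (measurable_poweR _)); apply: measurableT_comp => //.
    exact/measurable_EFinP.
  have ndQ x : nondecreasing_seq (fun k => `|(EFin \o P k) x| `^ r).
    move=> m n mn; apply: (le_pow); first exact: abse_ge0.
    by rewrite !gee0_abs ?lee_fin//; exact: ndP.
  (* One inequality between the power of the limit and the limit of the powers suffices; taking r-th
     roots term by term gives it from monotonicity alone. *)
  apply: (@le_trans _ _ (\int[mu]_x limn (fun k => `|(EFin \o P k) x| `^ r))).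
    apply: ge0_le_integral => //.
    + by move=> x _; exact: poweR_ge0.
    + apply: (measurableT_comp (measurable_poweR _)); apply: measurableT_comp => //.
      apply: (emeasurable_fun_cvg (fun k x => (P k x)%:E)) => // k; exact/measurable_EFinP.
    + apply: (emeasurable_fun_cvg (fun k x => `|(EFin \o P k) x| `^ r)) => // x _.
      exact: ereal_nondecreasing_is_cvgn.
    + move=> x _; rewrite gee0_abs ?S0//.
      rewrite -[leRHS]Kpow; last by apply: le_trans (nondecreasing_le_limn 0 (ndQ x)); exact: poweR_ge0.
      apply: (le_pow) => //; apply: lime_le => //; apply: nearW => k.
      rewrite -[leLHS](powK (P k x)%:E) ?lee_fin//; apply: (le_powV); first exact: poweR_ge0.
      have -> : (P k x)%:E `^ r = `|(EFin \o P k) x| `^ r by rewrite gee0_abs ?lee_fin.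
      exact: (nondecreasing_le_limn k (ndQ x)).
  rewrite monotone_convergence//; last first.
  + by move=> n x _; exact: poweR_ge0.
  + apply: lime_le.
      apply: ereal_nondecreasing_is_cvgn => m n mn; apply: ge0_le_integral => //.
      + by move=> x _; exact: poweR_ge0.
      + by move=> x _; exact: ndQ.
    apply: nearW => k; rewrite -[leLHS]Kpow; last by apply: integral_ge0 => x _; exact: poweR_ge0.
    apply: (le_pow); [exact: poweR_ge0|exact: PC].
- case: (boolP (0 < mu [set: T])) => // mu0 PC; apply/ess_supP.
  have : \forall x \ae mu, forall k, `|(EFin \o P k) x| <= C%:E.
    by apply: ae_foralln => k; apply/ess_supP; exact: PC.
  apply: ae_mono => x Px; rewrite /comp gee0_abs ?S0//; apply: lime_le => //.
  by apply: nearW => k; apply: le_trans (Px k); exact: lee_abs.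
Qed.

End CountableMinkowski.

(** The telescoping series of h converges absolutely, its sums of absolute values being bounded by
    M, and the bound passes to the limit. *)
Lemma summable_increments_limit (R : realType) (h D : nat -> R) (M : R) :
  (forall n, `|h n.+1 - h n| <= D n) -> (forall k, \sum_(0 <= j < k) D j <= M) ->
  cvgn h /\ `|limn h - h 0%N| <= M.
Proof.
move=> hD DM.
have sM k : \sum_(0 <= j < k) `|h j.+1 - h j| <= M.
  by apply: le_trans (DM k); exact: ler_sum_nat.
have ch : cvgn h.
  have /normed_cvg : cvgn [normed series (telescope h)].
    apply: nondecreasing_is_cvgn.
      by apply: nondecreasing_series => n _ _ /=.
    by exists M => _ [k _ <-]; rewrite /series/=; exact: sM.
  rewrite telescopeK => ct.
  rewrite (_ : h = (fun n => (h n - h 0%N) + h 0%N)); last by apply/funext => n; rewrite subrK.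
  by apply: is_cvgD => //; exact: is_cvg_cst.
split => //.
have : (fun n => `|h n - h 0%N|) @ \oo --> `|limn h - h 0%N|.
  by apply: cvg_norm; apply: cvgB => //; exact: cvg_cst.
move=> /cvg_lim <- //; apply: limr_le.
  by apply: is_cvg_norm; apply: is_cvgB => //; exact: is_cvg_cst.
apply: nearW => n; rewrite -telescope_sumr//.
by apply: le_trans (ler_norm_sum _ _ _) (sM n).
Qed.

Lemma normc_le_ReIm (R : realType) (z : R[i]) :
  normc z <= `|complex.Re z| + `|complex.Im z|.
Proof.
rewrite Defs.normcE -[leRHS](ger0_norm (addr_ge0 (normr_ge0 _) (normr_ge0 _))) -sqrtr_sqr.
apply: ler_wsqrtr; rewrite sqrrD !real_normK ?num_real// addrAC lerDl.
by rewrite mulrn_wge0// mulr_ge0.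
Qed.

Section Completeness.
Context d (T : measurableType d) (R : realType).
Variables (mu : {measure set T -> \bar R}) (p : \bar R) (p1 : (1 <= p)%E).
Local Notation Lf := (cLfun mu p1).
Local Notation Re := complex.Re.
Local Notation Im := complex.Im.

(** The limit is built from upper limits of real and imaginary parts, which are Borel and defined
    everywhere, and which are true limits wherever the increments are summable, hence almost
    everywhere. *)
Lemma cLfun_cauchy_limit (g : nat -> T -> R[i]) : (forall n, g n \in Lf) ->
  (forall n, (cLnorm mu p (g n.+1 - g n)%R <= (1 / 2 ^+ n)%:E)%E) ->
  exists2 G : T -> R[i], G \in Lf & forall m, (cLnorm mu p (G - g m)%R <= (4 * (1 / 2 ^+ m))%:E)%E.
Proof.
move=> gL gle.
have mg n : cmeasurable (g n) by have [] := (mem_cLfun (p1 := p1)).1 (gL n).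
have mgB (f : T -> R[i]) n : cmeasurable f -> cmeasurable (f - g n)%R.
  move=> mf; rewrite -scaleN1r; apply: Defs.cmeasurableD => //; exact: Defs.cmeasurableZ.
pose N n x := normc (g n.+1 x - g n x).
have mN n : measurable_fun setT (N n) by exact: Defs.measurable_normc (mgB _ n (mg n.+1)).
(* Increments are counted twice: the real and the imaginary part of G - g m are each bounded by the
   plain sum, and [normc_le_ReIm] adds the two bounds. *)
pose P m k x := \sum_(0 <= j < k) (N (m + j)%N x + N (m + j)%N x).
have PS m k x : P m k.+1 x = P m k x + (N (m + k)%N x + N (m + k)%N x).
  by rewrite /P big_nat_recr.
have N0 n x : 0 <= N n x by exact: Defs.normc_ge0.
have P0 m k x : 0 <= P m k x by apply: sumr_ge0 => j _; exact: addr_ge0.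
have mP m k : measurable_fun setT (P m k).
  by apply: measurable_sum => j; exact: measurable_funD.
have ndP m x : nondecreasing_seq (P m ^~ x).
  by apply/nondecreasing_seqP => k; rewrite PS lerDl addr_ge0.
(* Geometric sum: the term added at stage k has norm at most 2 / 2^(m+k), which equals 4 / 2^(m+k) -
   4 / 2^(m+k+1). *)
have PC m k : ('N[mu]_p[EFin \o P m k] <= (4 * (1 / 2 ^+ m) - 4 * (1 / 2 ^+ (m + k)))%:E)%E.
  elim: k => [|k ih].
    rewrite addn0 subrr (_ : EFin \o P m 0 = cst 0%E).
      by rewrite Lnorm0// gt_eqF// (lt_le_trans _ p1).
    by apply/funext => x; rewrite /P /= big_geq.
  rewrite (_ : EFin \o P m k.+1 = EFin \o (P m k \+ (N (m + k)%N \+ N (m + k)%N))%R); last first.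
    by apply/funext => x /=; rewrite PS.
  apply: le_trans (eminkowski mu (mP m k) (measurable_funD (mN _) (mN _)) p1) _.
  apply: (@le_trans _ _ (_ + ((1 / 2 ^+ (m + k))%:E + (1 / 2 ^+ (m + k))%:E))%E).
    apply: leeD; first exact: ih.
    apply: le_trans (eminkowski mu (mN _) (mN _) p1) _.
    by apply: leeD; exact: gle.
  rewrite -!EFinD lee_fin addnS exprS !div1r invfM.
  lra.
pose S m x := limn (fun k => (P m k x)%:E).
have mS m : measurable_fun setT (S m).
  apply: (emeasurable_fun_cvg (fun k x => (P m k x)%:E)) => [k|x _].
    exact/measurable_EFinP.
  by apply: ereal_nondecreasing_is_cvgn => i j ij; rewrite lee_fin; exact: ndP.
have SC m : ('N[mu]_p[S m] <= (4 * (1 / 2 ^+ m))%:E)%E.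
  apply: Lnorm_sup_le => // k; apply: le_trans (PC m k) _.
  by rewrite lee_fin gerBl.
have Sfin : \forall x \ae mu, forall m, (`|S m x| < +oo)%E.
  apply: ae_foralln => m; apply: Lnorm_lty_ae p1 (mS m) _.
  by apply: le_lt_trans (SC m) _; rewrite ltry.
have S0 m x : (0 <= S m x)%E.
  apply: le_trans (nondecreasing_le_limn 0 _); first by rewrite lee_fin.
  by move=> i j ij; rewrite lee_fin; exact: ndP.
have fin_S m x : (`|S m x| < +oo)%E -> S m x \is a fin_num.
  by rewrite (gee0_abs (S0 m x)) => Soo; rewrite ge0_fin_numE.
pose e (h : R[i] -> R) x := fine (limn_esup (fun n => (h (g n x))%:E)).
have me (h : R[i] -> R) : (forall n, measurable_fun setT (fun x => h (g n x))) ->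
    measurable_fun setT (e h).
  move=> mh; apply: measurableT_comp => //; apply: measurable_fun_limn_esup => n.
  exact/measurable_EFinP.
pose G x := (e (fun z => Re z) x +i* e (fun z => Im z) x)%C.
have mG : cmeasurable G by split; apply: me => n; case: (mg n).
have le_e (h : R[i] -> R) x m : (forall y z, `|h y - h z| <= normc (y - z)) ->
    (forall m, (`|S m x| < +oo)%E) -> `|e h x - h (g m x)| <= fine (S m x) / 2.
  move=> hN Sx.
  have part k : P m k x <= fine (S m x).
    rewrite -lee_fin fineK; last exact: fin_S.
    by apply: (nondecreasing_le_limn k) => i j ij; rewrite lee_fin; exact: ndP.
  have [||cv le] := @summable_increments_limit R (fun k => h (g (m + k)%N x))
    (fun k => N (m + k)%N x) (fine (S m x) / 2).
  - by move=> n; rewrite addnS; exact: hN.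
  - move=> k; rewrite ler_pdivlMr// mulr_suml; apply: le_trans (part k).
    by apply: ler_sum => j _; rewrite mulr_natr mulr2n.
  suff -> : e h x = limn (fun k => h (g (m + k)%N x)) by move: le; rewrite addn0.
  move: cv => /cvg_ex[l hl]; rewrite (cvg_lim _ hl)//.
  have hl0 : (fun n => h (g n x)) @ \oo --> l.
    rewrite -(cvg_shiftn m); apply: cvg_trans hl.
    by under eq_fun do rewrite addnC.
  have hlE : (fun n => (h (g n x))%:E) @ \oo --> l%:E by apply: cvg_EFin => //; exact: nearW.
  rewrite /e is_cvg_limn_esupE; last by apply/cvg_ex; exists l%:E.
  by rewrite (cvg_lim _ hlE).
have GN m : \forall x \ae mu, (`|(normc ((G - g m) x))%:E| <= `|S m x|)%E.
  apply: ae_mono Sfin => x Sx.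
  rewrite gee0_abs ?lee_fin ?Defs.normc_ge0//.
  rewrite (gee0_abs (S0 m x)) -(fineK (x := S m x)); last exact: fin_S.
  rewrite lee_fin; apply: le_trans (normc_le_ReIm _) _.
  rewrite [leRHS]splitr; apply: lerD.
  - have -> : Re ((G - g m) x) = e (fun z => Re z) x - Re (g m x).
      by rewrite [(G - g m) x](_ : _ = G x - g m x)//; case: (g m x).
    apply: le_e => // y z.
    by apply: le_trans (normr_Re_le (y - z)); case: y z => [a b] [c f].
  - have -> : Im ((G - g m) x) = e (fun z => Im z) x - Im (g m x).
      by rewrite [(G - g m) x](_ : _ = G x - g m x)//; case: (g m x).
    apply: le_e => // y z.
    by apply: le_trans (normr_Im_le (y - z)); case: y z => [a b] [c f].
have GC m : (cLnorm mu p (G - g m)%R <= (4 * (1 / 2 ^+ m))%:E)%E.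
  apply: le_trans (SC m); apply: ae_le_Lnorm => //.
    by apply: cmeasurable_norm; exact: mgB.
  exact: GN.
exists G => //; rewrite -[G](subrK (g 0%N)); apply: rpredD => //.
apply: (mem_cLfun (p1 := p1)).2; split; first exact: mgB.
by apply: le_lt_trans (GC 0%N) _; rewrite ltry.
Qed.

(** Cauchy filters need not come from sequences. Balls of radius 2^-(n+1) belonging to F have
    centres that form a rapidly Cauchy sequence, since two members of a proper filter meet; F
    converges to the limit of these centres. *)
Lemma cLspace_banach : banach_space (cLspace mu p1).
Proof.
(* The final error is 4 / 2^m for the limit of the centres plus 1 / 2^(m+1) for the ball, at most 5
   / 2^m; hence the division by 5 below. *)
have c5 : 4 + 2^-1 <= 5 :> R by lra.
move=> F FF cauchyF; have cF := (cauchyP F).1 cauchyF.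
have c0 n : (0 : R[i]) < (1 / 2 ^+ n.+1 : R)%:C%C by rewrite ltcR divr_gt0 ?exprn_gt0.
have /choice[x Fx] n := cF FF _ (c0 n).
pose g n : T -> R[i] := repr (x n).
have gL n : g n \in cLfun mu p1 by exact: repr_mem_cLfun.
have distE (f1 f2 : T -> R[i]) : f1 \in Lf -> f2 \in Lf ->
    `|cLclass mu p1 f1 - cLclass mu p1 f2| = (fine (cLnorm mu p (f1 - f2)%R))%:C%C /\
    (f1 - f2)%R \in Lf.
  move=> fL1 fL2; have fL : (f1 - f2)%R \in Lf by exact: rpredB.
  split => //; rewrite -norm_cLclass//; congr `|_|.
  by rewrite addrC -scaleN1r -cLclass_linear// scaleN1r addrC.
have le_g n : (cLnorm mu p (g n.+1 - g n)%R <= (1 / 2 ^+ n)%:E)%E.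
  have [dE dL] := distE _ _ (gL n.+1) (gL n).
  have [y [yn1 yn]] : (ball (x n.+1) (1 / 2 ^+ n.+2 : R)%:C%C `&`
      ball (x n) (1 / 2 ^+ n.+1 : R)%:C%C) !=set0.
    by have [y yP] := @filter_ex _ F FF _ (filterI (Fx n.+1) (Fx n)); exists y.
  rewrite -(fineK (cLnorm_fin dL)) lee_fin -lecR -dE !cLclass_repr.
  have := ball_triangle yn1 (ball_sym yn).
  rewrite -ball_normE /= => /ltW/le_trans; apply.
  rewrite -rmorphD/= lecR !div1r !exprS !invfM.
  have : 0 <= (2 ^+ n)^-1 :> R by rewrite invr_ge0 exprn_ge0.
  lra.
have [G GL Gg] := cLfun_cauchy_limit gL le_g.
apply/cvg_ex; exists (cLclass mu p1 G); apply/fcvg_ballP => e e0.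
(* The radius e lives in R[i], where a positive element is real. *)
have [eE r0] : e = (Re e)%:C%C /\ 0 < Re e.
  by move: e0; rewrite ltcE; case: e => [a b] /= /andP[/eqP -> ->].
have r5 : 0 < Re e / 5 by rewrite divr_gt0.
have [m _ /(_ m (leqnn m)) /= me] := near_infty_natSinv_expn_lt (PosNum r5).
apply: filterS (Fx m) => y; rewrite -ball_normE /= => xy.
rewrite -(subrKA (x m)) eE; apply: le_lt_trans (ler_normD _ _) _.
have [dE dL] := distE _ _ GL (gL m).
rewrite cLclass_repr in dE; rewrite dE.
apply: (@lt_le_trans _ _ ((4 * (1 / 2 ^+ m))%:C%C + (1 / 2 ^+ m.+1 : R)%:C%C)).
  apply: ler_ltD => //; rewrite lecR -lee_fin fineK ?cLnorm_fin//; exact: Gg.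
rewrite -rmorphD/= lecR; move: me; rewrite !div1r exprS invfM.
rewrite ltr_pdivlMr// => /ltW; apply: le_trans.
by rewrite -mulrDl mulrC ler_wpM2l ?invr_ge0 ?exprn_ge0.
Qed.

End Completeness.

Theorem theorem4p2 (R : realType) (H K : topologicalGroupType)
  (H_lc : locally_compact_group H) (K_lc : locally_compact_group K)
  (tau : cont_hom_aut H K)
  (muH : {measure set (borel H) -> \bar R}) (muH_haar : left_haar_measure muH)
  (muK : {measure set (borel K) -> \bar R}) (muK_haar : left_haar_measure muK)
  (delta : H -> R) (delta_modulus : is_modulus tau muK delta)
  (lam : {measure set (borel (semidirect tau)) -> \bar R})
  (lam_haar : left_haar_measure lam)
  (lam_def : is_delta_dh_dk muH muK delta lam)
  (p : \bar R) (p1 : (1 <= p)%E) :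
  (forall f u : borel (semidirect tau) -> R[i],
      f \in cLfun lam (lexx (1 : \bar R)%E) -> u \in cLfun lam p1 ->
    [/\ \forall x \ae lam, tau_conv_converges muH muK delta f u x,
        tau_conv muH muK delta f u \in cLfun lam p1 &
        tau_act muH muK delta (cLclass lam (lexx (1 : \bar R)%E) f)
          (cLclass lam p1 u) =
        cLclass lam p1 (tau_conv muH muK delta f u)]) /\
  left_banach_module
    (tau_act muH muK delta (lam := lam) (p1 := lexx (1 : \bar R)%E))
    (tau_act muH muK delta (lam := lam) (p1 := p1)).
Proof.
have bil q (q1 : (1 <= q)%E) :=
  bilinear_tau_act H_lc K_lc muH_haar muK_haar delta_modulus lam_haar lam_def q1.
split.
  move=> f u fL uL; split.
  - exact: (ae_tau_conv_converges H_lc K_lc muH_haar muK_haar delta_modulus lam_haar lam_def fL uL).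
  - exact: (tau_conv_cLfun H_lc K_lc muH_haar muK_haar delta_modulus lam_haar lam_def fL uL).
  - exact: (tau_act_class H_lc K_lc muH_haar muK_haar delta_modulus lam_haar lam_def fL uL).
split.
- split.
  + exact: cLspace_banach.
  + exact: bil.
  + move=> a b c; symmetry.
    exact: (tau_act_assoc H_lc K_lc muH_haar muK_haar delta_modulus lam_haar lam_def).
  + exact: (norm_tau_act_le H_lc K_lc muH_haar muK_haar delta_modulus lam_haar lam_def).
- exact: cLspace_banach.
- exact: bil.
- exact: (tau_act_assoc H_lc K_lc muH_haar muK_haar delta_modulus lam_haar lam_def).
- exact: (norm_tau_act_le H_lc K_lc muH_haar muK_haar delta_modulus lam_haar lam_def).
Qed.
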